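(* Let $f:\subseteq 2^\omega\to2^\omega$ be a partial computable injection (injective on its domain) and let $w$ be a real with $w\geq_{LR}\emptyset'$. Then $f$ is not oneway relative to $w$.
   Context: Reals are elements of $2^\omega$; $\mu$ is the uniform measure on $2^\omega$; $x\oplus y$ is the real $z$ with $z(2n)=x(n)$, $z(2n+1)=y(n)$. ''Random'' means Martin-Löf random, and ''$y$-random'' means Martin-Löf random relative to the oracle $y$. $\emptyset'$ is the halting set. $x\leq_{LR}y$ (equivalently $y\geq_{LR}x$) means that every $y$-random real is $x$-random. A partial function $g:\subseteq 2^\omega\to 2^\omega$ is partial $w$-computable, written $g\leq_T w$, if there is an oracle Turing machine that, with oracles $x$ and $w$, outputs successive bits of $g(x)$; $g(x)$ is defined exactly when infinitely many bits are output. Partial computable means partial $w$-computable for computable $w$. A partial function $g$ is a probabilistic inversion of $f$ if $\mu(\{y\oplus r: f(g(y\oplus r))=y\})>0$. $f$ is random-preserving if $\mu(\mathsf{dom}(f))>0$ and $f(x)$ is random for each random $x\in\mathsf{dom}(f)$, where $\mathsf{dom}(f)$ is the domain of $f$. $f$ is oneway relative to $w$ if it is partial computable, random-preserving, and has no probabilistic inversion $g\leq_T w$. *)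

(* Defs.v *)
From HB Require Import structures.
From mathcomp Require Import all_boot all_order all_algebra.
From mathcomp Require Import all_classical all_reals all_analysis.

Set Implicit Arguments.
Unset Strict Implicit.
Unset Printing Implicit Defensive.

From mathcomp Require Import zify.

Import Order.TTheory GRing.Theory Num.Theory.

Local Open Scope classical_set_scope.

(* An oracle Turing machine with m oracles has m read-only tapes carrying the *)
(* oracles, a positive number of work tapes, and an output stream to which a  *)
(* transition may append one bit.  All tapes are infinite to the right only;  *)
(* a head that is told to move left from cell 0 stays there.                  *)

Definition symbol (s : nat) : finType := option (bool + 'I_s).
Definition blank {s : nat} : option (bool + 'I_s) := None.

(* 'I_3 encodes the three head moves: 0 = left, 1 = stay, 2 = right. *)
Definition move : finType := 'I_3.
Definition move_head (d : move) (p : nat) : nat := (p + d).-1.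

(* A machine of shape (q, s, k) has q.+1 states with initial state ord0,      *)
(* k.+1 work tapes, and s work symbols besides the blank and the two bits.    *)
Definition mshape : Type := (nat * nat * nat)%type.
Definition nstates (p : mshape) : nat := p.1.1.
Definition nextra (p : mshape) : nat := p.1.2.
Definition ntapes (p : mshape) : nat := p.2.

(* The state and the symbols under the oracle heads and the work heads. *)
Definition situation (m : nat) (p : mshape) : finType :=
  ('I_(nstates p).+1 * {ffun 'I_m -> bool}
   * {ffun 'I_(ntapes p).+1 -> symbol (nextra p)})%type.

(* The new state, the moves of the oracle heads, what the work heads write    *)
(* and how they move, and the bit that is output, if any.                     *)
Definition action (m : nat) (p : mshape) : finType :=
  ('I_(nstates p).+1 * {ffun 'I_m -> move}
   * {ffun 'I_(ntapes p).+1 -> symbol (nextra p) * move} * option bool)%type.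

(* The machine halts when its transition table has no entry. *)
Definition table (m : nat) (p : mshape) : finType :=
  {ffun situation m p -> option (action m p)}.

Definition machine (m : nat) : countType := {p : mshape & table m p}.

Section Run.
Context {m : nat} (M : machine m) (oracles : m.-tuple cantor_space).

Record config := Config {
  cstate : 'I_(nstates (tag M)).+1;
  coracle : 'I_m -> nat;
  chead : 'I_(ntapes (tag M)).+1 -> nat;
  ctape : 'I_(ntapes (tag M)).+1 -> nat -> symbol (nextra (tag M));
  coutput : seq bool }.

Definition init (input : seq bool) : config := Config
  ord0 (fun=> 0) (fun=> 0)
  (fun i n => if i == ord0 then omap inl (onth input n) else blank)
  [::].

Definition current (c : config) : situation m (tag M) :=
  (cstate c,
   [ffun j => (tnth oracles j : nat -> bool) (coracle c j)],
   [ffun i => ctape c i (chead c i)]).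

Definition act (c : config) (a : action m (tag M)) : config :=
  let: (q, od, wd, out) := a in Config
    q
    (fun j => move_head (od j) (coracle c j))
    (fun i => move_head (wd i).2 (chead c i))
    (fun i n => if n == chead c i then (wd i).1 else ctape c i n)
    (if out is Some b then rcons (coutput c) b else coutput c).

Definition step (c : config) : option config :=
  omap (act c) (tagged M (current c)).

Definition run (t : nat) (input : seq bool) : option config :=
  iter t (obind step) (Some (init input)).

Definition halts (input : seq bool) : Prop := exists t, run t input = None.

(* Started with blank work tapes, the machine outputs exactly the bits of y;  *)
(* if it outputs only finitely many bits then this holds for no y.            *)
Definition outputs (y : cantor_space) : Prop :=
  forall n, exists t c,
    [/\ run t [::] = Some c, (n < size (coutput c))%N
      & nth false (coutput c) n = (y : nat -> bool) n].

End Run.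

Definition computable (w : cantor_space) : Prop :=
  exists M : machine 0, outputs M [tuple] w.

(* f x = None means that f is undefined at x. *)
Definition pfun := cantor_space -> option cantor_space.

Definition pdom (f : pfun) : set cantor_space :=
  [set x | exists y, f x = Some y].

Definition partial_computable_in (w : cantor_space) (g : pfun) : Prop :=
  exists M : machine 2, forall x y, g x = Some y <-> outputs M [tuple x; w] y.

Definition partial_computable (f : pfun) : Prop :=
  exists2 w, computable w & partial_computable_in w f.

Definition pinjective (f : pfun) : Prop :=
  forall x1 x2 y, f x1 = Some y -> f x2 = Some y -> x1 = x2.

Definition oplus (x y : cantor_space) : cantor_space :=
  fun n => if odd n then (y : nat -> bool) n./2 else (x : nat -> bool) n./2.

(* A bijection between nat * nat and nat. *)
Definition npair (e n : nat) : nat := (2 ^ e * n.*2.+1).-1.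

(* The halting problem for oracle-free machines, numbered by pickle, on the   *)
(* inputs 1^n.                                                                *)
Definition halting_set : cantor_space := fun p =>
  `[< exists (M : machine 0) (n : nat),
        p = npair (pickle M) n /\ halts M [tuple] (nseq n true) >].

Definition cylinder (s : seq bool) : set cantor_space :=
  [set x | mkseq (x : nat -> bool) (size s) = s].

Definition cantor_borel := g_sigma_algebraType (range cylinder).

Local Open Scope ring_scope.

Section UniformMeasure.
Context (R : realType).
Notation mu := (@lebesgue_measure R).

Definition binary (t : R) : cantor_borel :=
  fun n => odd (Num.truncn (t * 2 ^+ n.+1)).

(* The law of the binary expansion of a uniformly distributed point of the    *)
(* unit interval; see uniform_measure_cylinder for its values on cylinders.   *)
Definition uniform_measure : set cantor_borel -> \bar R :=
  pushforward (mrestr mu (measurable_itv `[0, 1[)) binary.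

Lemma truncn_half (t : R) : 0 <= t ->
  Num.truncn (t * 2) = (Num.truncn t * 2 + odd (Num.truncn (t * 2)))%N.
Proof.
move=> t0; have t20 : 0 <= t * 2 by rewrite mulr_ge0.
have -> : Num.truncn t = (Num.truncn (t * 2))./2.
  apply/truncn_def; apply/andP; split.
    rewrite -(ler_pM2r (ltr0n R 2)) (@le_trans _ _ (Num.truncn (t * 2))%:R) ?truncn_le//.
    by rewrite -natrM ler_nat muln2 -[leqRHS]odd_double_half leq_addl.
  rewrite -(ltr_pM2r (ltr0n R 2)) (lt_le_trans (truncnS_gt _)) //.
  rewrite -natrM ler_nat muln2 doubleS -[X in (X.+1 <= _)%N]odd_double_half.
  by case: odd.
by rewrite muln2 addnC odd_double_half.
Qed.

Definition binval (s : seq bool) : nat := 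
  foldl (fun (v : nat) (b : bool) => (v * 2 + b)%N) 0%N s.

Lemma binval_rcons s b : binval (rcons s b) = (binval s * 2 + b)%N.
Proof. by rewrite /binval -cats1 foldl_cat. Qed.

Lemma binval_lt s : (binval s < 2 ^ size s)%N.
Proof.
elim/last_ind: s => [//|s b IH]; rewrite binval_rcons size_rcons expnSr.
by apply: (@leq_trans ((binval s).+1 * 2)); [rewrite mulSn; case: b; lia|lia].
Qed.

Lemma binval_inj s1 s2 :
  size s1 = size s2 -> binval s1 = binval s2 -> s1 = s2.
Proof.
elim/last_ind: s1 s2 => [|s1 b1 IH] s2; first by case: s2.
case/lastP: s2 => [|s2 b2]; first by rewrite size_rcons.
rewrite !size_rcons !binval_rcons => -[/IH{}IH] e.
have e' : b1 = b2 by case: b1 b2 e => -[] //; lia.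
by rewrite e' IH //; move: e; rewrite e'; lia.
Qed.

Lemma binval_binary (t : R) n : 0 <= t < 1 ->
  binval (mkseq (binary t) n) = Num.truncn (t * 2 ^+ n).
Proof.
move=> /andP[t0 t1]; elim: n => [|n IH].
  by rewrite expr0 mulr1; apply/esym/truncn_def; rewrite t0.
rewrite mkseqS binval_rcons IH exprSr mulrA truncn_half ?mulr_ge0 ?exprn_ge0//.
by rewrite /binary exprSr mulrA.
Qed.

Lemma cylinder_binary (s : seq bool) :
  binary @^-1` cylinder s `&` `[0, 1[ =
  [set` `[(binval s)%:R / 2 ^+ size s, (binval s).+1%:R / 2 ^+ size s[].
Proof.
have p0 : 0 < 2 ^+ size s :> R by rewrite exprn_gt0.
apply/seteqP; split => t.
  rewrite /cylinder /preimage /= => -[e]; rewrite !in_itv /= => t01.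
  have /andP[t0 _] := t01.
  have := binval_binary (size s) t01; rewrite e => /esym/eqP.
  rewrite truncn_eq ?mulr_ge0 ?exprn_ge0// => /andP[h1 h2].
  by rewrite ler_pdivrMr// ltr_pdivlMr// h1.
rewrite /= !in_itv /= ler_pdivrMr// ltr_pdivlMr// => /andP[h1 h2].
have t0 : 0 <= t.
  by rewrite -(pmulr_lge0 _ p0) (le_trans _ h1).
have t1 : t < 1.
  rewrite -(ltr_pM2r p0) mul1r (lt_le_trans h2)// -natrX ler_nat.
  exact: binval_lt.
split; last by rewrite t0.
apply: binval_inj; first by rewrite size_mkseq.
rewrite binval_binary ?t0//; apply: truncn_def; by rewrite h1.
Qed.

Lemma uniform_measure_cylinder (s : seq bool) :
  uniform_measure (cylinder s) = (2 ^- size s)%:E.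
Proof.
have p0 : 0 < 2 ^+ size s :> R by rewrite exprn_gt0.
rewrite /uniform_measure /pushforward /mrestr cylinder_binary.
rewrite lebesgue_measure_itv /= lte_fin ltr_pM2r ?invr_gt0// ltr_nat ltnSn.
by rewrite -EFinD -mulrBl -natrB// subSnn mul1r.
Qed.

Lemma measurable_binary : measurable_fun [set: R] binary.
Proof.
apply: (@measurability _ _ (measurableTypeR R) cantor_borel _ _
  (range cylinder)) => //.
move=> _ [_ [s _ <-] <-]; rewrite setTI.
have mb n b : measurable [set t : R | binary t n = b].
  pose T k := [set t : R | (Num.truncn (t * 2 ^+ n.+1) <= k)%N].
  have p0 : 0 < 2 ^+ n.+1 :> R by rewrite exprn_gt0.
  have mT k : measurable (T k).
    suff -> : T k = [set` `]-oo, k.+1%:R / 2 ^+ n.+1[] by exact: measurable_itv.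
    apply/seteqP; split => t; rewrite /T /= in_itv /= truncn_le_nat;
      by rewrite ltr_pdivlMr.
  have -> : [set t : R | binary t n = b] =
      \bigcup_(k in [set k | odd k = b])
        (T k `&` ~` [set t : R | (Num.truncn (t * 2 ^+ n.+1) < k)%N]).
    apply/seteqP; split => [t <-|t [k /= <- [h1 /negP h2]]].
      by exists (Num.truncn (t * 2 ^+ n.+1)) => //; split; rewrite /T /= ?ltnn.
    rewrite /binary; congr odd; apply/eqP.
    by rewrite eqn_leq [X in X && _]h1 leqNgt.
  apply: bigcup_measurable => k _; apply: measurableI => //.
  apply: measurableC; case: k => [|k]; last exact: mT.
  by rewrite [X in measurable X](_ : _ = set0)//; apply/seteqP; split.
suff -> : binary @^-1` cylinder s =
    \bigcap_(i in [set i | (i < size s)%N])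
      [set t | binary t i = nth false s i].
  by apply: bigcap_measurableType => i _; exact: mb.
apply/seteqP; split => [t e i /= si|t h].
  by rewrite -[in RHS]e nth_mkseq.
apply: (@eq_from_nth _ false); first by rewrite size_mkseq.
by move=> i; rewrite size_mkseq => si; rewrite nth_mkseq// h.
Qed.

Let uniform_measure0 : uniform_measure set0 = 0%E.
Proof. by have mf := measurable_binary; exact: measure0. Qed.

Let uniform_measure_ge0 A : (0 <= uniform_measure A)%E.
Proof. by have mf := measurable_binary; exact: measure_ge0. Qed.

Let uniform_measure_sigma_additive : semi_sigma_additive uniform_measure.
Proof.
by have mf := measurable_binary; exact: measure_semi_sigma_additive.
Qed.

HB.instance Definition _ := isMeasure.Build _ _ _ uniform_measure
  uniform_measure0 uniform_measure_ge0 uniform_measure_sigma_additive.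

Let uniform_measure_setT : uniform_measure [set: _] = 1%E.
Proof.
rewrite (_ : [set: _] = cylinder [::]).
  by rewrite uniform_measure_cylinder expr0 invr1.
by apply/seteqP; split.
Qed.

HB.instance Definition _ := Measure_isProbability.Build _ _ _
  uniform_measure uniform_measure_setT.

End UniformMeasure.

(* W n s means that the string s is enumerated into the n-th set.  The pair   *)
(* (n, s) is presented to the machine as the input word 1^n 0 s.              *)
Definition uniformly_ce (m : nat) (oracles : m.-tuple cantor_space)
    (W : nat -> set (seq bool)) : Prop :=
  exists M : machine m, forall n s,
    W n s <-> halts M oracles (nseq n true ++ false :: s).

Definition open_of (S : set (seq bool)) : set cantor_space :=
  \bigcup_(s in S) cylinder s.

Section Randomness.
Context (R : realType).

Definition ml_test (m : nat) (oracles : m.-tuple cantor_space)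
    (W : nat -> set (seq bool)) : Prop :=
  uniformly_ce oracles W /\
  forall n, (uniform_measure R (open_of (W n)) <= (2 ^- n)%:E)%E.

Definition ml_random (m : nat) (oracles : m.-tuple cantor_space)
    (x : cantor_space) : Prop :=
  forall W, ml_test oracles W -> ~ (\bigcap_n open_of (W n)) x.

Definition random (x : cantor_space) : Prop := ml_random [tuple] x.

Definition random_in (y x : cantor_space) : Prop := ml_random [tuple y] x.

Definition le_LR (x y : cantor_space) : Prop :=
  forall z, random_in y z -> random_in x z.

Definition probabilistic_inversion (f g : pfun) : Prop :=
  (0 < uniform_measure R
     [set z | exists y r x,
        [/\ z = oplus y r, g (oplus y r) = Some x & f x = Some y]])%E.

Definition random_preserving (f : pfun) : Prop :=
  (0 < uniform_measure R (pdom f))%E /\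
  forall x y, random x -> f x = Some y -> random y.

Definition oneway (w : cantor_space) (f : pfun) : Prop :=
  [/\ partial_computable f, random_preserving f &
      ~ exists2 g, partial_computable_in w g & probabilistic_inversion f g].

End Randomness.

(* Main.v *)
(* Let D_n be the set of x for which f outputs at least n bits, so that the   *)
(* domain of f is the intersection of the D_n.  With the halting problem one  *)
(* finds stages at which all but 2^-(n+j) of D_n has been enumerated; the     *)
(* points missed at one of these stages form an open set U, generated by a    *)
(* 0'-decidable prefix-free set of strings, that contains the complement of   *)
(* the domain and has measure less than 1 for large j.  Since w >=_LR 0', U   *)
(* is contained in a Sigma^0_1(w) open set V of measure less than 1: else     *)
(* one builds, avoiding one w-test after the other, a w-random x consisting   *)
(* of infinitely many consecutive blocks from U, and x is not 0'-random       *)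
(* because n blocks have measure mu(U)^n.  So f is total, continuous and      *)
(* injective on the complement P of V, which is compact, of positive measure  *)
(* and Pi^0_1(w), and w computes f^-1 on f(P): to find a bit of x, wait until *)
(* all prefixes still compatible with P and y agree on it.  Finally           *)
(* mu(f(P)) > 0: the strings s with mu(f^-1[s]) > 2^k 2^-|s| form a           *)
(* Martin-Loef test, so that for some k a non-null part of P is mapped        *)
(* outside its k-th member, and there f^-1 enlarges measure by at most 2^k.   *)

From HB Require Import structures.
Require Import Defs.
From mathcomp Require Import all_boot all_order all_algebra.
From mathcomp Require Import all_classical all_reals all_analysis.
From mathcomp Require Import zify ring lra.

Set Implicit Arguments.
Unset Strict Implicit.
Unset Printing Implicit Defensive.

Import Order.TTheory GRing.Theory Num.Theory.

(** * Counter programs and their compilation to Turing machines *)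

(** The difficulty in inverting [f] is that its domain is only Pi^0_2: a candidate prefix of a
    preimage may never be refuted although no extension of it lies in the domain. The cure is to
    replace the domain by a closed set P of positive measure that is co-enumerable in [w], where
    compactness applies.

    With the halting problem one can tell when nearly all points that ever yield n bits have done
    so. Discarding the latecomers gives an open set with complement inside the domain
    ([not_bad_pdom]) and measure below 1 ([lam_bad]), but it is enumerable in 0' only.
    [cover_halting_open] encloses it in an open set of measure below 1 enumerable in [w]; this is
    where the LR hypothesis enters, through a w-random real built from blocks ([random_outside])
    that 0' would recognize as non-random ([blocks_not_random]).

    On P, the complement of the larger set, injectivity and König's lemma show that every bit of the
    preimage of y is decided at a finite stage ([exists_forces]), so [w] computes the inverse
    ([inversion_exists]). The image of P is not null, because a random-preserving map cannot squeeze
    positive measure into a null set: strings with too large a preimage form a test ([heavy_test]),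
    and off its k-th member the inverse enlarges measure by at most 2^k ([values_prefix_measure]).
    Both measure estimates rest on [maximal_inequality].

    All computability goes through [term], a language of primitive recursive functions with oracles;
    unbounded search occurs only as an outermost existential quantifier. [semidecider_halts] and
    [streamer_outputs] turn terms into machines, [den_run] turns machines into terms, so that
    effectiveness is shown by exhibiting a term. *)

Inductive test := Pos of nat | InSome | InTrue | OTrue of nat.

Inductive cmd :=
  | Skip | Mark | Inc of nat | Dec of nat | InNext | OLeft of nat
  | ORight of nat | Out of bool | Seq of cmd & cmd | While of test & cmd
  | If of test & cmd.

HB.instance Definition _ := gen_eqMixin cmd.

Record state := State {
  reg : nat -> nat; ipos : nat; opos : nat -> nat; out : seq bool }.

Definition state0 : state := State (fun=> 0) 0 (fun=> 0) [::].

Definition upd (f : nat -> nat) (r v : nat) : nat -> nat :=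
  fun x => if x == r then v else f x.

Definition cont (b : bool) (c : cmd) (k : seq cmd) : seq cmd :=
  match c with
  | Seq a b => [:: a, b & k]
  | While _ a => if b then [:: a, c & k] else k
  | If _ a => if b then a :: k else k
  | _ => k
  end.

Definition effect (c : cmd) (s : state) : state :=
  match c with
  | Inc r => State (upd (reg s) r (reg s r).+1) (ipos s) (opos s) (out s)
  | Dec r => State (upd (reg s) r (reg s r).-1) (ipos s) (opos s) (out s)
  | InNext => State (reg s) (ipos s).+1 (opos s) (out s)
  | OLeft j => State (reg s) (ipos s) (upd (opos s) j (opos s j).-1) (out s)
  | ORight j => State (reg s) (ipos s) (upd (opos s) j (opos s j).+1) (out s)
  | Out b => State (reg s) (ipos s) (opos s) (rcons (out s) b)
  | _ => s
  end.

Section Semantics.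
Variables (O : nat -> nat -> bool) (input : seq bool).

Definition tst (t : test) (s : state) : bool :=
  match t with
  | Pos r => 0 < reg s r
  | InSome => ipos s < size input
  | InTrue => nth false input (ipos s)
  | OTrue j => O j (opos s j)
  end.

Definition ctest (c : cmd) (s : state) : bool :=
  match c with While t _ | If t _ => tst t s | _ => false end.

Definition cstep (x : seq cmd * state) : option (seq cmd * state) :=
  if x.1 is c :: k then Some (cont (ctest c x.2) c k, effect c x.2) else None.

Definition csteps (n : nat) (x : seq cmd * state) : option (seq cmd * state) :=
  iter n (obind cstep) (Some x).

End Semantics.

Fixpoint cregs (c : cmd) : nat :=
  let tregs t := if t is Pos r then r.+1 else 0 in
  match c with
  | Inc r | Dec r => r.+1
  | Seq a b => maxn (cregs a) (cregs b)
  | While t a | If t a => maxn (tregs t) (cregs a)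
  | _ => 0
  end.

(** The stacks met while [c] runs on top of [k], without [k] itself. Finitely many suffice because a
    loop body runs on top of the very stack that started the loop; they become the states of the
    machine. *)
Fixpoint reach (c : cmd) (k : seq cmd) : seq (seq cmd) :=
  (c :: k) ::
  match c with
  | Seq a b => reach a (b :: k) ++ reach b k
  | While _ a => reach a (c :: k)
  | If _ a => reach a k
  | _ => [::]
  end.

Lemma reach_self c k : c :: k \in reach c k.
Proof. by case: c => [||r|r||j|j|b|a b|t a|t a]; apply: mem_head. Qed.

Lemma reach_cont c k s : s \in reach c k ->
  exists c' k', s = c' :: k' /\ forall b, cont b c' k' \in k :: reach c k.
Proof.
elim: c k s => [||r|r||j|j|b0|a IHa b IHb|t a IHa|t a IHa] k s;
  try by (rewrite inE => /eqP ->; eexists; eexists; split; [reflexivity|move=> b; rewrite in_cons eqxx]).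
- rewrite /= in_cons mem_cat => /orP[/eqP->|/orP[/IHa|/IHb]].
  + exists (Seq a b), k; split=> // b0.
    by rewrite /= !in_cons mem_cat reach_self !orbT.
  + move=> [c' [k' [-> H]]]; exists c', k'; split=> // b0.
    move: (H b0); rewrite !in_cons !mem_cat => /orP[/eqP->|->].
      by rewrite reach_self !orbT.
    by rewrite !orbT.
  + move=> [c' [k' [-> H]]]; exists c', k'; split=> // b0.
    move: (H b0); rewrite !in_cons !mem_cat => /orP[->//|->].
    by rewrite !orbT.
- rewrite /= in_cons => /orP[/eqP->|/IHa].
  + exists (While t a), k; split=> // -[] /=; rewrite !in_cons ?eqxx //.
    by rewrite reach_self !orbT.
  + move=> [c' [k' [-> H]]]; exists c', k'; split=> // b0.
    by move: (H b0); rewrite !in_cons => /orP[->|->]; rewrite !orbT.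
- rewrite /= in_cons => /orP[/eqP->|/IHa].
  + exists (If t a), k; split=> // -[] /=; rewrite !in_cons ?eqxx //.
    by rewrite reach_self !orbT.
  + move=> [c' [k' [-> H]]]; exists c', k'; split=> // b0.
    by move: (H b0); rewrite !in_cons => /orP[->|->]; rewrite ?orbT.
Qed.

Section Compile.
Variables (m : nat) (c0 : cmd).

(* The states of the machine are the continuations that can occur during the  *)
(* execution of [c0].  Counter [r] is the head position on tape [r.+1], whose  *)
(* cell 0 is marked in the first step so that zero can be tested.             *)
Definition states : seq (seq cmd) :=
  [:: Mark; c0] :: rcons (reach c0 [::]) [::].

Definition cshape : mshape := (size states, 1, cregs c0).

(** The stack [[:: Mark; c0]] heads [states] and so is the initial state [ord0]; an index past the
    list decodes to [[::]], which has no transition. *)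
Definition sidx (k : seq cmd) : 'I_(nstates cshape).+1 := inord (index k states).
Definition sof (q : 'I_(nstates cshape).+1) : seq cmd := nth [::] states q.

Lemma sidxK k : k \in states -> sof (sidx k) = k.
Proof.
move=> kL; rewrite /sof /sidx inordK ?nth_index//.
by rewrite ltnS; apply: index_size.
Qed.

Lemma states_cont b c k : c :: k \in states -> cont b c k \in states.
Proof.
rewrite /states !in_cons -cats1 !mem_cat => /orP[/eqP[-> ->]|].
  by rewrite reach_self orbT.
rewrite mem_seq1 orbF => /reach_cont[c' [k' [[-> ->] /(_ b)]]].
by rewrite in_cons inE => /orP[->|->]; rewrite !orbT.
Qed.

Definition marker : symbol 1 := Some (inr ord0).
Definition tape_of (r : nat) : 'I_(ntapes cshape).+1 := inord r.+1.

Definition sit_tst (t : test) (a : situation m cshape) : bool :=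
  match t with
  | Pos r => a.2 (tape_of r) != marker
  | InSome => a.2 ord0 != blank
  | InTrue => a.2 ord0 == Some (inl true)
  | OTrue j => if insub j is Some j' then a.1.2 j' else false
  end.

Definition mleft : move := @Ordinal 3 0 isT.
Definition mstay : move := @Ordinal 3 1 isT.
Definition mright : move := @Ordinal 3 2 isT.

Definition sit_action (a : situation m cshape) : option (action m cshape) :=
  if sof a.1.1 is c :: k then
    let b := match c with While t _ | If t _ => sit_tst t a | _ => false end in
    Some (sidx (cont b c k),
      [ffun j : 'I_m => match c with
         | OLeft j' => if nat_of_ord j == j' then mleft else mstay
         | ORight j' => if nat_of_ord j == j' then mright else mstay
         | _ => mstay end],
      [ffun i : 'I_(ntapes cshape).+1 =>
         (if c is Mark then if i == ord0 then a.2 i else marker else a.2 i,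
          match c with
          | Inc r => if i == tape_of r then mright else mstay
          | Dec r => if i == tape_of r then mleft else mstay
          | InNext => if i == ord0 then mright else mstay
          | _ => mstay end)],
      if c is Out b then Some b else None)
  else None.

Definition compile : machine m :=
  existT (fun p => table m p : Type) cshape [ffun a => sit_action a].

Definition tuple_oracle (T : m.-tuple cantor_space) : nat -> nat -> bool :=
  fun j => nth (fun=> false) T j.

Variables (T : m.-tuple cantor_space) (input : seq bool).
Local Notation O := (tuple_oracle T).

Definition regs_ok (k : seq cmd) : bool := all (fun c => cregs c <= cregs c0) k.

Lemma regs_ok_cont b c k : regs_ok (c :: k) -> regs_ok (cont b c k).
Proof.
case: c => [||r|r||j|j|b'|x y|t x|t x] /andP[H1 H2] //=.
- by move: H1; rewrite geq_max => /andP[-> ->].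
- move: H1 => /=; rewrite geq_max => /andP[H0 H1].
  by case: b => //=; rewrite H1 geq_max H0 H1.
- move: H1 => /=; rewrite geq_max => /andP[H0 H1].
  by case: b => //=; rewrite H1.
Qed.

Definition simulates (x : seq cmd * state) (c : config compile) : Prop :=
  [/\ [/\ x.1 \in states, regs_ok x.1, cstate c = sidx x.1 & coutput c = out x.2],
      (forall j : 'I_m, coracle c j = opos x.2 j) /\ chead c ord0 = ipos x.2,
      (forall r, r < cregs c0 -> chead c (tape_of r) = reg x.2 r),
      (forall p, ctape c ord0 p = omap inl (onth input p)) &
      forall r p, r < cregs c0 -> (ctape c (tape_of r) p == marker) = (p == 0)].

Lemma tape_of_inj r r' : r < cregs c0 -> r' < cregs c0 ->
  (tape_of r == tape_of r') = (r == r').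
Proof.
move=> h h'; apply/eqP/eqP => [/(congr1 val)|->//].
by rewrite /= !inordK // => -[].
Qed.

Lemma tape_of_neq0 r : r < cregs c0 -> (tape_of r == ord0) = false.
Proof. by move=> h; apply/negP => /eqP /(congr1 val); rewrite /= inordK. Qed.

Lemma tuple_oracleE (j : 'I_m) n : O j n = (tnth T j : nat -> bool) n.
Proof. by rewrite /tuple_oracle (tnth_nth (fun=> false)). Qed.

Lemma simulates_tst t x c : simulates x c ->
  (if t is Pos r then r < cregs c0 else true) ->
  sit_tst t (current T c) = tst O input t x.2.
Proof.
move=> [_ [Ho Hi] Hr H0 Hm]; case: t => [r|||j] /= ok.
- by rewrite ffunE Hm // Hr // lt0n.
- rewrite ffunE H0 Hi.
  by rewrite -onthTE; case: (onth input _).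
- by rewrite ffunE H0 Hi -odflt_onth; case: (onth input _) => [[]|].
- case: insubP => [j' _ <-|]; first by rewrite ffunE -tuple_oracleE Ho.
  by rewrite -leqNgt => h; rewrite /tuple_oracle nth_default // size_tuple.
Qed.

Lemma move_stay p : move_head mstay p = p.
Proof. by rewrite /move_head addn1. Qed.
Lemma move_left p : move_head mleft p = p.-1.
Proof. by rewrite /move_head addn0. Qed.
Lemma move_right p : move_head mright p = p.+1.
Proof. by rewrite /move_head addn2. Qed.

Definition move_simpl := (move_stay, move_left, move_right).

(** [Mark] is excluded: it writes the marker under every counter head, which is right only while all
    heads are on cell 0. [run_csteps] treats it as the first machine step, whence its shift from [t]
    to [t.+1]. *)
Lemma simulates_step x c : simulates x c -> match x.1 with
  | Mark :: _ => True | _ =>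
  match cstep O input x, step T c with
  | Some x', Some c' => simulates x' c' | None, None => True | _, _ => False
  end end.
Proof.
case: x => k s Sim; have := Sim => -[/= [kL kr qc oc] [Ho Hi] Hr H0 Hm].
rewrite /step ffunE /sit_action /= qc sidxK //.
case: k kL kr qc Sim => [//|d k] kL kr qc Sim.
have tE t : (if t is Pos r then r < cregs c0 else true) ->
   sit_tst t (current T c) = tst O input t s by move=> h; exact: (simulates_tst Sim h).
have bE : (match d with While t _ | If t _ => sit_tst t (current T c) | _ => false end)
    = ctest O input d s.
  have: cregs d <= cregs c0 by case/andP: kr.
  case: d {kL kr qc Sim} => // t a /=; rewrite geq_max => /andP[h _]; apply: tE; by case: t h.
rewrite /current qc /= in bE; rewrite /= bE.
have [/= kL' kr'] : cont (ctest O input d s) d k \in states /\ 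
    regs_ok (cont (ctest O input d s) d k).
  by split; [apply: states_cont | apply: regs_ok_cont].
have dc : cregs d <= cregs c0 by case/andP: kr.
(* Writing back the scanned symbol leaves the tape unchanged. *)
have tt p (i : 'I_(cregs c0).+1) : (if p == chead c i then
    ctape c i (chead c i) else ctape c i p) = ctape c i p by case: eqP => [->|].
case: d kL kr qc Sim bE kL' kr' dc => [||r|r||j|j|b'|x y|t x|t x] // kL kr qc Sim bE kL' kr' dc;
 (split; [split=> //=; by rewrite ?oc | split | | | ]); rewrite /=;
 try (by move=> j0; rewrite !ffunE ?move_simpl //);
 try (by rewrite !ffunE /= ?move_simpl // 1?eq_sym ?tape_of_neq0 ?move_simpl //);
 try (by move=> r0 h; rewrite !ffunE /= ?tape_of_neq0 ?move_simpl ?Hr //);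
 try (by move=> r0; rewrite !ffunE /= tt H0);
 try (by move=> r0 p h; rewrite !ffunE /= tt Hm).
- move=> r0 h; rewrite !ffunE /= tape_of_inj // /upd.
  by case: eqP => [->|]; rewrite move_simpl // Hr.
- move=> r0 h; rewrite !ffunE /= tape_of_inj // /upd.
  by case: eqP => [->|]; rewrite move_simpl // Hr.
- by rewrite !ffunE /= move_simpl Hi.
- by move=> j0; rewrite !ffunE /upd; case: eqP => [<-|]; rewrite move_simpl // Ho.
- by move=> j0; rewrite !ffunE /upd; case: eqP => [<-|]; rewrite move_simpl // Ho.
Qed.

Fixpoint markfree (c : cmd) : bool :=
  match c with
  | Mark => false
  | Seq a b => markfree a && markfree b
  | While _ a | If _ a => markfree a
  | _ => true
  end.

Lemma markfree_cont b c k :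
  all markfree (c :: k) -> all markfree (cont b c k).
Proof.
case: c => [||r|r||j|j|b'|x y|t x|t x] //= /andP[].
- by move=> /andP[-> ->].
- by case: b => //= -> ->.
- by case: b => //= -> ->.
Qed.

Lemma run_csteps t : markfree c0 ->
  match csteps O input t ([:: c0], state0), run compile T t.+1 input with
  | Some x, Some c => all markfree x.1 /\ simulates x c
  | None, None => True | _, _ => False end.
Proof.
move=> mf; elim: t => [|t IH].
  have c0L : [:: c0] \in states by rewrite !in_cons mem_rcons in_cons reach_self !orbT.
  have -> : run compile T 1 input = step T (init compile input) by [].
  rewrite /csteps /step ffunE /sit_action.
  have -> : sof (current T (init compile input)).1.1 = [:: Mark; c0] by [].
  split; first by rewrite /= mf.
  split=> //=.
  - by rewrite c0L leqnn.
  - by split=> [j|]; rewrite !ffunE move_simpl.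
  - by move=> r rl; rewrite !ffunE move_simpl.
  - move=> p; rewrite !ffunE /=; by case: p => //=.
  - move=> r p rl; rewrite !ffunE /= tape_of_neq0 //.
    by case: (p == 0).
have -> : run compile T t.+2 input = obind (step T) (run compile T t.+1 input) by [].
rewrite /csteps iterS -/(csteps O input t _).
case: (csteps _ _ _ _) IH => [x|]; case: (run _ _ _ _) => [c|] //= [mx Sim].
have := simulates_step Sim; case: x mx Sim => -[|d k] s //= mx Sim.
case: d mx Sim => [||r|r||j|j|b'|a b|t' a|t' a] mx Sim; case: (step T c) => // c' Sim';
  (split=> //; by [apply: markfree_cont | case/andP: mx]).
Qed.

Lemma compile_halts : markfree c0 ->
  halts compile T input <-> exists t, csteps O input t ([:: c0], state0) = None.
Proof.
move=> mf; split=> -[t].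
  case: t => [//|t] E; have := run_csteps t mf; rewrite E.
  by case E' : (csteps _ _ _ _) => [|] // _; exists t.
move=> E; have := run_csteps t mf; rewrite E.
by case E' : (run _ _ _ _) => [|] // _; exists t.+1.
Qed.

End Compile.

Lemma compile_outputs m (c0 : cmd) (T : m.-tuple cantor_space) (y : cantor_space) :
  markfree c0 ->
  (forall n, exists t k s, csteps (tuple_oracle T) [::] t ([:: c0], state0) = Some (k, s) /\
     (n < size (out s) /\ nth false (out s) n = (y : nat -> bool) n)) ->
  outputs (compile m c0) T y.
Proof.
move=> mf H n; have [t [k [s [E [h1 h2]]]]] := H n.
have := run_csteps T [::] t mf; rewrite E.
case E' : (run _ _ _ _) => [c|] // [_ [[_ _ _ /= oc] _ _ _ _]].
by exists t.+1, c; split=> //; rewrite oc.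
Qed.

(** * Primitive recursive terms with oracles *)

Inductive term :=
  | Var of nat | Zero | Succ of term | Orc of nat & term
  | Let of term & term | Shift of term | Rec of term & term & term.

(* The environment lists the values of the de Bruijn variables; the step of   *)
(* [Rec] sees the previous value as variable 0 and the index as variable 1.   *)
Fixpoint den (O : nat -> nat -> bool) (t : term) (e : seq nat) : nat :=
  match t with
  | Var i => nth 0 e i
  | Zero => 0
  | Succ u => (den O u e).+1
  | Orc j u => O j (den O u e)
  | Let u v => den O v (den O u e :: e)
  | Shift u => den O u (behead e)
  | Rec n b f => nat_rec (fun=> nat) (den O b e)
                   (fun i x => den O f [:: x, i & e]) (den O n e)
  end.

Fixpoint rename (h : nat -> nat) (t : term) : term :=
  match t with
  | Var i => Var i
  | Zero => Zero
  | Succ u => Succ (rename h u)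
  | Orc j u => Orc (h j) (rename h u)
  | Let u v => Let (rename h u) (rename h v)
  | Shift u => Shift (rename h u)
  | Rec n b f => Rec (rename h n) (rename h b) (rename h f)
  end.

Lemma den_rename O h t e : den O (rename h t) e = den (O \o h) t e.
Proof.
elim: t e => [i||u IH|j u IH|u IHu v IHv|u IH|n IHn b IHb f IHf] e //=;
  rewrite ?IH ?IHu ?IHv ?IHn ?IHb //.
by elim: (den _ n e) => //= i ->; rewrite IHf.
Qed.

(** * Compiling terms to counter programs *)

Definition clear (r : nat) : cmd := While (Pos r) (Dec r).
Definition mv (r d : nat) : cmd := While (Pos r) (Seq (Dec r) (Inc d)).
Definition copy (r d x : nat) : cmd :=
  Seq (While (Pos r) (Seq (Dec r) (Seq (Inc d) (Inc x)))) (mv x r).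
(** Register [d] is used up to advance oracle head [j]; its copy in [d.+1] brings the head back, so
    that oracle heads rest on cell 0 between queries. *)
Definition query (j d : nat) : cmd :=
  Seq (While (Pos d) (Seq (Dec d) (Seq (ORight j) (Inc d.+1))))
 (Seq (If (OTrue j) (Inc d))
      (While (Pos d.+1) (Seq (Dec d.+1) (OLeft j)))).

(* [compute t env d] stores the value of [t] in register [d]; the variables   *)
(* live in the registers [env], all below [d], and the registers from [d] on  *)
(* are zero.                                                                  *)
Fixpoint compute (t : term) (env : seq nat) (d : nat) : cmd :=
  match t with
  | Var i => if i < size env then copy (nth 0 env i) d d.+1 else Skip
  | Zero => Skip
  | Succ u => Seq (compute u env d) (Inc d)
  | Orc j u => Seq (compute u env d) (query j d)
  | Let u v => Seq (compute u env d) (Seq (compute v (d :: env) d.+1)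
                 (Seq (clear d) (mv d.+1 d)))
  | Shift u => compute u (behead env) d
  | Rec n b f =>
      Seq (compute n env d) (Seq (compute b env d.+2)
     (Seq (While (Pos d)
            (Seq (compute f [:: d.+2, d.+1 & env] d.+3)
            (Seq (clear d.+2) (Seq (mv d.+3 d.+2) (Seq (Inc d.+1) (Dec d))))))
     (Seq (clear d.+1) (mv d.+2 d))))
  end.

Lemma markfree_compute t env d : markfree (compute t env d).
Proof.
elim: t env d => [i||u IH|j u IH|u IHu v IHv|u IH|n IHn b IHb f IHf] env d //=.
- by case: ifP.
- by rewrite IH.
- by rewrite IH.
- by rewrite IHu IHv.
- by rewrite IHn IHb IHf.
Qed.

Definition setr (s : state) (r v : nat) : state :=
  State (upd (reg s) r v) (ipos s) (opos s) (out s).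

Lemma state_eq s s' : reg s =1 reg s' -> ipos s = ipos s' ->
  opos s =1 opos s' -> out s = out s' -> s = s'.
Proof.
by case: s s' => r i o w [r' i' o' w'] /= /funext-> -> /funext-> ->.
Qed.

Ltac eq_state := apply: state_eq => //= ?; rewrite /upd /=;
  repeat (case: eqP => ?); subst => //; try lia.

Section Exec.
Variables (O : nat -> nat -> bool) (input : seq bool).

(** The statement is uniform in the stack [k] below [c], which is what lets executions be
    composed. *)
Definition exec (c : cmd) (s s' : state) : Prop :=
  forall k, exists n, csteps O input n.+1 (c :: k, s) = Some (k, s').

Lemma csteps_add n1 n2 x y : csteps O input n1 x = Some y ->
  csteps O input (n2 + n1) x = csteps O input n2 y.
Proof. by rewrite /csteps iterD => ->. Qed.

Lemma csteps1 n x y : cstep O input x = Some y ->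
  csteps O input n.+1 x = csteps O input n y.
Proof. by move=> h; rewrite -addn1; apply: csteps_add. Qed.

Lemma exec_effect c s : (forall k, cont (ctest O input c s) c k = k) ->
  exec c s (effect c s).
Proof. by move=> h k; exists 0; rewrite /csteps /= /cstep /= h. Qed.

Lemma exec_seq a b s1 s2 s3 : exec a s1 s2 -> exec b s2 s3 -> exec (Seq a b) s1 s3.
Proof.
move=> ha hb k; have [n1 h1] := ha (b :: k); have [n2 h2] := hb k.
exists (n2.+1 + n1.+1); rewrite (@csteps1 _ _ ([:: a, b & k], s1)) //.
by rewrite (csteps_add _ h1) h2.
Qed.

Lemma exec_loop t a (P : nat -> state) n :
  (forall i, i < n -> tst O input t (P i) /\ exec a (P i) (P i.+1)) ->
  ~~ tst O input t (P n) -> exec (While t a) (P 0) (P n).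
Proof.
elim: n P => [|n IH] P H tn k.
  by exists 0; rewrite /csteps /= /cstep /= (negbTE tn).
have [n2 h2] := IH (P \o succn) (fun i h => H i.+1 h) tn k.
have [t0 /(_ (While t a :: k)) [n1 h1]] := H 0 isT.
exists (n2.+1 + n1.+1); rewrite (@csteps1 _ _ ([:: a, While t a & k], P 0)).
  by rewrite (csteps_add _ h1) h2.
by rewrite /cstep /= t0.
Qed.

Lemma exec_if t a s s' : tst O input t s -> exec a s s' -> exec (If t a) s s'.
Proof.
move=> ts ha k; have [n h] := ha k; exists n.+1.
by rewrite (@csteps1 _ _ (a :: k, s)) // /cstep /= ts.
Qed.

Lemma exec_ifN t a s : ~~ tst O input t s -> exec (If t a) s s.
Proof. by move=> ts k; exists 0; rewrite /csteps /= /cstep /= (negbTE ts). Qed.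

Lemma exec_inc r s : exec (Inc r) s (setr s r (reg s r).+1).
Proof. exact: exec_effect. Qed.
Lemma exec_dec r s : exec (Dec r) s (setr s r (reg s r).-1).
Proof. exact: exec_effect. Qed.

Lemma exec_eq c s s' s'' : exec c s s' -> s' = s'' -> exec c s s''.
Proof. by move=> h <-. Qed.

Lemma exec_eql c s s' s0 : s0 = s -> exec c s s' -> exec c s0 s'.
Proof. by move=> ->. Qed.

Lemma exec_clear r s : exec (clear r) s (setr s r 0).
Proof.
pose P i := setr s r (reg s r - i).
have -> : s = P 0 by eq_state.
have -> : setr (P 0) r 0 = P (reg s r) by eq_state.
apply: exec_loop => [i h|] /=; rewrite /upd eqxx; last by rewrite subnn.
split; first by rewrite subn_gt0.
by apply: exec_eq (exec_dec _ _) _; rewrite /P; eq_state.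
Qed.

Lemma exec_mv r d s : r != d ->
  exec (mv r d) s (setr (setr s r 0) d (reg s d + reg s r)).
Proof.
move=> rd; pose P i := setr (setr s r (reg s r - i)) d (reg s d + i).
have -> : setr (setr s r 0) d (reg s d + reg s r) = P (reg s r).
  by rewrite /P; eq_state.
apply: (@exec_eql _ (P 0)); first by rewrite /P; eq_state.
apply: exec_loop => [i h|] /=; rewrite /upd eqxx (negbTE rd); last by rewrite subnn.
split; first by rewrite subn_gt0.
apply: exec_seq (exec_dec _ _) _.
by apply: exec_eq (exec_inc _ _) _; rewrite /P; eq_state.
Qed.

Lemma exec_copy r d x s : r != d -> x != r -> x != d -> reg s x = 0 ->
  exec (copy r d x) s (setr s d (reg s d + reg s r)).
Proof.
move=> /eqP rd /eqP xr /eqP xd x0.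
pose P i := setr (setr (setr s r (reg s r - i)) d (reg s d + i)) x i.
apply: (@exec_seq _ _ _ (P (reg s r))).
  apply: (@exec_eql _ (P 0)); first by rewrite /P; eq_state.
  apply: exec_loop => [i h|].
    split; first by rewrite /= /upd; do !case: eqP => ?; subst; lia.
    apply: exec_seq (exec_dec _ _) _; apply: exec_seq (exec_inc _ _) _.
    by apply: exec_eq (exec_inc _ _) _; rewrite /P; eq_state.
  by rewrite /= /upd; do !case: eqP => ?; subst; lia.
apply: exec_eq (exec_mv _ _) _; first exact/eqP.
by rewrite /P; eq_state.
Qed.

Lemma exec_query j d s : opos s j = 0 -> reg s d.+1 = 0 ->
  exec (query j d) s (setr s d (O j (reg s d))).
Proof.
move=> oj d1; pose P i := State (upd (upd (reg s) d (reg s d - i)) d.+1 i)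
  (ipos s) (upd (opos s) j i) (out s).
pose Q i := State (upd (upd (reg s) d (O j (reg s d))) d.+1 (reg s d - i))
  (ipos s) (upd (opos s) j (reg s d - i)) (out s).
apply: (@exec_seq _ _ _ (P (reg s d))).
  apply: (@exec_eql _ (P 0)); first by rewrite /P; eq_state.
  apply: exec_loop => [i h|].
    split; first by rewrite /= /upd; do !case: eqP => ?; subst; lia.
    apply: exec_seq (exec_dec _ _) _.
    apply: (@exec_seq _ _ _ (effect (ORight j) _)); first exact: exec_effect.
    by apply: exec_eq (exec_inc _ _) _; rewrite /P; eq_state.
  by rewrite /= /upd; do !case: eqP => ?; subst; lia.
apply: (@exec_seq _ _ _ (Q 0)).
  case Oj: (O j (reg s d)).
    apply: exec_if; first by rewrite /= /upd eqxx.
    by apply: exec_eq (exec_inc _ _) _; rewrite /P /Q; eq_state; rewrite Oj; lia.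
  apply: exec_eq; first by apply: exec_ifN; rewrite /= /upd eqxx Oj.
  by rewrite /P /Q; eq_state; rewrite Oj; lia.
have -> : setr s d (O j (reg s d)) = Q (reg s d) by rewrite /Q; eq_state.
apply: exec_loop => [i h|]; last by rewrite /= /upd eqxx subnn.
split; first by rewrite /= /upd eqxx; lia.
apply: exec_seq (exec_dec _ _) _.
by apply: exec_eq; [exact: exec_effect|rewrite /Q; eq_state].
Qed.

Lemma map_setr s r v env : all (fun x => x < r) env ->
  map (reg (setr s r v)) env = map (reg s) env.
Proof.
move=> /allP h; apply/eq_in_map => x /h /=; rewrite /upd.
by case: eqP => // ->; rewrite ltnn.
Qed.

Lemma exec_compute t env d s : all (fun x => x < d) env ->
  (forall r, d <= r -> reg s r = 0) -> opos s =1 (fun=> 0) ->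
  exec (compute t env d) s (setr s d (den O t (map (reg s) env))).
Proof.
have lt_mono e x y : x <= y -> all (fun z => z < x) e -> all (fun z => z < y) e.
  by move=> xy /allP h; apply/allP => z /h /leq_trans; apply.
elim: t env d s => [i||u IH|j u IH|u IHu v IHv|u IH|n IHn b IHb f IHf] env d s
  envd zd oz.
- rewrite /=; case: ltnP => h.
    rewrite (nth_map 0) //.
    have hd : nth 0 env i < d by move/allP: envd; apply; rewrite mem_nth.
    apply: exec_eq; first by apply: exec_copy; try lia; apply: zd.
    by rewrite zd.
  rewrite nth_default ?size_map //; apply: exec_eq; first exact: exec_effect.
  by have z0 := zd d (leqnn d); eq_state.
- apply: exec_eq; first exact: exec_effect.
  by have z0 := zd d (leqnn d); eq_state.
- apply: exec_seq; first exact: IH.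
  by apply: exec_eq (exec_inc _ _) _; rewrite /= /upd eqxx; eq_state.
- apply: exec_seq; first exact: IH.
  have z1 := zd d.+1 (leqnSn d).
  apply: exec_eq; first by apply: exec_query => //=; rewrite /upd; case: eqP => //; lia.
  by rewrite /= /upd eqxx; eq_state.
- apply: exec_seq; first exact: IHu.
  apply: exec_seq.
    apply: IHv => //=; first by rewrite ltnSn (lt_mono _ _ _ (leqnSn d)).
    by move=> r dr; rewrite /upd; case: eqP => [|_]; [lia|apply: zd; lia].
  apply: exec_seq; first exact: exec_clear.
  apply: exec_eq; first by apply: exec_mv; lia.
  rewrite map_cons map_setr //= {1 2 3}/upd eqxx.
  have z1 := zd d.+1 (leqnSn d); eq_state.
- rewrite /= behead_map; apply: IH => //.
  by case: (env) envd => //= ? ? /andP[].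
- set e := map (reg s) env; set N := den O n e.
  pose R i := nat_rec (fun=> nat) (den O b e) (fun i x => den O f [:: x, i & e]) i.
  (* Loop invariant: after [i] rounds, [d] holds the rounds left, [d.+1] the index and [d.+2] the
     current value; [d.+3] is where the step is evaluated. *)
  pose P i := setr (setr (setr s d (N - i)) d.+1 i) d.+2 (R i).
  have z1 := zd d.+1 (leqnSn d).
  apply: exec_seq; first exact: IHn.
  apply: (@exec_seq _ _ _ (P 0)).
    apply: exec_eq; first apply: IHb => //; first by apply: lt_mono envd; lia.
      by move=> r dr /=; rewrite /upd; case: eqP => [|_]; [lia|apply: zd; lia].
    by rewrite map_setr // /P /R /= subn0; eq_state.
  apply: (@exec_seq _ _ _ (P N)).
    apply: exec_loop => [i h|].
      split; first by rewrite /= /upd eqxx; do !case: eqP => ?; subst; lia.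
      have mP : map (reg (P i)) [:: d.+2, d.+1 & env] = [:: R i, i & e].
        rewrite !map_cons !map_setr //; try by apply: lt_mono envd; lia.
        by congr [:: _ , _ & _]; rewrite /= /upd; do !case: eqP => ?; subst; lia.
      apply: exec_seq.
        apply: IHf => //=; first by rewrite !ltnS leqnn leqnSn /= (lt_mono _ _ _ _ envd) //; lia.
        move=> r dr; rewrite /upd; do !case: eqP => ?; try lia.
        by apply: zd; lia.
      rewrite mP; apply: exec_seq; first exact: exec_clear.
      apply: exec_seq; first by apply: exec_mv; lia.
      apply: exec_seq; first exact: exec_inc.
      apply: exec_eq (exec_dec _ _) _.
      have z3 := zd d.+3 (leq_trans (leqnSn d) (leq_trans (leqnSn _) (leqnSn _))).
      by rewrite /P; eq_state.
    by rewrite /= /upd eqxx; do !case: eqP => ?; subst; lia.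
  apply: exec_seq; first exact: exec_clear.
  apply: exec_eq; first by apply: exec_mv; lia.
  have z2 := zd d.+2 (leq_trans (leqnSn d) (leqnSn _)).
  rewrite -[den O (Rec n b f) _]/(R N) /P; eq_state.
Qed.

End Exec.

(** * Arithmetic, logic and bounded quantifiers as terms *)

Fixpoint Tnat (n : nat) : term := if n is n'.+1 then Succ (Tnat n') else Zero.
Definition Tpred a := Rec a Zero (Var 1).
Definition Tadd a b := Rec a b (Succ (Var 0)).
Definition Tmul a b := Rec a Zero (Tadd (Shift (Shift b)) (Var 0)).
Definition Tsub a b := Rec b a (Tpred (Var 0)).
Definition Texp a b := Rec b (Tnat 1) (Tmul (Shift (Shift a)) (Var 0)).
Definition Tnot a := Rec a (Tnat 1) Zero.
Definition Tif c a b := Rec c b (Shift (Shift a)).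
(* The locks keep [rewrite] from confusing these operations by unfolding them. *)
Definition Tand a b := locked (Tif a (Tnot (Tnot b)) Zero).
Definition Tleq a b := locked (Tnot (Tsub a b)).
Definition Tlt a b := Tleq (Succ a) b.
Definition Teq a b := locked (Tand (Tleq a b) (Tleq b a)).
(** The rest comes from bounded sums, in which variable 0 is the index: quantifiers compare a sum
    with zero, [Tdiv] counts the i with (i+1)b <= a, and [Tlog] the i with 2^(i+1) <= a. *)
Definition Tsum n f := Rec n Zero (Tadd (Var 0) (Shift f)).
Definition Tex n f := locked (Tnot (Tnot (Tsum n f))).
Definition Tall n f := locked (Tnot (Tsum n (Tnot f))).
Definition Tdiv a b := Tsum a (Tleq (Tmul (Succ (Var 0)) (Shift b)) (Shift a)).
Definition Tmod a b := Tsub a (Tmul (Tdiv a b) b).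
Definition Tlog a := Tsum a (Tleq (Texp (Tnat 2) (Succ (Var 0))) (Shift a)).
Definition Tor a b := locked (Tnot (Tnot (Tadd a b))).
Definition call1 f a := Let a f.
(** In [f] the arguments are variables 0 and 1; since [b] is evaluated first, the shift lets [a] be
    read in the original environment. *)
Definition call2 f a b := Let b (Let (Shift a) f).
Definition call3 f a b c := Let c (call2 f (Shift a) (Shift b)).

Arguments Tnat : simpl never.
Arguments Tpred : simpl never.
Arguments Tadd : simpl never.
Arguments Tmul : simpl never.
Arguments Tsub : simpl never.
Arguments Texp : simpl never.
Arguments Tnot : simpl never.
Arguments Tif : simpl never.
Arguments Tand : simpl never.
Arguments Tleq : simpl never.
Arguments Tlt : simpl never.
Arguments Teq : simpl never.
Arguments Tsum : simpl never.
Arguments Tex : simpl never.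
Arguments Tall : simpl never.
Arguments Tdiv : simpl never.
Arguments Tmod : simpl never.
Arguments Tlog : simpl never.
Arguments Tor : simpl never.
Arguments call1 : simpl never.
Arguments call2 : simpl never.
Arguments call3 : simpl never.

Arguments den : simpl never.

(** The integer part of the binary logarithm, with value 0 at 0, in the form counted by [Tlog]. *)
Definition lg (c : nat) : nat := \sum_(i < c) (2 ^ i.+1 <= c).

Lemma sum_ltn_ord (N x : nat) : x <= N -> \sum_(i < N) (i < x) = x.
Proof.
elim: N x => [|N IH] x; first by rewrite leqn0 big_ord0 => /eqP.
rewrite leq_eqVlt big_ord_recr /= => /orP[/eqP->|xN].
  by rewrite ltnSn (eq_bigr (fun=> 1)) ?sum1_card ?card_ord ?addn1 // => i _; rewrite ltnW // ltnS.
by rewrite IH // ltnNge -ltnS xN addn0.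
Qed.

Lemma has_iotaP (P : pred nat) n :
  reflect (exists2 i, i < n & P i) (has P (iota 0 n)).
Proof.
by apply: (iffP hasP) => -[i]; rewrite ?mem_iota => h Pi; exists i; rewrite ?mem_iota.
Qed.

Lemma all_iotaP (P : pred nat) n :
  reflect (forall i, i < n -> P i) (all P (iota 0 n)).
Proof.
by apply: (iffP allP) => h i; have := h i; rewrite mem_iota.
Qed.

Section Den.
Variables (O : nat -> nat -> bool).
Implicit Types (a b c f n : term) (e : seq nat).
Local Notation D := (den O).

Lemma den_rec n b f e : D (Rec n b f) e =
  nat_rec (fun=> nat) (D b e) (fun i x => D f [:: x, i & e]) (D n e).
Proof. by []. Qed.
Lemma den_succ a e : D (Succ a) e = (D a e).+1. Proof. by []. Qed.
Lemma den_shift a e : D (Shift a) e = D a (behead e). Proof. by []. Qed.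
Lemma den_var i e : D (Var i) e = nth 0 e i. Proof. by []. Qed.
Lemma den_orc j a e : D (Orc j a) e = O j (D a e). Proof. by []. Qed.
Lemma den_zero e : D Zero e = 0. Proof. by []. Qed.
Lemma den_call1 f a e : D (call1 f a) e = D f (D a e :: e). Proof. by []. Qed.
Lemma den_call2 f a b e : D (call2 f a b) e = D f [:: D a e, D b e & e].
Proof. by []. Qed.
Lemma den_call3 f a b c e : D (call3 f a b c) e = D f [:: D a e, D b e, D c e & e].
Proof. by []. Qed.

Lemma den_nat k e : D (Tnat k) e = k.
Proof. by elim: k => // k IH; rewrite -[Tnat _]/(Succ (Tnat k)) den_succ IH. Qed.
Lemma den_pred a e : D (Tpred a) e = (D a e).-1.
Proof. by rewrite den_rec; case: (D a e). Qed.
Lemma den_add a b e : D (Tadd a b) e = D a e + D b e.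
Proof. by rewrite den_rec; elim: (D a e) => //= n IH; rewrite den_succ den_var /= IH. Qed.
Lemma den_mul a b e : D (Tmul a b) e = D a e * D b e.
Proof.
rewrite den_rec; elim: (D a e) => //= n IH.
by rewrite den_add !den_shift den_var /= IH mulSn.
Qed.
Lemma den_sub a b e : D (Tsub a b) e = D a e - D b e.
Proof.
rewrite den_rec; elim: (D b e) => [|n IH] /=; first by rewrite subn0.
by rewrite den_pred den_var /= IH subnS.
Qed.
Lemma den_exp a b e : D (Texp a b) e = D a e ^ D b e.
Proof.
rewrite den_rec; elim: (D b e) => [|n IH] /=; first by rewrite den_nat.
by rewrite den_mul !den_shift den_var /= IH expnS.
Qed.
Lemma den_not a e : D (Tnot a) e = (D a e == 0).
Proof. by rewrite den_rec; case: (D a e) => [|k] /=; rewrite ?den_nat. Qed.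
Lemma den_if c a b e : D (Tif c a b) e = if 0 < D c e then D a e else D b e.
Proof. by rewrite den_rec; case: (D c e). Qed.
Lemma den_and a b e : D (Tand a b) e = (0 < D a e) && (0 < D b e).
Proof. by rewrite /Tand -lock den_if !den_not den_zero; case: (D a e); case: (D b e). Qed.
Lemma den_or a b e : D (Tor a b) e = (0 < D a e) || (0 < D b e).
Proof. by rewrite /Tor -lock !den_not den_add; case: (D a e); case: (D b e). Qed.
Lemma den_leq a b e : D (Tleq a b) e = (D a e <= D b e).
Proof. by rewrite /Tleq -lock den_not den_sub. Qed.
Lemma den_lt a b e : D (Tlt a b) e = (D a e < D b e).
Proof. by rewrite den_leq. Qed.
Lemma den_eq a b e : D (Teq a b) e = (D a e == D b e).
Proof. by rewrite /Teq -lock den_and !den_leq !lt0b -eqn_leq. Qed.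
Lemma den_sum n f e : D (Tsum n f) e = \sum_(i < D n e) D f (nat_of_ord i :: e).
Proof.
rewrite den_rec; elim: (D n e) => [|k IH] /=; first by rewrite big_ord0.
by rewrite big_ord_recr den_add den_shift den_var /= IH.
Qed.
Lemma den_ex n f e :
  D (Tex n f) e = has (fun i => 0 < D f (i :: e)) (iota 0 (D n e)).
Proof.
rewrite /Tex -lock !den_not den_sum eqb0 sum_nat_eq0; congr nat_of_bool.
apply/forallPn/hasP => [[i]|[i]].
  rewrite implyTb -lt0n => h; exists (nat_of_ord i) => //.
  by rewrite mem_iota add0n ltn_ord.
rewrite mem_iota add0n => ik h.
by exists (Ordinal ik); rewrite implyTb -lt0n.
Qed.
Lemma den_all n f e :
  D (Tall n f) e = all (fun i => 0 < D f (i :: e)) (iota 0 (D n e)).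
Proof.
rewrite /Tall -lock den_not den_sum sum_nat_eq0; congr nat_of_bool.
apply/forallP/allP => [h i|h i].
  rewrite mem_iota add0n => ik; have := h (Ordinal ik).
  by rewrite implyTb den_not eqb0 lt0n.
by rewrite implyTb den_not eqb0 -lt0n; apply: h; rewrite mem_iota add0n ltn_ord.
Qed.
Lemma den_log a e : D (Tlog a) e = lg (D a e).
Proof.
rewrite den_sum; apply: eq_bigr => i _.
by rewrite den_leq den_exp den_nat den_succ den_var.
Qed.
Lemma den_div a b e : 0 < D b e -> D (Tdiv a b) e = D a e %/ D b e.
Proof.
move=> b0; rewrite den_sum.
rewrite (eq_bigr (fun i : 'I__ => nat_of_bool (i < D a e %/ D b e))) => [|i _].
  by rewrite sum_ltn_ord ?leq_div.
by rewrite den_leq den_mul den_succ !den_shift den_var /= leq_divRL.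
Qed.
Lemma den_mod a b e : 0 < D b e -> D (Tmod a b) e = D a e %% D b e.
Proof.
by move=> b0; rewrite den_sub den_mul den_div // {1}(divn_eq (D a e) (D b e)) addKn.
Qed.
End Den.

(** * Strings coded by numbers *)

(** The number written in binary as 1 followed by [s]. The leading 1 protects initial zeros, so
    strings correspond to the positive numbers and those of length t to the interval from 2^t to
    2^(t+1) - 1. *)
Definition code (s : seq bool) : nat := foldl (fun v (b : bool) => v * 2 + b) 1 s.

Lemma code_rcons s b : code (rcons s b) = code s * 2 + b.
Proof. by rewrite /code -cats1 foldl_cat. Qed.

Lemma code_bounds s : 2 ^ size s <= code s < 2 ^ (size s).+1.
Proof.
elim/last_ind: s => [//|s b]; rewrite size_rcons code_rcons !expnS.
by case: b => /=; lia.
Qed.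

Lemma code_gt0 s : 0 < code s.
Proof. by have /andP[h _] := code_bounds s; apply: leq_trans h; rewrite expn_gt0. Qed.

Lemma lg_code s : lg (code s) = size s.
Proof.
have /andP[h1 h2] := code_bounds s.
rewrite /lg (eq_bigr (fun i : 'I__ => nat_of_bool (i < size s))) => [|i _].
  by rewrite sum_ltn_ord // (leq_trans _ h1) // ltnW // ltn_expl.
congr nat_of_bool; apply/idP/idP => h.
  by have := leq_ltn_trans h h2; rewrite ltn_exp2l.
by apply: leq_trans h1; rewrite leq_exp2l.
Qed.

Lemma code_cat u s : code (u ++ s) = code u * 2 ^ size s + (code s - 2 ^ size s).
Proof.
elim/last_ind: s => [|s b IH]; first by rewrite cats0 expn0 muln1 addn0.
rewrite -rcons_cat !code_rcons IH size_rcons expnS.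
by have /andP[h1 h2] := code_bounds s; rewrite mulnDl; case: b; nia.
Qed.

Lemma code_takedrop i s :
  code s = code (take i s) * 2 ^ (size s - i) + (code (drop i s) - 2 ^ (size s - i)).
Proof. by rewrite -{1}(cat_take_drop i s) code_cat size_drop. Qed.

Lemma code_drop_lt i s : code (drop i s) - 2 ^ (size s - i) < 2 ^ (size s - i).
Proof.
by have /andP[h1 h2] := code_bounds (drop i s); rewrite size_drop expnS in h1 h2; lia.
Qed.

Lemma code_take i s : code (take i s) = code s %/ 2 ^ (size s - i).
Proof.
rewrite (code_takedrop i s) divnMDl ?expn_gt0 //.
by rewrite [X in _ + X]divn_small ?addn0 // code_drop_lt.
Qed.

Lemma code_drop i s :
  code (drop i s) = 2 ^ (size s - i) + code s %% 2 ^ (size s - i).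
Proof.
rewrite (code_takedrop i s) modnMDl modn_small ?code_drop_lt // subnKC //.
by have /andP[h1 h2] := code_bounds (drop i s); rewrite size_drop in h1.
Qed.

Lemma nth_code i s :
  nth false s i = (i < size s) && odd (code (take i.+1 s)).
Proof.
case: ltnP => h; last by rewrite nth_default.
by rewrite (take_nth false) // code_rcons oddD oddM andbF; case: nth.
Qed.

Lemma code_inj s1 s2 : code s1 = code s2 -> s1 = s2.
Proof.
move=> e; have sz : size s1 = size s2 by rewrite -!lg_code e.
apply: (@eq_from_nth _ false) => // i h.
by rewrite !nth_code !code_take e sz.
Qed.

Lemma code_surj c : 0 < c -> exists s, code s = c.
Proof.
have [n] := ubnP c; elim: n c => // n IH c; rewrite ltnS => cn c0.
have [c1|c1] := leqP c 1; first by exists [::]; apply/eqP; rewrite eqn_leq c0 c1.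
have [s sE] : exists s, code s = c./2 by apply: IH; lia.
by exists (rcons s (odd c)); rewrite code_rcons sE; lia.
Qed.

Definition decode (c : nat) : seq bool := mkseq (fun i =>
  odd (c %/ 2 ^ (lg c - i.+1))) (lg c).

Lemma codeK : cancel code decode.
Proof.
move=> s; apply: (@eq_from_nth _ false); first by rewrite size_mkseq lg_code.
move=> i; rewrite size_mkseq lg_code => h; rewrite nth_mkseq ?lg_code //.
by rewrite nth_code h code_take.
Qed.

Lemma decodeK c : 0 < c -> code (decode c) = c.
Proof. by move=> /code_surj[s <-]; rewrite codeK. Qed.

Definition strings (t : nat) : seq (seq bool) :=
  [seq decode i | i <- iota (2 ^ t) (2 ^ t)].

Lemma mem_strings t s : (s \in strings t) = (size s == t).
Proof.
have pt : 0 < 2 ^ t by rewrite expn_gt0.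
apply/mapP/eqP => [[i]|<-].
  rewrite mem_iota addnn -mul2n -expnS => /andP[h1 h2] ->.
  have [u uE] : exists u, code u = i by apply: code_surj; apply: leq_trans h1.
  rewrite -uE codeK; have /andP[h3 h4] := code_bounds u; rewrite uE in h3 h4.
  apply/eqP; rewrite eqn_leq -ltnS -[t <= _]ltnS.
  rewrite -(@ltn_exp2l 2 (size u)) // -(@ltn_exp2l 2 t) //.
  by rewrite (leq_ltn_trans h3 h2) (leq_ltn_trans h1 h4).
exists (code s); last by rewrite codeK.
by rewrite mem_iota addnn -mul2n -expnS code_bounds.
Qed.

Lemma uniq_strings t : uniq (strings t).
Proof.
rewrite map_inj_in_uniq ?iota_uniq // => i j.
have p0 : 0 < 2 ^ t by rewrite expn_gt0.
rewrite !mem_iota => /andP[hi _] /andP[hj _] /(congr1 code).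
by rewrite !decodeK // (leq_trans p0).
Qed.

Definition Ttake i s := Tdiv s (Texp (Tnat 2) (Tsub (Tlog s) i)).
Definition Tdrop i s := let m := Texp (Tnat 2) (Tsub (Tlog s) i) in
  Tadd m (Tmod s m).
Definition Tcat u s := Tadd (Tmul u (Texp (Tnat 2) (Tlog s)))
  (Tsub s (Texp (Tnat 2) (Tlog s))).
Definition Tnth s i := Tand (Tlt i (Tlog s)) (Tmod (Ttake (Succ i) s) (Tnat 2)).
(** Counting the strings of length [t] gives the measure of a clopen set; compared with zero, it is
    a quantifier over these strings. *)
Definition Tcount t f := Tsum (Texp (Tnat 2) (Succ t))
  (Tand (Tleq (Texp (Tnat 2) (Shift t)) (Var 0)) f).

Section DenStrings.
Variable O : nat -> nat -> bool.
Local Notation D := (den O).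

Lemma den_len s e x : D s e = code x -> D (Tlog s) e = size x.
Proof. by move=> h; rewrite den_log h lg_code. Qed.

Lemma den_take s i e x : D s e = code x -> D (Ttake i s) e = code (take (D i e) x).
Proof.
move=> h; rewrite den_div den_exp den_nat ?expn_gt0 // den_sub (den_len h) h.
by rewrite code_take.
Qed.

Lemma den_drop s i e x : D s e = code x -> D (Tdrop i s) e = code (drop (D i e) x).
Proof.
move=> h; rewrite den_add den_mod den_exp den_nat ?expn_gt0 // den_sub (den_len h) h.
by rewrite code_drop.
Qed.

Lemma den_cat u s e x y : D u e = code x -> D s e = code y ->
  D (Tcat u s) e = code (x ++ y).
Proof.
move=> hx hy.
by rewrite den_add den_mul den_sub den_exp den_nat (den_len hy) hx hy code_cat.
Qed.

Lemma den_nth s i e x : D s e = code x -> D (Tnth s i) e = nth false x (D i e).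
Proof.
move=> h; rewrite den_and den_lt (den_len h) lt0b nth_code.
by rewrite den_mod den_nat // (den_take _ h) den_succ modn2 lt0b.
Qed.

Lemma den_count t f e : D (Tcount t f) e =
  count (fun s => 0 < D f (code s :: e)) (strings (D t e)).
Proof.
have p0 : 0 < 2 ^ D t e by rewrite expn_gt0.
rewrite den_sum den_exp den_nat den_succ count_map -sum1_count [RHS]big_mkcond /=.
set g := Tand _ f; rewrite -(big_mkord xpredT (fun i => D g (i :: e))) {}/g.
rewrite (@big_cat_nat _ _ _ (2 ^ D t e)) ?leq_exp2l //=.
rewrite big_nat big1 ?add0n => [|i /andP[_ h]]; last first.
  by rewrite den_and den_leq den_exp den_nat den_shift den_var /= lt0b leqNgt h.
rewrite expnS mul2n -addnn /index_iota addnK big_seq [RHS]big_seq.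
apply: eq_bigr => i; rewrite mem_iota => /andP[h _].
rewrite den_and den_leq den_exp den_nat den_shift den_var /= lt0b h /=.
by rewrite decodeK ?(leq_trans p0 h) //; case: (D f _).
Qed.
End DenStrings.

(** * Machines for unbounded search *)

Arguments compute : simpl never.

(* Register 0 holds the input of a search and register 1 its witness. *)
Definition search (t : term) (d : nat) : cmd :=
  let c := compute (Tnot t) [:: 1; 0] d in
  Seq c (While (Pos d) (Seq (clear d) (Seq (Inc 1) c))).

(** Horner's scheme: register 0 starts at 1 and is doubled for each input bit, so it ends as
    [code input]. *)
Definition read_input : cmd :=
  Seq (Inc 0)
  (While InSome
    (Seq (While (Pos 0) (Seq (Dec 0) (Seq (Inc 1) (Inc 1))))
    (Seq (mv 1 0) (Seq (If InTrue (Inc 0)) InNext)))).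

Definition semidecider (t : term) : cmd := Seq read_input (search t 2).

(** At witness k and position n, the value 0 of [t] means that the bit is not known yet and b.+1
    that it is b. Register 0 is the position; register 2 stays 1 and keeps [streamer] looping. *)
Definition stream_one (t : term) : cmd :=
  Seq (search t 3)
 (Seq (compute (Tpred t) [:: 1; 0] 3) (Seq (If (Pos 3) (Out true)) (Seq (clear 3)
 (Seq (compute (Tnot (Tpred t)) [:: 1; 0] 3) (Seq (If (Pos 3) (Out false)) (Seq (clear 3)
 (Seq (clear 1) (Inc 0)))))))).

Definition streamer (t : term) : cmd :=
  Seq (Inc 2) (While (Pos 2) (stream_one t)).

Section Exec.
Variables (O : nat -> nat -> bool) (input : seq bool).
Local Notation exec := (exec O input).
Local Notation csteps := (csteps O input).

Lemma csteps_None n1 n x y : csteps n1 x = Some y -> csteps n x = None ->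
  n1 < n /\ csteps (n - n1) y = None.
Proof.
move=> h1 hn; have [h|h] := ltnP n1 n.
  by split=> //; rewrite -(csteps_add _ h1) subnK // ltnW.
have : csteps n1 x = None.
  rewrite -(subnK h) /csteps iterD -/(csteps n x) hn.
  by elim: (n1 - n) => //= i ->.
by rewrite h1.
Qed.

(** Descent on [n]: if the loop were over within [n] steps, then after one more round it would be
    over within fewer. *)
Lemma loop_forever t a (P : nat -> state) n k i :
  (forall i, tst O input t (P i) /\ exec a (P i) (P i.+1)) ->
  csteps n (While t a :: k, P i) <> None.
Proof.
move=> H; have [N] := ubnP n; elim: N n i => // N IH n i nN hn.
have [ti /(_ (While t a :: k)) [n1 h1]] := H i.
have h : csteps n1.+2 (While t a :: k, P i) = Some (While t a :: k, P i.+1).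
  by rewrite (@csteps1 _ _ _ _ ([:: a, While t a & k], P i)) // /cstep /= ti.
have [lt0 h0] := csteps_None h hn.
by apply: IH h0; lia.
Qed.

Lemma halts_exec c s s' : exec c s s' -> exists n, csteps n ([:: c], s) = None.
Proof.
move=> /(_ [::]) [n h]; exists n.+2.
by rewrite /csteps iterS -/(csteps n.+1 _) h.
Qed.

Variables (t : term) (d : nat) (s : state).
Hypotheses (d2 : 1 < d) (zd : forall r, d <= r -> reg s r = 0)
  (os : opos s =1 (fun=> 0)) (r1 : reg s 1 = 0).
Local Notation F k := (den O t [:: k; reg s 0]).

Lemma exec_search_test k :
  exec (compute (Tnot t) [:: 1; 0] d) (setr s 1 k)
       (setr (setr s 1 k) d (F k == 0)).
Proof.
apply: exec_eq; first apply: exec_compute => //=.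
- by rewrite d2 (ltnW d2).
- by move=> r dr; rewrite /upd; case: eqP => [|_]; [lia|apply: zd].
by rewrite den_not /= /upd eqxx.
Qed.

Lemma exec_search_body k : exec
  (Seq (clear d) (Seq (Inc 1) (compute (Tnot t) [:: 1; 0] d)))
  (setr (setr s 1 k) d (F k == 0)) (setr (setr s 1 k.+1) d (F k.+1 == 0)).
Proof.
apply: exec_seq; first exact: exec_clear.
apply: exec_seq; first exact: exec_inc.
apply: exec_eql (exec_search_test k.+1).
by have z := zd (leqnn d); eq_state.
Qed.

Lemma exec_search k0 : F k0 != 0 -> (forall k, k < k0 -> F k = 0) ->
  exec (search t d) s (setr s 1 k0).
Proof.
move=> h0 hk; pose P k := setr (setr s 1 k) d (F k == 0).
have es : s = setr s 1 0 by eq_state.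
apply: (@exec_seq _ _ _ _ _ (P 0)).
  by rewrite {1}es; apply: exec_search_test.
have -> : setr s 1 k0 = P k0.
  by have z := zd (leqnn d); rewrite /P (negbTE h0); eq_state.
apply: exec_loop => [i h|].
  by split; [rewrite /= /upd eqxx hk|apply: exec_search_body].
by rewrite /= /upd eqxx (negbTE h0).
Qed.

Lemma search_halts n k : csteps n (search t d :: k, s) = None ->
  exists i, F i != 0.
Proof.
move=> hn; apply: contrapT => nF.
have Fz i : F i == 0 by apply/negPn/negP => h; apply: nF; exists i.
pose P k := setr (setr s 1 k) d (F k == 0).
have es : s = setr s 1 0 by eq_state.
have := exec_search_test 0; rewrite -{1}es.
pose W := While (Pos d) (Seq (clear d) (Seq (Inc 1) (compute (Tnot t) [:: 1; 0] d))).
move=> /(_ (W :: k)) [n1 h1].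
have h : csteps n1.+2 (search t d :: k, s) = Some (W :: k, P 0).
  by rewrite (@csteps1 _ _ _ _ ([:: compute (Tnot t) [:: 1; 0] d, W & k], s)) // h1.
have [_] := csteps_None h hn.
apply: loop_forever => i; split; first by rewrite /= /upd eqxx Fz.
exact: exec_search_body.
Qed.
End Exec.

Lemma exec_read_input O input : exec O input read_input state0
  (State (upd (fun=> 0) 0 (code input)) (size input) (fun=> 0) [::]).
Proof.
pose P i := State (upd (fun=> 0) 0 (code (take i input))) i (fun=> 0) [::].
have -> : State (upd (fun=> 0) 0 (code input)) (size input) (fun=> 0) [::] =
   P (size input) by rewrite /P take_size.
apply: (@exec_seq _ _ _ _ _ (P 0)).
  apply: exec_eq (exec_inc _ _ _ _) _; rewrite /P take0; eq_state.
apply: exec_loop => [i h|]; last by rewrite /= ltnn.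
split; first by [].
set c := code (take i input).
pose Q j := setr (setr (P i) 0 (c - j)) 1 (j * 2).
apply: (@exec_seq _ _ _ _ _ (Q c)).
  apply: (@exec_eql _ _ _ (Q 0)); first by rewrite /P /Q /c; eq_state.
  apply: exec_loop => [j jc|].
    split; first by rewrite /= /upd /=; lia.
    apply: exec_seq (exec_dec _ _ _ _) _; apply: exec_seq (exec_inc _ _ _ _) _.
    by apply: exec_eq (exec_inc _ _ _ _) _; rewrite /P /Q; eq_state.
  by rewrite /= /upd /= subnn.
apply: exec_seq; first exact: exec_mv.
apply: (@exec_seq _ _ _ _ _ (setr (P i) 0 (code (take i.+1 input)))).
  rewrite (take_nth false) // code_rcons -/c.
  case b: (nth false input i).
    apply: exec_if; first by [].
    by apply: exec_eq (exec_inc _ _ _ _) _; rewrite /P /Q; eq_state.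
  apply: exec_eq; first by apply: exec_ifN; rewrite /= b.
  by rewrite /P /Q; eq_state.
by apply: exec_eq; [exact: exec_effect | rewrite /P; eq_state].
Qed.

(** The search stops at the least witness if there is one, and otherwise is a loop that never
    ends. *)
Lemma semidecider_halts m (T : m.-tuple cantor_space) t input :
  halts (compile m (semidecider t)) T input <->
  exists k, den (tuple_oracle T) t [:: k; code input] != 0.
Proof.
rewrite compile_halts; last by rewrite /= !markfree_compute.
set O := tuple_oracle T.
have hr := exec_read_input O input; set s := State _ _ _ _ in hr.
have z2 r : 2 <= r -> reg s r = 0 by case: r => [|[|]].
split=> [[n hn]|ex].
  have [n1 h1] := hr [:: search t 2].
  have h : csteps O input n1.+2 ([:: semidecider t], state0) = Some ([:: search t 2], s).
    by rewrite (@csteps1 _ _ _ _ ([:: read_input; search t 2], state0)).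
  have [_ h0] := csteps_None h hn.
  by apply: (search_halts _ _ _ _ h0).
apply: (@halts_exec _ _ _ _ (setr s 1 (ex_minn ex))).
apply: exec_seq hr _; case: ex_minnP => k hk hmin.
apply: exec_search => // i ik; apply/eqP/negPn/negP => /hmin.
by rewrite leqNgt ik.
Qed.

Lemma streamer_outputs m (T : m.-tuple cantor_space) t (y : cantor_space) :
  (forall n, exists k, den (tuple_oracle T) t [:: k; n] != 0) ->
  (forall n k, den (tuple_oracle T) t [:: k; n] != 0 ->
     den (tuple_oracle T) t [:: k; n] = ((y : nat -> bool) n).+1) ->
  outputs (compile m (streamer t)) T y.
Proof.
set O := tuple_oracle T => ex ey.
apply: compile_outputs; first by rewrite /= !markfree_compute.
pose P i := State (upd (upd (fun=> 0) 2 1) 0 i) 0 (fun=> 0) (mkseq (y : nat -> bool) i).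
set body := stream_one t.
have Pbody i : exec O [::] body (P i) (P i.+1).
  have z3 r : 3 <= r -> reg (P i) r = 0 by case: r => [|[|[|]]].
  have exi := ex i; pose k0 := ex_minn exi.
  have [Fk0 mk0] : den O t [:: k0; i] != 0 /\ forall k, k < k0 -> den O t [:: k; i] = 0.
    rewrite /k0; case: ex_minnP => k hk hmin; split=> // k' h.
    by apply/eqP/negPn/negP => /hmin; rewrite leqNgt h.
  pose s1 := setr (P i) 1 k0.
  pose s2 := State (reg s1) 0 (fun=> 0) (mkseq (y : nat -> bool) i.+1).
  have ev f s : reg s = reg s1 -> opos s = opos s1 ->
    exec O [::] (compute f [:: 1; 0] 3) s (setr s 3 (den O f [:: k0; i])).
    move=> rs os; apply: exec_eq; first apply: exec_compute => //.
    - by move=> r h; rewrite rs /= /upd; case: eqP => [|_]; [lia|apply: z3].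
    - by move=> j; rewrite os.
    by rewrite /= rs.
  have yi := ey _ _ Fk0.
  apply: (@exec_seq _ _ _ _ _ s1); first exact: exec_search.
  apply: exec_seq; first exact: ev.
  rewrite den_pred yi /=.
  apply: (@exec_seq _ _ _ _ _ (if (y : nat -> bool) i then setr s2 3 1 else s1)).
    case yb: ((y : nat -> bool) i) => /=.
      apply: exec_if => //; apply: exec_eq; first exact: exec_effect.
      by rewrite /s2 mkseqS yb; eq_state.
    by apply: exec_eq; [exact: exec_ifN|eq_state].
  apply: (@exec_seq _ _ _ _ _ (if (y : nat -> bool) i then s2 else s1)).
    by apply: exec_eq; [exact: exec_clear | case: ((y : nat -> bool) i); rewrite /s2; eq_state].
  apply: exec_seq; first by apply: ev; case: ((y : nat -> bool) i).
  rewrite den_not den_pred yi /=.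
  apply: (@exec_seq _ _ _ _ _ (setr s2 3 (~~ (y : nat -> bool) i))).
    case yb: ((y : nat -> bool) i) => /=.
      by apply: exec_eq; [exact: exec_ifN|rewrite /s2; eq_state].
    apply: exec_if => //; apply: exec_eq; first exact: exec_effect.
    by rewrite /s2 mkseqS yb; eq_state.
  apply: exec_seq; first exact: exec_clear.
  apply: exec_seq; first exact: exec_clear.
  by apply: exec_eq (exec_inc _ _ _ _) _; rewrite /s2 /s1 /P; eq_state.
have toP i : exists k n, csteps O [::] n ([:: streamer t], state0) = Some (k, P i).
  set W := While (Pos 2) body; exists [:: W]; elim: i => [|i [n IH]].
    have [n1 h1] := exec_inc O [::] 2 state0 [:: W].
    exists n1.+2; rewrite (@csteps1 _ _ _ _ ([:: Inc 2; W], state0)) // h1.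
    by congr (Some (_, _)); rewrite /P; eq_state.
  have [n1 h1] := Pbody i [:: W].
  exists (n1.+2 + n); rewrite (csteps_add _ IH).
  by rewrite (@csteps1 _ _ _ _ ([:: body; W], P i)) // h1.
move=> n; have [k [N h]] := toP n.+1; exists N, k, (P n.+1); split=> //.
by rewrite -[out _]/(mkseq (y : nat -> bool) n.+1) size_mkseq nth_mkseq.
Qed.

(** * Simulating a Turing machine by a term *)

(** Lists are coded as by [CodeSeq.code]: the empty list is 0 and a :: l is 2^a(2l+1). Hence [Thd]
    is the 2-adic valuation, found by counting the powers of 2 that divide the code. *)
Definition Tcons a l := Tmul (Texp (Tnat 2) a) (Succ (Tmul l (Tnat 2))).
Definition Tlist (ts : seq term) : term := foldr Tcons Zero ts.
Definition Thd c := Tsum c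
  (Tnot (Tmod (Shift c) (Texp (Tnat 2) (Succ (Var 0))))).
Definition Ttl c := Tdiv (Tdiv c (Texp (Tnat 2) (Thd c))) (Tnat 2).
Definition Tget c i := Thd (iter i Ttl c).
Definition Tands (ts : seq term) : term := foldr Tand (Tnat 1) ts.
Definition Tdig B T p := Tmod (Tdiv T (Texp (Tnat B) p)) (Tnat B).
Definition Twr B T p d :=
  Tadd (Tadd (Tmul (Tdiv T (Texp (Tnat B) (Succ p))) (Texp (Tnat B) (Succ p)))
             (Tmul d (Texp (Tnat B) p)))
       (Tmod T (Texp (Tnat B) p)).
Arguments Tget : simpl never.
Arguments Tlist : simpl never.
Arguments Tands : simpl never.
Arguments Twr : simpl never.
Arguments Tdig : simpl never.

(** A tape is a number in base [B] whose digit [p] codes cell [p]. The blank has code 0, so an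
    almost blank infinite tape is a finite number. *)
Definition dig (B T p : nat) : nat := (T %/ B ^ p) %% B.
Definition wr (B T p d : nat) : nat :=
  T %/ B ^ p.+1 * B ^ p.+1 + d * B ^ p + T %% B ^ p.

Lemma dig0 B p : dig B 0 p = 0.
Proof. by rewrite /dig div0n mod0n. Qed.

Lemma dig_add B X T p n : 0 < B -> n < p -> dig B (X * B ^ p + T) n = dig B T n.
Proof.
move=> B0 np; rewrite /dig -[p](subnK (ltnW np)) expnD mulnA divnMDl ?expn_gt0 ?B0 //.
have -> : p - n = (p - n.+1).+1 by lia.
by rewrite expnSr mulnA modnMDl.
Qed.

Lemma dig_wr B T p d n : 0 < B -> d < B ->
  dig B (wr B T p d) n = if n == p then d else dig B T n.
Proof.
move=> B0 dB; have P0 i : 0 < B ^ i by rewrite expn_gt0 B0.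
have wrE : wr B T p d = (T %/ B ^ p.+1 * B + d) * B ^ p + T %% B ^ p.
  by rewrite /wr expnS mulnDl mulnA.
case: ltngtP => h.
- by rewrite wrE {3}(divn_eq T (B ^ p)) !dig_add.
- rewrite /dig -(subnKC h) expnD !divnMA; congr (_ %/ _ %% _).
  rewrite wrE; set X := T %/ _; rewrite expnSr divnMA divnMDl //.
  by rewrite (divn_small (ltn_pmod _ (P0 p))) addn0 divnMDl // divn_small // addn0.
- rewrite h wrE /dig divnMDl // (divn_small (ltn_pmod _ (P0 p))) addn0.
  by rewrite modnMDl modn_small.
Qed.

Lemma lhdE a l : \sum_(i < 2 ^ a * l.*2.+1) (2 ^ i.+1 %| 2 ^ a * l.*2.+1) = a.
Proof.
have c0 : 0 < 2 ^ a * l.*2.+1 by rewrite muln_gt0 expn_gt0.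
rewrite (eq_bigr (fun i : 'I__ => nat_of_bool (i < a))) => [|i _].
  by rewrite sum_ltn_ord // (leq_trans (ltnW (ltn_expl a (ltnSn 1)))) // leq_pmulr.
rewrite pfactor_dvdn // lognM ?expn_gt0 // pfactorK //.
by rewrite [logn 2 _.+1]lognE /= dvdn2 /= odd_double addn0.
Qed.

Section DenList.
Variable O : nat -> nat -> bool.
Local Notation D := (den O).

Lemma den_list ts e : D (Tlist ts) e = CodeSeq.code (map (D^~ e) ts).
Proof.
rewrite /Tlist; elim: ts => //= t ts IH.
by rewrite den_mul den_exp den_nat den_succ den_mul den_nat IH muln2.
Qed.

Lemma den_hd c e l : D c e = CodeSeq.code l -> D (Thd c) e = head 0 l.
Proof.
move=> h; rewrite den_sum h.
case: l h => [|a l] h; first by rewrite /= big_ord0.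
rewrite -[RHS](lhdE a (CodeSeq.code l)) /=; apply: eq_bigr => i _.
by rewrite den_not den_mod den_exp den_nat ?expn_gt0 // den_shift den_succ den_var /= h.
Qed.

Lemma den_tl c e l : D c e = CodeSeq.code l -> D (Ttl c) e = CodeSeq.code (behead l).
Proof.
move=> h; rewrite den_div ?den_nat // den_div den_exp ?den_nat ?expn_gt0 // h (den_hd h).
case: l h => [|a l] h /=; first by rewrite div0n.
by rewrite mulKn ?expn_gt0 // divn2 /= uphalf_double.
Qed.

Lemma den_get c e l i : D c e = CodeSeq.code l -> D (Tget c i) e = nth 0 l i.
Proof.
move=> h; rewrite /Tget -[i in RHS]addn0 -nth_drop nth0; apply: den_hd.
elim: i => [|i IH] /=; first by rewrite drop0.
by rewrite (den_tl IH) -drop1 drop_drop add1n.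
Qed.

Lemma den_ands ts e : D (Tands ts) e = all (fun t => 0 < D t e) ts.
Proof. by rewrite /Tands; elim: ts => [|t ts IH] /=; rewrite ?den_nat // den_and IH lt0b. Qed.

Lemma den_dig B T p e : 0 < B -> D (Tdig B T p) e = dig B (D T e) (D p e).
Proof.
by move=> h; rewrite den_mod ?den_nat // den_div den_exp ?den_nat ?expn_gt0 ?h.
Qed.

Lemma den_wr B T p d e : 0 < B -> D (Twr B T p d) e = wr B (D T e) (D p e) (D d e).
Proof.
have den_pow n : D (Texp (Tnat B) n) e = B ^ D n e by rewrite den_exp den_nat.
move=> h; rewrite !den_add !den_mul den_mod ?den_div ?den_pow ?expn_gt0 ?h //.
Qed.

Lemma den_chain (A : eqType) (l : seq A) (cond new : A -> term) cur e :
  (forall a, (0 < D (cond a) e) = (a == cur)) -> cur \in l ->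
  D (foldr (fun a r => Tif (cond a) (new a) r) Zero l) e = D (new cur) e.
Proof.
move=> h; elim: l => //= a l IH; rewrite in_cons den_if h eq_sym.
by case: eqP => [->|].
Qed.
End DenList.

Section Simulation.
Variables (m : nat) (M : machine m) (Q : nat -> term).
Let p := tag M.
Let k := ntapes p.
Let B := (nextra p + 3)%N.

Definition sym_code (x : symbol (nextra p)) : nat :=
  match x with
  | None => 0
  | Some (inl b) => b.+1
  | Some (inr i) => i + 3
  end.

Lemma sym_code_inj : injective sym_code.
Proof.
move=> [[[]|i]|] [[[]|i']|] //=; try lia.
by move=> /addIn/val_inj->.
Qed.

Lemma sym_code_lt x : sym_code x < B.
Proof. by case: x => [[[]|[i h]]|] /=; rewrite /B; lia. Qed.

Let B0 : 0 < B. Proof. by rewrite /B addn3. Qed.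

(* [ohead], [head] and [tape] read a configuration held by variable 0. *)
Let ohead (j : nat) := Tget (Tget (Var 0) 1) j.
Let head (i : nat) := Tget (Tget (Var 0) 2) i.
Let tape (i : nat) := Tget (Tget (Var 0) 3) i.

(** The term [Q j] supplies the bits of oracle [j], so a simulated oracle may be computed by a term
    instead of being queried. *)
Definition Tmatch (a : situation m p) : term :=
  Tands ([:: Teq (Tget (Var 0) 0) (Tnat a.1.1)] ++
    [seq Teq (call1 (Q (nat_of_ord j)) (ohead j)) (Tnat (a.1.2 j)) | j : 'I_m <- enum 'I_m] ++
    [seq Teq (Tdig B (tape i) (head i)) (Tnat (sym_code (a.2 i))) | i : 'I_k.+1 <- enum 'I_k.+1]).

Definition Taction (a : option (action m p)) : term :=
  if a is Some (q, od, wd, out) then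
    Tlist [:: Tnat (nat_of_ord q);
      Tlist [seq Tpred (Tadd (ohead j) (Tnat (od j))) | j : 'I_m <- enum 'I_m];
      Tlist [seq Tpred (Tadd (head i) (Tnat (wd i).2)) | i : 'I_k.+1 <- enum 'I_k.+1];
      Tlist [seq Twr B (tape i) (head i) (Tnat (sym_code (wd i).1)) | i : 'I_k.+1 <- enum 'I_k.+1];
      if out is Some b then Twr B (Tget (Var 0) 4) (Tget (Var 0) 5) (Tnat b.+1)
      else Tget (Var 0) 4;
      if out is Some b then Succ (Tget (Var 0) 5) else Tget (Var 0) 5]
  else Zero.

Definition Tstep : term := Tif (Var 0)
  (foldr (fun a r => Tif (Tmatch a) (Taction (tagged M a)) r) Zero
    (enum (situation m p))) Zero.

Definition Tinit : term :=
  Tlist [:: Zero; Tlist [seq Zero | j : 'I_m <- enum 'I_m]; Tlist [seq Zero | i : 'I_k.+1 <- enum 'I_k.+1];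
    Tlist [seq if i == ord0 then
       Rec (Tlog (Var 1)) Zero (Twr B (Var 0) (Var 1) (Succ (Tnth (Var 3) (Var 1))))
       else Zero | i : 'I_k.+1 <- enum 'I_k.+1]; Zero; Zero].

(** Variable 0 is the number of steps and variable 1 the coded input. The value 0, which represents
    no configuration, signals that the machine has halted. *)
Definition Trun : term := Rec (Var 0) Tinit Tstep.
Definition Toutput : term := Tdig B (Tget Trun 4) (Var 2).

(** Tapes are described by their digits only. The output is a tape too, with digit b.+1 for the bit
    b, so that 0 marks a position not yet output. *)
Definition represents (acc : nat) (c : config M) : Prop :=
  exists (tp : 'I_k.+1 -> nat) (o : nat),
  [/\ acc = CodeSeq.code [:: nat_of_ord (cstate c);
        CodeSeq.code [seq coracle c j | j : 'I_m <- enum 'I_m];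
        CodeSeq.code [seq chead c i | i : 'I_k.+1 <- enum 'I_k.+1];
        CodeSeq.code [seq tp i | i : 'I_k.+1 <- enum 'I_k.+1]; o; size (coutput c)],
      forall i n, dig B (tp i) n = sym_code (ctape c i n) &
      forall n, dig B o n = if n < size (coutput c) then (nth false (coutput c) n).+1 else 0].

Lemma represents_gt0 acc c : represents acc c -> 0 < acc.
Proof. by move=> [? [? [-> _ _]]]; rewrite muln_gt0 expn_gt0. Qed.

Lemma nth_enum_map n (f : 'I_n -> nat) (i : 'I_n) : nth 0 [seq f j | j <- enum 'I_n] i = f i.
Proof. by rewrite (nth_map i) ?size_enum_ord // nth_ord_enum. Qed.

Variables (O : nat -> nat -> bool) (T : m.-tuple cantor_space) (e : seq nat).
Hypothesis QT : forall (j : 'I_m) n a b,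
  den O (Q j) [:: n, a, b & e] = (tnth T j : nat -> bool) n.

Lemma represents_step acc idx c : represents acc c ->
  if step T c is Some c' then represents (den O Tstep [:: acc, idx & e]) c'
  else den O Tstep [:: acc, idx & e] = 0.
Proof.
move=> Rep; have acc0 := represents_gt0 Rep; have [tp [ow [accE tpE oE]]] := Rep.
pose e' := [:: acc, idx & e]; rewrite -/e'.
have v0 : den O (Var 0) e' = CodeSeq.code [:: nat_of_ord (cstate c);
        CodeSeq.code [seq coracle c j | j : 'I_m <- enum 'I_m];
        CodeSeq.code [seq chead c i | i : 'I_k.+1 <- enum 'I_k.+1];
        CodeSeq.code [seq tp i | i : 'I_k.+1 <- enum 'I_k.+1]; ow; size (coutput c)] by rewrite -accE.
have oh (j : 'I_m) : den O (ohead j) e' = coracle c j.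
  by rewrite (@den_get _ _ _ [seq coracle c j | j : 'I_m <- enum 'I_m]) ?nth_enum_map // (den_get _ v0).
have hh (i : 'I_k.+1) : den O (head i) e' = chead c i.
  by rewrite (@den_get _ _ _ [seq chead c i | i : 'I_k.+1 <- enum 'I_k.+1]) ?nth_enum_map // (den_get _ v0).
have th (i : 'I_k.+1) : den O (tape i) e' = tp i.
  by rewrite (@den_get _ _ _ [seq tp i | i : 'I_k.+1 <- enum 'I_k.+1]) ?nth_enum_map // (den_get _ v0).
rewrite /Tstep den_if /= acc0.
rewrite (@den_chain _ _ _ _ _ (current T c)); first last.
- by rewrite mem_enum.
- move=> [[q ob] sy]; rewrite den_ands lt0b !all_cat 2!all_map all_seq1 den_eq (den_get _ v0) den_nat lt0b.
  apply/idP/eqP => [/and3P[/eqP/ord_inj qE /allP obE /allP syE]|[-> -> ->]].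
    rewrite /current qE; congr (_, _, _); apply/ffunP => x; rewrite ffunE.
      have xA : x \in enum 'I_m by rewrite mem_enum.
      have := obE x xA; rewrite /= den_eq den_call1 QT oh den_nat lt0b.
      by move/eqP; case: (ob x); case: (tnth _ _ _).
    have xA : x \in enum 'I_k.+1 by rewrite mem_enum.
    have := syE x xA; rewrite /= den_eq den_dig // th hh tpE den_nat lt0b.
    by move=> /eqP/sym_code_inj.
  apply/and3P; split=> //; apply/allP => x _ /=; rewrite den_eq ffunE den_nat lt0b.
    by rewrite den_call1 QT oh.
  by rewrite den_dig // th hh tpE.
rewrite /step; case: (tagged M (current T c)) => [[[[q od] wd] out]|] /=; last by [].
exists (fun i => wr B (tp i) (chead c i) (sym_code (wd i).1)),
  (if out is Some b then wr B ow (size (coutput c)) b.+1 else ow); split.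
- rewrite /Taction den_list -!map_comp; congr CodeSeq.code; rewrite /= den_nat !den_list -!map_comp.
  congr [:: _; _; _; _; _; _].
  + by congr CodeSeq.code; apply: eq_map => j /=; rewrite den_pred den_add oh den_nat /move_head addnC.
  + by congr CodeSeq.code; apply: eq_map => j /=; rewrite den_pred den_add hh den_nat /move_head addnC.
  + by congr CodeSeq.code; apply: eq_map => j /=; rewrite den_wr // th hh den_nat.
  + by case: out => [b|]; rewrite ?den_wr // !(den_get _ v0) //= den_nat.
  + by case: out => [b|]; rewrite ?den_succ (den_get _ v0) //= size_rcons.
- by move=> i n; rewrite dig_wr ?sym_code_lt //= tpE; case: eqP.
- case: out => [b|] n; last exact: oE.
  rewrite dig_wr //; last by case: b; rewrite /B; lia.
  rewrite /= size_rcons nth_rcons oE ltnS.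
  by case: ltngtP.
Qed.

Variables (input : seq bool) (t : nat) (e0 : seq nat).
Hypothesis eE : e = [:: t, code input & e0].

Lemma represents_init : represents (den O Tinit e) (init M input).
Proof.
pose T0 := den O (Rec (Tlog (Var 1)) Zero (Twr B (Var 0) (Var 1) (Succ (Tnth (Var 3) (Var 1))))) e.
exists (fun i => if i == ord0 then T0 else 0), 0; split.
- rewrite /Tinit den_list; congr CodeSeq.code => /=; rewrite !den_list -!map_comp den_zero.
  congr [:: _; _; _; _; _; _].
  by congr CodeSeq.code; apply: eq_map => j /=; case: eqP.
- move=> i n /=; case: eqP => _; last by rewrite dig0.
  have v1 : den O (Var 1) e = code input by rewrite eE.
  rewrite /T0 den_rec den_log v1 lg_code.
  suff H N : N <= size input -> dig B (nat_rec (fun=> nat) (den O Zero e) (fun i x =>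
    den O (Twr B (Var 0) (Var 1) (Succ (Tnth (Var 3) (Var 1)))) [:: x, i & e]) N) n
    = if n < N then (nth false input n).+1 else 0.
    rewrite H //; case: ltnP => h; last by rewrite onth_default.
    have : onth input n by rewrite onthTE.
    by rewrite -odflt_onth; case: (onth input n).
  elim: N => [_|N IH h] /=; first by rewrite dig0.
  rewrite den_wr // dig_wr //; last first.
    rewrite den_succ (@den_nth _ _ _ _ input) ?eE //.
    by case: (nth _ _ _); rewrite /B; lia.
  rewrite den_succ (@den_nth _ _ _ _ input) ?eE //= -eE IH ?(ltnW h) //.
  by rewrite ltnS; case: (ltngtP n N) => // ->.
- by move=> n; rewrite dig0.
Qed.

Lemma den_run : if run M T t input is Some c then represents (den O Trun e) c
  else den O Trun e = 0.
Proof.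
have v0 : den O (Var 0) e = t by rewrite eE.
rewrite /Trun den_rec v0.
elim: (t) => [|n IH]; first exact: represents_init.
rewrite /run iterS -/(run M T n input) [nat_rec _ _ _ n.+1]/=.
case: (run M T n input) IH => [c|] IH /=; first exact: represents_step IH.
by rewrite IH /Tstep den_if.
Qed.

Lemma den_halt : (den O Trun e == 0) = ~~ run M T t input.
Proof.
have := den_run; case: (run _ _ _ _) => [c /represents_gt0|->] //.
by rewrite lt0n => /negbTE->.
Qed.

Lemma den_output : den O Toutput e = if run M T t input is Some c then
  if nth 0 e0 0 < size (coutput c) then (nth false (coutput c) (nth 0 e0 0)).+1 else 0
  else 0.
Proof.
have v2 : den O (Var 2) e = nth 0 e0 0 by rewrite eE.
rewrite /Toutput den_dig // v2; have := den_run.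
case: (run _ _ _ _) => [c [tp [ow [accE _ oE]]]|r0]; first by rewrite (den_get _ accE) oE.
by rewrite (@den_get _ _ _ [::]) ?dig0.
Qed.
End Simulation.

Local Open Scope classical_set_scope.

Definition prefix_of (x : cantor_space) (n : nat) : seq bool := mkseq (x : nat -> bool) n.

Lemma size_prefix_of x n : size (prefix_of x n) = n.
Proof. exact: size_mkseq. Qed.

Lemma nth_prefix_of x n i : i < n -> nth false (prefix_of x n) i = (x : nat -> bool) i.
Proof. exact: nth_mkseq. Qed.

Lemma take_prefix_of x n m : take n (prefix_of x m) = prefix_of x (minn n m).
Proof.
apply: (@eq_from_nth _ false).
  by rewrite size_take_min !size_prefix_of.
move=> i; rewrite size_take_min size_prefix_of leq_min => /andP[h1 h2].
by rewrite nth_take // !nth_prefix_of // leq_min h1 h2.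
Qed.

(** * Enumerability *)

Definition agrees m (O : nat -> nat -> bool) (T : m.-tuple cantor_space) : Prop :=
  forall j : 'I_m, O j = (tnth T j : nat -> bool).

Lemma agrees_tuple m (T : m.-tuple cantor_space) : agrees (tuple_oracle T) T.
Proof. by move=> j; apply/funext => n; exact: tuple_oracleE. Qed.

(** The normal form of enumerability: a projection of a 0-1-valued term. Allowing every [O] that
    agrees with [T] and every longer environment lets the term be used inside others. *)
Definition ce m (T : m.-tuple cantor_space) (W : nat -> set (seq bool)) : Prop :=
  exists t (F : nat -> nat -> seq bool -> bool),
    (forall O k n s e, agrees O T -> den O t [:: k, n, code s & e] = F k n s) /\
    (forall n s, W n s <-> exists k, F k n s).

Definition word (n : nat) (s : seq bool) : seq bool := nseq n true ++ false :: s.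

Lemma word_inj n n' s s' : word n s = word n' s' -> n = n' /\ s = s'.
Proof.
rewrite /word; elim: n n' => [|n IH] [|n'] //=; first by case.
by case=> /IH [-> ->].
Qed.

Definition Tones n := Tpred (Texp (Tnat 2) (Succ n)).
Definition Tword n s := Tcat (Tmul (Tones n) (Tnat 2)) s.

Lemma code_ones n : code (nseq n true) = (2 ^ n.+1).-1.
Proof.
elim: n => // n IH; rewrite -[in LHS]addn1 nseqD /= cats1 code_rcons IH !expnS.
have : 0 < 2 ^ n by rewrite expn_gt0.
by lia.
Qed.

Lemma den_ones O n e : den O (Tones n) e = code (nseq (den O n e) true).
Proof. by rewrite den_pred den_exp den_nat den_succ code_ones. Qed.

Lemma den_word O n s e x : den O s e = code x ->
  den O (Tword n s) e = code (word (den O n e) x).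
Proof.
move=> h; rewrite (@den_cat _ _ _ _ (rcons (nseq (den O n e) true) false) x) //.
  by rewrite /word cat_rcons.
by rewrite den_mul den_ones den_nat code_rcons addn0.
Qed.

Lemma code_word_ge n s : n <= code (word n s) /\ code s <= code (word n s).
Proof.
have /andP[h1 _] := code_bounds (word n s).
have /andP[h2 h3] := code_bounds s.
have szE : size (word n s) = n + (size s).+1 by rewrite size_cat size_nseq.
split; first by apply: leq_trans h1; rewrite szE ltnW // (leq_trans (ltn_expl n (ltnSn 1))) // leq_exp2l // leq_addr.
apply: leq_trans h1; apply: leq_trans (ltnW h3) _; rewrite leq_exp2l // szE; lia.
Qed.

Lemma ce_uniformly m (T : m.-tuple cantor_space) W :
  ce T W -> uniformly_ce T W.
Proof.
move=> [t [F [tE' WE]]]; set O := tuple_oracle T.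
have tE k n s e := tE' O k n s e (agrees_tuple T).
(* The machine receives only the code of 1^n 0 s; both [n] and the code of [s] are found by a search
   bounded by it, thanks to [code_word_ge]. *)
pose t' := Tex (Succ (Var 1)) (Tex (Succ (Var 2)) (Tand (Tlt Zero (Var 0))
  (Tand (Teq (Var 3) (Tword (Var 1) (Var 0))) (call3 t (Var 2) (Var 1) (Var 0))))).
exists (compile m (semidecider t')) => n s; rewrite WE semidecider_halts -/(word n s).
have t'E k c n' v s' : den O (Tand (Tlt Zero (Var 0))
  (Tand (Teq (Var 3) (Tword (Var 1) (Var 0))) (call3 t (Var 2) (Var 1) (Var 0))))
  [:: c; n'; k; v] = (0 < c) && (c == code s') && ((v == code (word n' s')) && F k n' s') :> nat
  \/ c <> code s'.
  have [->|] := eqVneq c (code s'); last by move/eqP; right.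
  left; rewrite !den_and den_lt !lt0b den_eq lt0b (@den_word _ _ _ _ s') // ?eqxx ?andbT.
  by rewrite den_call3 /= tE lt0b.
split=> -[k h]; exists k.
  have [h1 h2] := code_word_ge n s.
  rewrite den_ex eqb0 negbK; apply/has_iotaP; exists n => //.
  rewrite den_ex lt0b; apply/has_iotaP; exists (code s) => //.
  by case: (t'E k (code s) n (code (word n s)) s) => // ->; rewrite !eqxx code_gt0 h.
move: h; rewrite den_ex eqb0 negbK => /has_iotaP[n' _]; rewrite den_ex lt0b => /has_iotaP[c _].
case: (posnP c) => [->|c0]; first by rewrite den_and den_lt.
have [s' sE] := code_surj c0; case: (t'E k c n' (code (word n s)) s') => [->|]; last by rewrite sE.
by rewrite lt0b => /and3P[_ /eqP/code_inj/word_inj[-> ->]].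
Qed.

Lemma uniformly_ceP m (T : m.-tuple cantor_space) W :
  uniformly_ce T W -> ce T W.
Proof.
move=> [M ME].
pose Q j := Orc j (Var 0).
exists (Tnot (call2 (Trun M Q) (Var 0) (Tword (Var 1) (Var 2)))).
exists (fun k n s => ~~ run M T k (word n s)); split.
  move=> O k n s e OT; rewrite den_not den_call2 (@den_word _ _ _ _ s) //.
  by rewrite (@den_halt _ _ _ _ T _ _ (word n s) k [:: k, n, code s & e]) // => j p a b; rewrite /Q den_orc OT.
move=> n s; rewrite ME; split=> -[t h]; exists t.
  by rewrite /word h.
by move: h; rewrite /word; case: run.
Qed.

(** * Finite approximations of a partial computable function *)

Section Use.
Variables (m : nat) (M : machine m).

Lemma coracle_le (T : m.-tuple cantor_space) input t c j :
  run M T t input = Some c -> coracle c j <= t.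
Proof.
elim: t c => [|t IH] c; first by case=> <-.
rewrite /run iterS -/(run M T t input); case: (run M T t input) IH => [c0|] //= IH.
rewrite /step; case: (tagged M _) => [[[[q od] wd] ob]|] //= [<-] /=.
have := IH _ erefl; rewrite /move_head; case: (od j) => d hd /=.
by lia.
Qed.

(** An oracle head starts at 0 and moves at most one cell per step, so [t] steps read only bits
    below [t]. *)
Lemma run_local (T T' : m.-tuple cantor_space) input t :
  (forall j n, n < t -> (tnth T j : nat -> bool) n = (tnth T' j : nat -> bool) n) ->
  run M T t input = run M T' t input.
Proof.
elim: t => [//|t IH] h; rewrite /run !iterS -/(run M T t input) -/(run M T' t input).
rewrite -IH => [|j n nt]; last by apply: h; rewrite ltnS ltnW.
case E : (run M T t input) => [c|] //=.
rewrite /step; have -> // : current T c = current T' c.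
congr (_, _, _); apply/ffunP => j; rewrite !ffunE; apply: h.
by rewrite ltnS; exact: coracle_le E.
Qed.

Lemma run_prefix (T : m.-tuple cantor_space) input t t' c c' : t <= t' ->
  run M T t input = Some c -> run M T t' input = Some c' ->
  coutput c = take (size (coutput c)) (coutput c').
Proof.
move=> /subnK<-; elim: (t' - t) c' => [|d IH] c' hc.
  by rewrite add0n hc => -[<-]; rewrite take_size.
rewrite /run addSn iterS -/(run M T (d + t) input).
case: (run M T (d + t) input) IH => [c0|] //= IH.
rewrite /step; case: (tagged M _) => [[[[q od] wd] ob]|] //= [<-] /=.
have h := IH _ hc erefl; rewrite {1}h; case: ob => [b|] //.
have : size (coutput c) <= size (coutput c0) by rewrite h size_take_min geq_minr.
by rewrite -cats1 => hs; rewrite takel_cat.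
Qed.
End Use.

Lemma outputs_unique m (M : machine m) T (y y' : cantor_space) :
  outputs M T y -> outputs M T y' -> y = y'.
Proof.
move=> h h'; apply/funext => n.
have [t [c [r1 s1 n1]]] := h n; have [t' [c' [r2 s2 n2]]] := h' n.
rewrite -[y n]n1 -[y' n]n2; case: (leqP t t') => tt.
  by rewrite (run_prefix tt r1 r2) nth_take.
by rewrite (run_prefix (ltnW tt) r2 r1) nth_take.
Qed.

Lemma outputs_prefix m (M : machine m) T (y : cantor_space) n : outputs M T y ->
  exists t c, [/\ run M T t [::] = Some c, n <= size (coutput c) &
    forall i, i < n -> nth false (coutput c) i = (y : nat -> bool) i].
Proof.
move=> h; have [t [c [r1 s1 _]]] := h n.
exists t, c; split=> // [|i hi]; first exact: ltnW.
have [t' [c' [r2 s2 <-]]] := h i; case: (leqP t t') => tt.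
  by rewrite (run_prefix tt r1 r2) nth_take // (ltn_trans hi).
by rewrite (run_prefix (ltnW tt) r2 r1) nth_take.
Qed.

Definition out_digit m (M : machine m) T t n : nat :=
  if run M T t [::] is Some c then
    if n < size (coutput c) then (nth false (coutput c) n).+1 else 0
  else 0.

(* [E tau sigma]: the prefix [tau] of the argument suffices to compute the    *)
(* prefix [sigma] of the value within [size tau] steps.                       *)
Definition approximates (E : seq bool -> seq bool -> bool) (f : pfun) : Prop :=
  [/\ (forall x y, f x = Some y <->
         forall n, exists t, E (prefix_of x t) (prefix_of y n)),
      (forall x s t n, E (prefix_of x s) n -> s <= t -> E (prefix_of x t) n),
      (forall x s t a b, E (prefix_of x s) a -> E (prefix_of x t) b ->
         size a <= size b -> a = take (size a) b) &
      (forall s a i, E s a -> E s (take i a))].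

Definition seq_real (s : seq bool) : cantor_space := nth false s.

Lemma approximation f : partial_computable f ->
  exists E t, approximates E f /\
    forall O s a e, den O t [:: code s, code a & e] = E s a.
Proof.
move=> [w0 [M0 M0E] [M ME]].
(* Stage [t] of the computable oracle [w0]: digit 2 means that a bit true has been output, and
   missing bits count as false. [B] therefore insists that the first [size s] bits, all that can be
   read, are present. *)
pose om t : cantor_space := fun n => out_digit M0 [tuple] t n == 2.
pose B t s a :=
  all (fun i => 0 < out_digit M0 [tuple] t i) (iota 0 (size s)) &&
  all (fun i => out_digit M [tuple seq_real s; om t] (size s) i == (nth false a i).+1)
      (iota 0 (size a)).
(* Admitting all shorter prefixes and smaller stages makes [E] monotone under extension of [s]. *)
pose E s a := has (fun i => has (fun t => B t (take i s) a) (iota 0 (size s).+1))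
  (iota 0 (size s).+1).
pose T0 := Toutput M0 (fun=> Zero).
(* Inside the simulation, variables 0 to 2 are the queried position, the configuration and the step
   index; [t] and [code s] have moved to 7 and 8. [Tnat 1] is the code of the empty input. *)
pose Q j := if j == 0 then Tnth (Var 8) (Var 0)
            else Teq (call3 T0 (Var 7) (Tnat 1) (Var 0)) (Tnat 2).
pose TB := Tand (Tall (Tlog (Var 1)) (call3 T0 (Var 1) (Tnat 1) (Var 0)))
  (Tall (Tlog (Var 2)) (Teq (call3 (Toutput M Q) (Tlog (Var 2)) (Tnat 1) (Var 0))
     (Succ (Tnth (Var 3) (Var 0))))).
exists E, (Tex (Succ (Tlog (Var 0))) (Tex (Succ (Tlog (Var 1)))
  (call3 TB (Var 0) (Ttake (Var 1) (Var 2)) (Var 3)))).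
have T0E O t n e : den O T0 [:: t, 1, n & e] = out_digit M0 [tuple] t n.
  rewrite /T0 (@den_output _ _ _ _ [tuple] _ _ [::] t (n :: e)) // => -[j jm]; by have := jm; rewrite ltn0.
split; last first.
  have TBE O t s a e : den O TB [:: t, code s, code a & e] = B t s a.
    rewrite den_and !den_all !lt0b /B.
    rewrite (@den_len _ _ _ s) // (@den_len _ _ _ a) //.
    congr (nat_of_bool (_ && _)); apply: eq_in_all => i _.
      by rewrite den_call3 den_nat T0E.
    rewrite den_eq lt0b den_call3 den_nat (@den_len _ _ _ s) // den_succ (@den_nth _ _ _ _ a) //=.
    rewrite (@den_output _ _ _ _ [tuple seq_real s; om t] _ _ [::] (size s) [:: i, i, t, code s, code a & e]) //.
    move=> j n b c; rewrite /Q; case: j => -[|[|//]] h /=; rewrite (tnth_nth (fun=> false)) /=.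
      by rewrite (@den_nth _ _ _ _ s).
    by rewrite den_eq den_call3 !den_nat T0E.
  move=> O s a e; rewrite den_ex den_succ (@den_len _ _ _ s) //.
  congr nat_of_bool; apply: eq_has => i; rewrite den_ex lt0b den_succ (@den_len _ _ _ s) //.
  apply: eq_has => t; rewrite den_call3 /= (@den_take _ _ _ _ s) //.
  by rewrite TBE lt0b.
have omE t n : 0 < out_digit M0 [tuple] t n -> om t n = (w0 : nat -> bool) n.
  rewrite /om /out_digit; case r1: (run _ _ _ _) => [c|] //; case: (ltnP n (size (coutput c))) => // sn _.
  have [t' [c' [r2 s2 <-]]] := M0E n.
  suff -> : nth false (coutput c) n = nth false (coutput c') n by case: (nth false (coutput c') n).
  case: (leqP t t') => tt; first by rewrite (run_prefix tt r1 r2) nth_take.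
  by rewrite (run_prefix (ltnW tt) r2 r1) nth_take.
pose Rx x i a := forall k, k < size a -> exists2 c, run M [tuple x; w0] i [::] = Some c &
   k < size (coutput c) /\ nth false (coutput c) k = nth false a k.
have omR x i t : (forall n, n < i -> 0 < out_digit M0 [tuple] t n) ->
    run M [tuple seq_real (prefix_of x i); om t] i [::] = run M [tuple x; w0] i [::].
  move=> h; apply: run_local => -[[|[|//]] hj] n ni; rewrite !(tnth_nth (fun=> false)) /=.
    by rewrite /seq_real nth_prefix_of.
  by apply: omE; apply: h.
have BR x t i a : B t (prefix_of x i) a -> Rx x i a.
  move=> /andP[/all_iotaP h1 /all_iotaP h2]; rewrite size_prefix_of in h1 h2.
  have rE := omR x i t h1.
  move=> k ka; have := h2 k ka; rewrite /out_digit rE.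
  case: (run _ _ _ _) => // c; case: (ltnP k _) => // kc /eqP[e]; exists c => //.
  by split=> //; move: e; case: nth; case: nth.
have RB x i a : Rx x i a -> exists t, B t (prefix_of x i) a.
  move=> h; have [t [c [rt st nt]]] := outputs_prefix i M0E.
  have h1 n : n < i -> 0 < out_digit M0 [tuple] t n.
    by move=> ni; rewrite /out_digit rt (leq_trans ni st).
  exists t; rewrite /B size_prefix_of; apply/andP; split; apply/all_iotaP => k ka; first exact: h1.
  rewrite /out_digit omR //; have [c' -> [kc ->]] := h k ka.
  by rewrite kc.
have ER x s a : E (prefix_of x s) a -> exists2 i, i <= s & Rx x i a.
  move=> /has_iotaP[i]; rewrite size_prefix_of ltnS => is_ /has_iotaP[t _ h].
  by exists i => //; apply: (BR _ t); move: h; rewrite take_prefix_of (minn_idPl is_).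
have RE x i a : Rx x i a -> exists s, E (prefix_of x s) a.
  move=> /RB[t h]; exists (i + t); apply/has_iotaP; exists i.
    by rewrite size_prefix_of ltnS leq_addr.
  apply/has_iotaP; exists t; first by rewrite size_prefix_of ltnS leq_addl.
  by rewrite take_prefix_of (minn_idPl (leq_addr _ _)).
split.
- move=> x y; rewrite ME; split=> [h n|h n].
    have [t [c [rt st nt]]] := outputs_prefix n h; apply: (RE _ t) => k.
    rewrite size_prefix_of => kn; exists c => //.
    by split; [apply: leq_trans st|rewrite nt // nth_prefix_of].
  have [t /ER[i _ /(_ n)]] := h n.+1; rewrite size_prefix_of ltnSn => /(_ isT).
  move=> [c rc [nc e]]; exists i, c; split=> //.
  by rewrite e nth_prefix_of.
- move=> x s t a /has_iotaP[i]; rewrite size_prefix_of ltnS => is_.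
  move=> /has_iotaP[u]; rewrite ltnS => us hB st.
  have it := leq_trans is_ st; apply/has_iotaP; exists i.
    by rewrite size_prefix_of ltnS.
  apply/has_iotaP; exists u; first by rewrite size_prefix_of ltnS (leq_trans us).
  by move: hB; rewrite !take_prefix_of !(minn_idPl _).
- move=> x s t a b /ER[i _ hi] /ER[j _ hj] ab; apply: (@eq_from_nth _ false).
    by rewrite size_takel.
  move=> k ka; rewrite nth_take //.
  have [c rc [kc <-]] := hi k ka; have [c' rc' [kc' <-]] := hj k (leq_trans ka ab).
  case: (leqP i j) => ij; first by rewrite (run_prefix ij rc rc') nth_take.
  by rewrite (run_prefix (ltnW ij) rc' rc) nth_take.
- move=> s a i /has_iotaP[j js /has_iotaP[t ts /andP[h1 /all_iotaP h2]]].
  apply/has_iotaP; exists j => //; apply/has_iotaP; exists t => //; rewrite /B h1.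
  apply/all_iotaP => k; rewrite size_take_min leq_min => /andP[ki ka].
  by rewrite nth_take //; apply: h2.
Qed.

(** * The halting problem as an oracle *)

Lemma npair_inj e e' n n' : npair e n = npair e' n' -> e = e' /\ n = n'.
Proof.
rewrite /npair => h.
have {}h : 2 ^ e * n.*2.+1 = 2 ^ e' * n'.*2.+1.
  have : 0 < 2 ^ e by rewrite expn_gt0.
  have : 0 < 2 ^ e' by rewrite expn_gt0.
  move: h.
  by case: (2 ^ e) => //; case: (2 ^ e') => // a b; rewrite !mulSn; lia.
have ee : e = e' by rewrite -(lhdE e n) h lhdE.
split=> //; move/eqP: h; rewrite ee eqn_pmul2l ?expn_gt0 //.
by move=> /eqP[/double_inj].
Qed.

(** Compile the search for [k] to an oracle-free machine that halts on 1^n exactly if a witness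
    exists. Its [pickle] is a constant, so a single query decides the question. *)
Lemma halting_query t (F : nat -> nat -> bool) :
  (forall O k n e, den O t [:: k, n & e] = F k n) ->
  exists t', forall O n e, O 0 = (halting_set : nat -> bool) ->
    den O t' (n :: e) = `[< exists k, F k n >].
Proof.
move=> tE; pose O0 := tuple_oracle ([tuple] : 0.-tuple cantor_space).
pose s := semidecider (Tex (Succ (Var 1)) (Tand (Teq (Var 2) (Tones (Var 0)))
  (call2 t (Var 1) (Var 0)))).
have [M sE] : exists M : machine 0, forall n,
    halts M [tuple] (nseq n true) <-> exists k, F k n.
  exists (compile 0 s) => n; rewrite semidecider_halts; split=> -[k h]; exists k.
    move: h; rewrite den_ex eqb0 negbK => /has_iotaP[i _].
    rewrite den_and lt0b den_eq lt0b den_var den_ones => /andP[/eqP/code_inj/(congr1 size)].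
    by rewrite !size_nseq den_call2 => <-; rewrite tE lt0b.
  rewrite den_ex eqb0 negbK; apply/has_iotaP; exists n.
    rewrite den_succ den_var /= ltnS.
    have /andP[h1 _] := code_bounds (nseq n true); apply: leq_trans h1.
    by rewrite size_nseq ltnW // ltn_expl.
  by rewrite den_and lt0b den_eq lt0b den_var den_ones eqxx den_call2 tE lt0b.
exists (Orc 0 (Tpred (Tmul (Texp (Tnat 2) (Tnat (pickle M)))
  (Succ (Tmul (Var 0) (Tnat 2)))))) => O n e O0E.
rewrite den_orc O0E den_pred den_mul den_exp !den_nat den_succ den_mul den_nat muln2 /=.
rewrite -/(npair _ n) /halting_set; congr nat_of_bool; apply/asboolP/asboolP.
  by move=> [M' [n' [/npair_inj[/(pcan_inj pickleK) <- <-]]]]; rewrite sE.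
by move=> h; exists M, n; rewrite sE.
Qed.

(** * The uniform measure *)

Local Notation borel A := (measurable (A : set cantor_borel)).

Lemma cylinderP (s : seq bool) (x : cantor_space) :
  cylinder s x <-> prefix_of x (size s) = s.
Proof. by []. Qed.

Lemma cylinder_prefix (x : cantor_space) n : cylinder (prefix_of x n) x.
Proof. by rewrite cylinderP size_prefix_of. Qed.

Lemma cylinder_take (x : cantor_space) s n : cylinder s x -> (size s <= n)%N ->
  take (size s) (prefix_of x n) = s.
Proof. by move=> /cylinderP h sn; rewrite take_prefix_of (minn_idPl sn). Qed.

Lemma open_ofP S (x : cantor_space) : open_of S x <-> exists n, S (prefix_of x n).
Proof.
split=> [[s Ss /cylinderP xs]|[n Sn]]; first by exists (size s); rewrite xs.
by exists (prefix_of x n) => //; exact: cylinder_prefix.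
Qed.

(** Indexing strings by numbers turns unions and sums over sets of strings into countable unions and
    series over nat. *)
Definition codes (S : set (seq bool)) : set nat := [set c | (0 < c)%N /\ S (decode c)].

Lemma bigcup_codes S (F : seq bool -> set cantor_space) :
  \bigcup_(s in S) F s = \bigcup_(c in codes S) F (decode c).
Proof.
apply/seteqP; split=> [x [s Ss Fs]|x [c [c0 Sc] Fc]]; last by exists (decode c).
by exists (code s); rewrite /codes /= ?codeK ?code_gt0.
Qed.

Lemma borel_cylinder s : borel (cylinder s).
Proof. by apply: sub_sigma_algebra; exists s. Qed.

Lemma borel_bigcup S (F : seq bool -> set cantor_space) :
  (forall s, S s -> borel (F s)) -> borel (\bigcup_(s in S) F s).
Proof.
by move=> h; rewrite bigcup_codes; apply: bigcup_measurable => c [_ /h].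
Qed.

Lemma borel_open S : borel (open_of S).
Proof. by apply: borel_bigcup => s _; exact: borel_cylinder. Qed.

Lemma prefix_set_open (P : seq bool -> Prop) t :
  [set x : cantor_space | P (prefix_of x t)] = open_of [set s | size s = t /\ P s].
Proof.
apply/seteqP; split=> x /=; rewrite open_ofP.
  by move=> h; exists t; rewrite /= size_prefix_of.
by move=> [n /= []]; rewrite size_prefix_of => ->.
Qed.

Lemma borel_prefix (P : seq bool -> Prop) t : borel [set x : cantor_space | P (prefix_of x t)].
Proof. by rewrite prefix_set_open; exact: borel_open. Qed.

Section Lam.
Local Open Scope ring_scope.
Variable R : realType.
Implicit Types (A B : set cantor_space).
Local Notation mu := (uniform_measure R).

Definition lam A : R := fine (mu A).

Lemma lamE A : borel A -> mu A = (lam A)%:E.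
Proof. by move=> mA; rewrite fineK // fin_num_measure. Qed.

Lemma lam_ge0 A : 0 <= lam A.
Proof. by apply: fine_ge0; exact: measure_ge0. Qed.

Lemma mu_mono A B : A `<=` B -> (mu A <= mu B)%E.
Proof.
by move=> AB; apply: le_mu_ext => x [Ax xI]; split=> //; exact: AB.
Qed.

Lemma lam_le A B : borel A -> borel B -> A `<=` B -> lam A <= lam B.
Proof. by move=> mA mB AB; rewrite -lee_fin -!lamE //; exact: mu_mono. Qed.

Lemma lam_le1 A : borel A -> lam A <= 1.
Proof. by move=> mA; rewrite -lee_fin -lamE //; exact: probability_le1. Qed.

Lemma lamT : lam [set: _] = 1.
Proof. by rewrite /lam (@probability_setT _ _ _ mu). Qed.

Lemma lam0 : lam set0 = 0.
Proof. by rewrite /lam (@measure0 _ _ _ mu). Qed.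

Lemma lamC A : borel A -> lam (~` A) = 1 - lam A.
Proof.
move=> mA; apply: EFin_inj; rewrite EFinB -!lamE //; last exact: measurableC.
exact: (@probability_setC _ _ _ mu).
Qed.

Lemma lamU A B : borel A -> borel B -> A `&` B = set0 -> lam (A `|` B) = lam A + lam B.
Proof.
move=> mA mB AB; apply: EFin_inj; rewrite EFinD -!lamE //; last exact: measurableU.
exact: (@measureU _ _ _ mu).
Qed.

Lemma lamD A B : borel A -> borel B -> A `<=` B -> lam (B `\` A) = lam B - lam A.
Proof.
move=> mA mB AB; have mD : borel (B `\` A) by exact: measurableD.
have dis : A `&` (B `\` A) = set0 by rewrite setIDA setIC -setIDA setDv setI0.
have := lamU mA mD dis; rewrite (setDUK AB) => ->.
by rewrite addrC addKr.
Qed.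

Lemma lamU_le A B : borel A -> borel B -> lam (A `|` B) <= lam A + lam B.
Proof.
move=> mA mB; rewrite -lee_fin EFinD -!lamE //; last exact: measurableU.
exact: (@measureU2 _ _ _ mu).
Qed.

Lemma lam_cylinder s : lam (cylinder s) = 2 ^- size s.
Proof. by rewrite /lam uniform_measure_cylinder. Qed.

Lemma lam_sup (F : nat -> set cantor_space) (r : R) :
  (forall n, borel (F n)) -> (forall n m, (n <= m)%N -> F n `<=` F m) ->
  r < lam (\bigcup_n F n) -> exists n, r < lam (F n).
Proof.
move=> mF hF hr; apply: contrapT => hn.
have hle n : (mu (F n) <= r%:E)%E.
  by rewrite lamE // lee_fin leNgt; apply/negP => h; apply: hn; exists n.
have mU : borel (\bigcup_n F n) by exact: bigcupT_measurable.
have cv : mu \o F @ \oo --> mu (\bigcup_n F n).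
  by apply: (@nondecreasing_cvg_mu _ _ _ mu) => // n m nm; apply/subsetPset; exact: hF.
have : (mu (\bigcup_n F n) <= r%:E)%E.
  rewrite -(cvg_lim _ cv) //; apply: lime_le; first by apply/cvg_ex; exists (mu (\bigcup_n F n)).
  by apply: nearW => n /=; exact: hle.
by rewrite lamE // lee_fin leNgt hr.
Qed.

Lemma lam_inf (F : nat -> set cantor_space) (r : R) :
  (forall n, borel (F n)) -> (forall n m, (n <= m)%N -> F m `<=` F n) ->
  lam (\bigcap_n F n) < r -> exists n, lam (F n) < r.
Proof.
move=> mF hF hr; have mI : borel (\bigcap_n F n) by exact: bigcapT_measurable.
have [|||n] := @lam_sup (fun n => ~` F n) (1 - r).
- by move=> n; exact: measurableC.
- by move=> n m nm; apply: subsetC; exact: hF.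
- by rewrite -setC_bigcap lamC // ltrD2l ltrN2.
by exists n; move: p; rewrite lamC // ltrD2l ltrN2.
Qed.

Lemma lam_bigcup_le (F : nat -> set cantor_space) (c : R) :
  (forall n, borel (F n)) -> (forall n, lam (F n) <= c * 2 ^- n.+1) ->
  lam (\bigcup_n F n) <= c.
Proof.
move=> mF hF; rewrite leNgt; apply/negP => hc.
pose G N := \bigcup_(n in [set n | (n < N)%N]) F n.
have mG N : borel (G N) by apply: bigcup_measurable.
have UG : \bigcup_n F n = \bigcup_N G N.
  apply/seteqP; split=> x [n _]; first by move=> Fx; exists n.+1 => //; exists n => /=.
  by move=> [k _ Fx]; exists k.
rewrite UG in hc; have [N hN] : exists N, c < lam (G N).
  apply: lam_sup mG _ hc => n m nm x [k /= kn Fx]; by exists k => //=; exact: leq_trans nm.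
have GN : lam (G N) <= c * (1 - 2 ^- N).
  elim: N {hN} => [|N IH].
    rewrite [G 0%N](_ : _ = set0) ?lam0 ?expr0 ?invr1 ?subrr ?mulr0 //.
    by apply/seteqP; split=> x // [].
  have -> : G N.+1 = G N `|` F N.
    apply/seteqP; split=> x [].
    - move=> n /=; rewrite ltnS leq_eqVlt => /orP[/eqP->|h] Fx; first by right.
      by left; exists n.
    - by move=> [n /= h Fx]; exists n => //=; exact: ltnW.
    - by exists N => /=.
  apply: (le_trans (lamU_le (mG N) (mF N))).
  apply: (le_trans (lerD IH (hF N))); rewrite -mulrDr.
  have c0 : 0 <= c by have := le_trans (lam_ge0 (F 0%N)) (hF 0%N); rewrite pmulr_lge0 // invr_gt0 exprn_gt0.
  apply: ler_wpM2l => //; rewrite exprS invfM.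
  by set p := 2 ^- N; lra.
have c0 : 0 <= c by have := le_trans (lam_ge0 (F 0%N)) (hF 0%N); rewrite pmulr_lge0 // invr_gt0 exprn_gt0.
have := lt_le_trans hN GN.
have p0 : 0 < 2 ^- N :> R by rewrite invr_gt0 exprn_gt0.
by apply/negP; rewrite -leNgt mulrBr mulr1 lerBlDr lerDl mulr_ge0 // ltW.
Qed.

Lemma lam_bigcup0 (F : nat -> set cantor_space) :
  (forall n, borel (F n)) -> (forall n, lam (F n) = 0) -> lam (\bigcup_n F n) = 0.
Proof.
move=> mF hF; apply/eqP; rewrite eq_le lam_ge0 andbT; apply: lam_bigcup_le => // n.
by rewrite hF mul0r.
Qed.

Lemma lam_seq (l : seq (seq bool)) t : uniq l -> all (fun s => size s == t) l ->
  lam [set x | prefix_of x t \in l] = (size l)%:R * 2 ^- t.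
Proof.
elim: l => [|s l IH] /=.
  by rewrite mul0r => _ _; rewrite [X in lam X](_ : _ = set0) ?lam0 //; apply/seteqP; split.
move=> /andP[sl ul] /andP[/eqP ss al].
rewrite [X in lam X](_ : _ = cylinder s `|` [set x | prefix_of x t \in l]).
  rewrite lamU ?IH ?lam_cylinder ?ss //; first by rewrite -natr1; ring.
  - exact: borel_cylinder.
  - exact: (@borel_prefix (fun u => u \in l)).
  - apply/seteqP; split=> x //= [/cylinderP]; rewrite ss => ->.
    by rewrite (negbTE sl).
apply/seteqP; split=> x /=; rewrite in_cons.
  by move=> /orP[/eqP h|h]; [left; apply/cylinderP; rewrite ss|right].
by move=> [/cylinderP|->]; rewrite ?orbT // ss => ->; rewrite eqxx.
Qed.

Lemma lam_count (P : pred (seq bool)) t :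
  lam [set x | P (prefix_of x t)] = (count P (strings t))%:R * 2 ^- t.
Proof.
rewrite -size_filter -lam_seq ?filter_uniq ?uniq_strings //; last first.
  by apply/allP => s; rewrite mem_filter mem_strings => /andP[].
congr lam; apply/seteqP; split=> x /=; rewrite mem_filter mem_strings size_prefix_of eqxx andbT //.
Qed.

(** * Prefix-free sets and the maximal inequality *)

Definition prefix_free (S : set (seq bool)) : Prop :=
  forall s i, S s -> S (take i s) -> (size s <= i)%N.

Lemma prefix_free_disjoint S s u x : prefix_free S -> S s -> S u ->
  cylinder s x -> cylinder u x -> s = u.
Proof.
wlog su : s u / (size s <= size u)%N.
  by case: (leqP (size s) (size u)) => h H *; [apply: H|apply/esym; apply: H => //; exact: ltnW].
move=> pf Ss Su xs /cylinderP xu.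
have e := cylinder_take xs su; rewrite xu in e.
by have := pf u (size s) Su; rewrite e => /(_ Ss) us; rewrite -e take_oversize.
Qed.

Definition seq_sum (S : set (seq bool)) (g : seq bool -> R) : \bar R :=
  (\sum_(0 <= c <oo | c \in codes S) (g (decode c))%:E)%E.

Lemma lam_disjoint_bigcup S (F : seq bool -> set cantor_space) :
  (forall s, S s -> borel (F s)) ->
  (forall s u x, S s -> S u -> F s x -> F u x -> s = u) ->
  (lam (\bigcup_(s in S) F s))%:E = seq_sum S (lam \o F).
Proof.
move=> mF dF; rewrite -lamE; last exact: borel_bigcup.
rewrite bigcup_codes (@measure_bigcup _ _ _ mu).
- by apply: eq_eseriesr => c; rewrite inE => -[_ Sc] /=; rewrite lamE //; exact: mF.
- by move=> c [_ /mF].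
- move=> c d [c0 Sc] [d0 Sd] [x [xc xd]].
  by rewrite -(decodeK c0) -(decodeK d0); congr code; exact: dF xc xd.
Qed.

Lemma lam_bigcup_sum S (F : seq bool -> set cantor_space) :
  (forall s, S s -> borel (F s)) ->
  ((lam (\bigcup_(s in S) F s))%:E <= seq_sum S (lam \o F))%E.
Proof.
move=> mF; rewrite -lamE; last exact: borel_bigcup.
pose G c := if c \in codes S then F (decode c) else set0.
apply: (@le_trans _ _ (\sum_(0 <= c <oo) mu (G c))%E).
  apply: (@measure_sigma_subadditive _ _ _ mu).
  - move=> c; rewrite /G; case: ifPn => //; rewrite inE => -[_ Sc]; exact: mF.
  - exact: borel_bigcup.
  - rewrite bigcup_codes => x [c Sc Fx]; exists c => //; rewrite /G ifT //.
    exact/mem_set.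
rewrite /seq_sum [leRHS]eseries_mkcond; apply: lee_nneseries => c; first by move=> *; exact: measure_ge0.
move=> _; rewrite /G; case: ifPn; last by rewrite measure0.
by rewrite inE => -[_ Sc] /=; rewrite lamE //; exact: mF.
Qed.

Lemma seq_sum_le S (g h : seq bool -> R) : (forall s, 0 <= g s) ->
  (forall s, S s -> g s <= h s) -> (seq_sum S g <= seq_sum S h)%E.
Proof.
move=> g0 gh; apply: lee_nneseries => c; first by move=> *; rewrite lee_fin.
by rewrite inE => -[_ /gh]; rewrite lee_fin.
Qed.

Lemma seq_sumZ S (g : seq bool -> R) (r : R) : (forall s, 0 <= g s) ->
  seq_sum S (fun s => r * g s) = (r%:E * seq_sum S g)%E.
Proof.
move=> g0; rewrite /seq_sum -nneseriesZl; last by move=> *; rewrite lee_fin.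
by apply: eq_eseriesr => c _; rewrite EFinM.
Qed.

Lemma lam_open_sum S : prefix_free S ->
  (lam (open_of S))%:E = seq_sum S (fun s => 2 ^- size s).
Proof.
move=> pf; rewrite lam_disjoint_bigcup.
- by apply: eq_eseriesr => c _ /=; rewrite lam_cylinder.
- by move=> s _; exact: borel_cylinder.
- by move=> s u x Ss Su; exact: prefix_free_disjoint pf Ss Su.
Qed.

Definition minimal (S : set (seq bool)) : set (seq bool) :=
  [set s | S s /\ forall i, (i < size s)%N -> ~ S (take i s)].

Lemma minimal_prefix_free S : prefix_free (minimal S).
Proof.
move=> s i [Ss h] [Si _]; rewrite leqNgt; apply/negP => /h; exact.
Qed.

Lemma open_minimal S : open_of (minimal S) = open_of S.
Proof.
apply/seteqP; split=> x /open_ofP[n h]; apply/open_ofP; first by case: h => h _; exists n.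
have ex : exists n, `[< S (prefix_of x n) >] by exists n; apply/asboolP.
case: (ex_minnP ex) => k /asboolP hk kmin; exists k; split=> // i.
rewrite size_prefix_of take_prefix_of => ik; rewrite (minn_idPl (ltnW ik)) => /asboolP/kmin.
by rewrite leqNgt ik.
Qed.

(* Restricting to the minimal strings of [S] makes the cylinders, and hence   *)
(* the sets [F s], disjoint.                                                  *)
Lemma maximal_inequality S (F : seq bool -> set cantor_space) (r : R) : 0 <= r ->
  (forall s, borel (F s)) ->
  (forall s u x, F s x -> F u x -> (size s <= size u)%N -> s = take (size s) u) ->
  (forall s, S s -> r * 2 ^- size s <= lam (F s)) ->
  r * lam (open_of S) <= lam (\bigcup_(s in S) F s).
Proof.
move=> r0 mF dF hF; have pf := @minimal_prefix_free S.
apply: (@le_trans _ _ (lam (\bigcup_(s in minimal S) F s))); last first.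
  apply: lam_le; [exact: borel_bigcup|exact: borel_bigcup|].
  by move=> x [s [Ss _] Fx]; exists s.
have g0 (s : seq bool) : 0 <= 2 ^- size s :> R by rewrite invr_ge0 exprn_ge0.
rewrite -lee_fin EFinM -open_minimal lam_open_sum // -seq_sumZ //.
rewrite lam_disjoint_bigcup //.
  by apply: seq_sum_le => [s|s [Ss _]]; [rewrite mulr_ge0|exact: hF].
have key s u x : minimal S s -> minimal S u -> F s x -> F u x ->
    (size s <= size u)%N -> s = u.
  move=> ms mu_ Fs Fu su; have e := dF _ _ _ Fs Fu su.
  have := pf u (size s) mu_; rewrite -e => /(_ ms) us.
  by rewrite e take_oversize.
move=> s u x ms mu_ Fs Fu; case: (leqP (size s) (size u)) => h; first exact: key Fs Fu h.
by apply/esym; exact: key Fu Fs (ltnW h).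
Qed.

End Lam.

(** * Open sets enumerable in an oracle *)

Definition sigma1 (w : cantor_space) (S : set (seq bool)) : Prop :=
  exists t (F : nat -> seq bool -> bool),
    (forall O k s e, O 0 = (w : nat -> bool) -> den O t [:: k, code s & e] = F k s) /\
    (forall s, S s <-> exists k, F k s).

(** Bounding both the prefix and the witness by [size s] makes this decidable and monotone, while
    the union over all lengths is still the whole open set ([open_covered]). *)
Definition covered (F : nat -> seq bool -> bool) (s : seq bool) : bool :=
  has (fun i => has (fun k => F k (take i s)) (iota 0 (size s).+1))
      (iota 0 (size s).+1).

Definition Tcovered t := Tex (Succ (Tlog (Var 0))) (Tex (Succ (Tlog (Var 1)))
  (call2 t (Var 0) (Ttake (Var 1) (Var 2)))).

Lemma den_covered O t (F : nat -> seq bool -> bool) s e :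
  (forall k s e, den O t [:: k, code s & e] = F k s) ->
  den O (Tcovered t) (code s :: e) = covered F s.
Proof.
move=> tE; rewrite den_ex den_succ (@den_len _ _ _ s) //; congr nat_of_bool.
apply: eq_has => i; rewrite den_ex den_succ (@den_len _ _ _ s) // lt0b.
by apply: eq_has => k; rewrite den_call2 (@den_take _ _ _ _ s) // tE lt0b.
Qed.

Lemma covered_take F i s : covered F (take i s) -> covered F s.
Proof.
move=> /has_iotaP[j]; rewrite ltnS => js /has_iotaP[k ks].
have sz : size (take i s) <= size s by rewrite size_take_min geq_minr.
rewrite ltnS in ks; have js' := leq_trans js sz.
rewrite take_takel; last by apply: leq_trans js _; rewrite size_take_min geq_minl.
move=> h; apply/has_iotaP; exists j; first by rewrite ltnS.
by apply/has_iotaP; exists k => //; rewrite ltnS (leq_trans ks).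
Qed.

Lemma covered_mono F x s t : covered F (prefix_of x s) -> s <= t ->
  covered F (prefix_of x t).
Proof.
by move=> h st; apply: (@covered_take _ s); rewrite take_prefix_of (minn_idPl st).
Qed.

Lemma open_covered S (F : nat -> seq bool -> bool) x : (forall s, S s <-> exists k, F k s) ->
  open_of S x <-> exists t, covered F (prefix_of x t).
Proof.
move=> SF; rewrite open_ofP; split=> [[n /SF[k h]]|[t /has_iotaP[i _ /has_iotaP[k _ h]]]].
  exists (n + k); apply/has_iotaP; exists n; first by rewrite size_prefix_of ltnS leq_addr.
  apply/has_iotaP; exists k; first by rewrite size_prefix_of ltnS leq_addl.
  by rewrite take_prefix_of (minn_idPl (leq_addr _ _)).
by exists (minn i t); apply/SF; exists k; rewrite -take_prefix_of.
Qed.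

Lemma sigma1_set0 w : sigma1 w set0.
Proof.
exists Zero, (fun _ _ => false); split=> [//|s]; split=> [[]|[k //]].
Qed.

Lemma sigma1_setU w S1 S2 : sigma1 w S1 -> sigma1 w S2 -> sigma1 w (S1 `|` S2).
Proof.
move=> [t1 [F1 [tE1 SF1]]] [t2 [F2 [tE2 SF2]]].
exists (Tor t1 t2), (fun k s => F1 k s || F2 k s); split.
  by move=> O k s e Ow; rewrite den_or tE1 // tE2 // !lt0b.
move=> s; rewrite /setU /= SF1 SF2; split.
  by move=> [[k h]|[k h]]; exists k; rewrite h ?orbT.
by move=> [k /orP[h|h]]; [left|right]; exists k.
Qed.

Lemma ce_sigma1 w W n : ce [tuple w] W -> sigma1 w (W n).
Proof.
move=> [t [F [tE WF]]]; exists (call3 t (Var 0) (Tnat n) (Var 1)), (fun k s => F k n s).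
split; last by move=> s; exact: WF.
move=> O k s e Ow; rewrite den_call3 den_nat /= tE // => -[[|//] h]; by rewrite (tnth_nth (fun=> false)).
Qed.

(** * From covers enumerable in 0' to covers enumerable in w *)

Section KH.
Variable R : realType.
Local Notation lam := (@lam R).
Local Open Scope ring_scope.

Lemma pow2_gt0 n : 0 < 2 ^+ n :> R. Proof. exact: exprn_gt0. Qed.
Lemma ipow2_gt0 n : 0 < 2 ^- n :> R. Proof. by rewrite invr_gt0 pow2_gt0. Qed.

Lemma small_ipow2 (r : R) : 0 < r -> exists n, 2 ^- n < r.
Proof.
move=> r0; have [n _ /(_ _ (leqnn n)) h] := near_infty_natSinv_expn_lt (PosNum r0).
by exists n; move: h; rewrite div1r.
Qed.

Lemma small_expr (q : R) : 0 <= q < 1 -> exists n, q ^+ n <= 2^-1.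
Proof.
move=> /andP[q0 q1]; have /cvgrPdist_le /(_ 2^-1) : q ^+ n @[n --> \oo] --> 0.
  by apply: cvg_expr; rewrite ger0_norm.
rewrite invr_gt0 ltr0n => /(_ isT) [n _ /(_ n (leqnn n))] h.
by exists n; move: h; rewrite /= sub0r normrN ger0_norm // exprn_ge0.
Qed.

Lemma cylinder_cat_sub s u : cylinder (s ++ u) `<=` cylinder s.
Proof.
move=> x /cylinderP xs; apply/cylinderP.
have := congr1 (take (size s)) xs; rewrite take_size_cat // take_prefix_of size_cat.
by rewrite (minn_idPl (leq_addr _ _)).
Qed.

(** The continuations of [sigma] on which [S] fills more than the fraction 1 - 2^-j of the cylinder.
    A block outside this set leaves room beside [S]. *)
Definition dense_strings j (S : set (seq bool)) (sigma : seq bool) : set (seq bool) :=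
  [set rho | (1 - 2 ^- j) * 2 ^- size (sigma ++ rho) <
             lam (open_of S `&` cylinder (sigma ++ rho))].

(** The measure of the part of [S] above a string is the limit from below of counts of covered
    strings of length k, so a strict lower bound shows at a finite stage. [F'] is that bound with
    denominators cleared. *)
Lemma sigma1_dense w j S sigma : sigma1 w S -> sigma1 w (dense_strings j S sigma).
Proof.
move=> [t [F [tE SF]]].
pose P u s := (take (size u) s == u) && covered F s.
pose F' k rho := ((2 ^ j - 1) * 2 ^ k < 2 ^ j * count (P (sigma ++ rho)) (strings k) * 2 ^ size (sigma ++ rho))%N.
pose su := Tcat (Tnat (code sigma)) (Var 1).
exists (Tlt (Tmul (Tnat (2 ^ j - 1)%N) (Texp (Tnat 2) (Var 0)))
  (Tmul (Tmul (Tnat (2 ^ j)%N) (Tcount (Var 0)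
     (Tand (Teq (Ttake (Tlog (Shift su)) (Var 0)) (Shift su)) (Tcovered t))))
     (Texp (Tnat 2) (Tlog su)))), F'; split.
  move=> O k s e Ow.
  have suE : den O su [:: k, code s & e] = code (sigma ++ s) by apply: den_cat; rewrite ?den_nat.
  rewrite den_lt !den_mul !den_exp !den_nat den_count (den_len suE) /F' /=.
  congr (nat_of_bool (_ < _ * _ * _)%N); apply: eq_count => u.
  rewrite den_and lt0b den_eq lt0b (@den_take _ _ _ _ u) // !den_shift.
  rewrite (@den_len _ _ _ (sigma ++ s)) ?den_shift // suE (inj_eq code_inj).
  by rewrite (@den_covered _ _ F) ?lt0b // => *; exact: tE.
move=> rho; set u := sigma ++ rho.
pose A k := [set x : cantor_space | P u (prefix_of x k)].
have mA k : borel (A k) by exact: (@borel_prefix (fun s => P u s)).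
have AS : open_of S `&` cylinder u = \bigcup_k A k.
  apply/seteqP; split=> x.
    move=> [/(open_covered _ SF)[k hk] xu]; exists (k + size u)%N => //; apply/andP; split.
      by rewrite (cylinder_take xu) // leq_addl.
    by apply: covered_mono hk _; exact: leq_addr.
  move=> [k _ /andP[/eqP h1 h2]]; split; first by apply/(open_covered _ SF); exists k.
  have hs : (size u <= k)%N by apply/minn_idPl; have := congr1 size h1; rewrite size_take_min size_prefix_of.
  by apply/cylinderP; rewrite -[RHS]h1 take_prefix_of (minn_idPl hs).
have incA n m : (n <= m)%N -> A n `<=` A m.
  move=> nm x /andP[/eqP h1 h2]; apply/andP; split; last exact: covered_mono h2 nm.
  have hs : (size u <= n)%N by apply/minn_idPl; have := congr1 size h1; rewrite size_take_min size_prefix_of.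
  rewrite -[X in _ == X]h1 !take_prefix_of !(minn_idPl _) //; exact: leq_trans nm.
have F'E k : F' k rho <-> (1 - 2 ^- j) * 2 ^- size u < lam (A k).
  rewrite /A (@lam_count R (P u)) /F' -/u -(ltr_nat R) !natrM natrB ?expn_gt0 // !natrX.
  set c := (count _ _)%:R.
  have p1 := pow2_gt0 j; have p2 := pow2_gt0 k; have p3 := pow2_gt0 (size u).
  have -> : (1 - 2 ^- j) * 2 ^- size u = (2 ^+ j - 1) * 2 ^+ k * (2 ^- j * 2 ^- k * 2 ^- size u) :> R.
    by field; rewrite !gt_eqF.
  have -> : c * 2 ^- k = 2 ^+ j * c * 2 ^+ size u * (2 ^- j * 2 ^- k * 2 ^- size u) :> R.
    by field; rewrite !gt_eqF.
  by rewrite ltr_pM2r // !mulr_gt0 // ipow2_gt0.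
rewrite /dense_strings /= -/u AS; split.
  by move=> /(lam_sup mA incA)[k /F'E h]; exists k.
move=> [k /F'E h]; apply: lt_le_trans h _; apply: lam_le => //.
  exact: bigcupT_measurable.
by move=> x Ax; exists k.
Qed.

(** If a < 2^-|sigma| is the measure of [S] above [sigma], the maximal inequality bounds the measure
    of the dense continuations by a 2^|sigma| / (1 - 2^-j), which is below 1 once 2^-j < 1 - a
    2^|sigma|. *)
Lemma dense_measure S sigma : lam (open_of S `&` cylinder sigma) < 2 ^- size sigma ->
  exists j, lam (open_of (dense_strings j S sigma)) < 1.
Proof.
set a := lam _ => ha; have p0 := ipow2_gt0 (size sigma).
have [j hj] : exists j, 2 ^- j < 1 - a * 2 ^+ size sigma.
  by apply: small_ipow2; rewrite subr_gt0 -ltr_pdivlMr ?pow2_gt0 // div1r.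
exists j; set S' := dense_strings j S sigma.
have mF rho : borel (open_of S `&` cylinder (sigma ++ rho)).
  by apply: measurableI; [exact: borel_open|exact: borel_cylinder].
have j1 : 2 ^- j <= 1 :> R by rewrite invf_le1 ?pow2_gt0 // exprn_ege1 // ler1n.
have h : (1 - 2 ^- j) * 2 ^- size sigma * lam (open_of S') <=
    lam (\bigcup_(s in S') (open_of S `&` cylinder (sigma ++ s))).
  apply: maximal_inequality => //.
  - by rewrite mulr_ge0 ?subr_ge0 // ltW.
  - move=> s u x [_ /cylinderP xs] [_ /cylinderP xu] su.
    have := congr1 (take (size (sigma ++ s))) xu.
    rewrite take_prefix_of (minn_idPl _) ?size_cat ?leq_add2l // -size_cat xs.
    by rewrite take_cat size_cat ltnNge leq_addr /= addKn => /eqP; rewrite eqseq_cat // eqxx => /eqP.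
  - by move=> s /ltW; rewrite size_cat exprD invfM mulrA.
have hle : lam (\bigcup_(s in S') (open_of S `&` cylinder (sigma ++ s))) <= a.
  apply: lam_le; [exact: borel_bigcup| |].
    by apply: measurableI; [exact: borel_open|exact: borel_cylinder].
  by move=> x [s _ [xS /cylinder_cat_sub xs]].
rewrite ltNge; apply/negP => h1.
have : (1 - 2 ^- j) * 2 ^- size sigma <= a.
  apply: le_trans (le_trans h hle).
  by rewrite -[leLHS]mulr1 ler_wpM2l // mulr_ge0 ?subr_ge0 // ltW.
rewrite ler_pdivrMr ?pow2_gt0 // => h2.
by lra.
Qed.

Lemma prefix_free_cat (S : set (seq bool)) a b a' b' : prefix_free S -> S a -> S b ->
  a ++ a' = b ++ b' -> a = b.
Proof.
wlog ab : a b a' b' / (size a <= size b)%N.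
  case: (leqP (size a) (size b)) => h H pf Sa Sb e; first exact: H e.
  by apply/esym; apply: H (esym e) => //; exact: ltnW.
move=> pf Sa Sb /(congr1 (take (size a))); rewrite take_size_cat // takel_cat // => e.
by have := pf b (size a) Sb; rewrite -e => /(_ Sa) h; rewrite e take_oversize.
Qed.

(** * Concatenations of blocks *)

Section Blocks.
Variable G : pred (seq bool).

Fixpoint blocks (n : nat) (s : seq bool) : bool :=
  if n is n'.+1
  then has (fun i => blocks n' (take i s) && G (drop i s)) (iota 0 (size s).+1)
  else s == [::].

Lemma blocksS n s : reflect (exists u v, [/\ s = u ++ v, blocks n u & G v]) (blocks n.+1 s).
Proof.
apply: (iffP (has_iotaP _ _)) => [[i _ /andP[h1 h2]]|[u [v [-> h1 h2]]]].
  by exists (take i s), (drop i s); rewrite cat_take_drop.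
exists (size u); first by rewrite size_cat ltnS leq_addr.
by rewrite take_size_cat // drop_size_cat //; apply/andP.
Qed.

Hypothesis pfG : prefix_free [set` G].

Lemma blocks_prefix_free n : prefix_free [set` blocks n].
Proof.
elim: n => [|n IH] s i; first by rewrite /= => /eqP->.
move=> /blocksS[u [v [-> hu hv]]] /blocksS[u' [v' [e hu' hv']]].
have e2 := cat_take_drop i (u ++ v); rewrite e -catA in e2.
have eu := prefix_free_cat IH hu' hu e2; rewrite eu in e2.
move/eqP: e2; rewrite eqseq_cat // eqxx => /eqP e3.
have := @pfG v (size v') hv; rewrite -{1}e3 take_size_cat // => /(_ hv').
have e4 := congr1 size e3; rewrite size_cat size_drop in e4 => h.
by rewrite -subn_eq0 -leqn0 -(leq_add2l (size v')) addn0 e4.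
Qed.

(** Appending one more block to [u] leaves at most the fraction [q] of the cylinder of [u]; summing
    over the prefix-free set of n-block strings gives the induction step. *)
Lemma lam_blocks n : lam (open_of [set` blocks n]) <= lam (open_of [set` G]) ^+ n.
Proof.
set q := lam (open_of [set` G]); elim: n => [|n IH].
  by rewrite expr0; apply: lam_le1; exact: borel_open.
rewrite exprS; apply: le_trans (ler_wpM2l (lam_ge0 _ _) IH).
pose H u := \bigcup_(v in [set` G]) cylinder (u ++ v).
have mH u : borel (H u) by apply: borel_bigcup => v _; exact: borel_cylinder.
have -> : open_of [set` blocks n.+1] = \bigcup_(u in [set` blocks n]) H u.
  apply/seteqP; split=> x.
    by move=> [s /blocksS[u [v [-> hu hv]]] xs]; exists u => //; exists v.
  by move=> [u hu [v hv xs]]; exists (u ++ v) => //; apply/blocksS; exists u, v.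
have g0 (s : seq bool) : 0 <= 2 ^- size s :> R by rewrite ltW ?ipow2_gt0.
have Hle u : lam (H u) <= q * 2 ^- size u.
  rewrite -lee_fin; apply: le_trans (lam_bigcup_sum _ _) _.
    by move=> v _; exact: borel_cylinder.
  rewrite mulrC EFinM (lam_open_sum _ pfG) -seq_sumZ //.
  apply: seq_sum_le => [v|v _]; first exact: lam_ge0.
  by rewrite /= lam_cylinder size_cat exprD invfM.
rewrite -lee_fin; apply: le_trans (lam_bigcup_sum _ _) _ => //.
rewrite EFinM (lam_open_sum _ (@blocks_prefix_free n)) -seq_sumZ //.
by apply: seq_sum_le => [u|u _]; [exact: lam_ge0|exact: Hle].
Qed.

(** Dynamic programming: after k rounds, binary digit i of the accumulator tells whether the prefix
    of length i consists of k blocks. It starts as 1, since only the empty prefix consists of 0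
    blocks. *)
Definition Tblocks tG := Tdig 2
  (Rec (Var 0) (Tnat 1) (Tsum (Succ (Tlog (Var 3))) (Tmul
     (Tex (Succ (Var 0)) (Tand (Tdig 2 (Var 2) (Var 0))
        (call1 tG (Tdrop (Var 0) (Ttake (Var 1) (Var 5))))))
     (Texp (Tnat 2) (Var 0))))) (Tlog (Var 1)).

Lemma dig_sum (b : nat -> bool) N j :
  dig 2 (\sum_(i < N) b i * 2 ^ i)%N j = (j < N)%N && b j.
Proof.
have lt N' : (\sum_(i < N') b i * 2 ^ i < 2 ^ N')%N.
  elim: N' => [|k IH]; first by rewrite big_ord0.
  by rewrite big_ord_recr expnS /=; move: IH; set x := bigop _ _ _; case: (b k); rewrite ?mul1n ?mul0n; lia.
elim: N => [|N IH]; first by rewrite big_ord0 dig0.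
rewrite big_ord_recr /= addnC; case: (ltngtP j N) => h.
- by rewrite dig_add // IH h ltnS ltnW.
- rewrite ltnS leqNgt h /= /dig divn_small //.
  have := lt N.+1; rewrite big_ord_recr /= addnC => /leq_trans; apply.
  by rewrite leq_exp2l.
- by rewrite h ltnSn /dig divnMDl ?expn_gt0 // (divn_small (lt N)) addn0; case: (b N).
Qed.

Lemma den_blocks O tG n s e : (forall u e', den O tG (code u :: e') = G u) ->
  den O (Tblocks tG) [:: n, code s & e] = blocks n s.
Proof.
move=> tGE; rewrite den_dig // (@den_len _ _ _ s) // den_rec den_var /=.
suff H i : (i <= size s)%N -> dig 2 (nat_rec (fun=> nat) (den O (Tnat 1) [:: n, code s & e])
   (fun k x => den O (Tsum (Succ (Tlog (Var 3))) (Tmul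
     (Tex (Succ (Var 0)) (Tand (Tdig 2 (Var 2) (Var 0))
        (call1 tG (Tdrop (Var 0) (Ttake (Var 1) (Var 5))))))
     (Texp (Tnat 2) (Var 0)))) [:: x, k, n, code s & e]) n) i = blocks n (take i s).
  by rewrite H // take_size.
elim: {3 4}n i => [|k IH] i hi /=.
  rewrite den_nat; case: i hi => [|i] hi; first by rewrite take0.
  rewrite /dig divn_small ?expnS ?mul2n; last by have := expn_gt0 2 i; lia.
  by case: s hi.
set x := nat_rec _ _ _ k in IH *.
rewrite den_sum den_succ (@den_len _ _ _ s) //.
pose b i := has (fun j => blocks k (take j s) && G (drop j (take i s))) (iota 0 i.+1).
rewrite (eq_bigr (fun i : 'I_(size s).+1 => b i * 2 ^ i)%N) => [|j _].
  rewrite dig_sum ltnS hi /= /b size_takel //; congr nat_of_bool.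
  apply: eq_in_has => j; rewrite mem_iota add0n ltnS => /andP[_ ji].
  by rewrite take_takel.
rewrite den_mul den_exp den_nat den_ex den_succ !den_var; congr (nat_of_bool _ * _)%N.
rewrite /b; apply: eq_in_has => l; rewrite mem_iota add0n ltnS => /andP[_ lj].
rewrite den_and lt0b den_dig // den_call1 (@den_drop _ _ _ _ (take j s)); last exact: den_take.
have ls : (l <= size s)%N by exact: leq_trans lj (ltn_ord j).
by rewrite tGE !den_var [dig _ _ _](IH l ls) !lt0b.
Qed.
End Blocks.
(** Taking [c] blocks at a time, where q^c <= 1/2, makes the measure of the n-th set at most 2^-n,
    as a test requires. *)
Lemma blocks_not_random (G : pred (seq bool)) tG (y x : cantor_space) :
  prefix_free [set` G] ->
  (forall O s e, O 0%N = (y : nat -> bool) -> den O tG (code s :: e) = G s) ->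
  lam (open_of [set` G]) < 1 ->
  (forall n, open_of [set` blocks G n] x) -> ~ random_in R y x.
Proof.
move=> pfG tGE G1 xG xr; set q := lam _ in G1.
have [c qc] : exists c, q ^+ c <= 2^-1 by apply: small_expr; rewrite lam_ge0.
apply: (xr (fun n => [set` blocks G (c * n)])); last by move=> n _; exact: xG.
split.
  apply: ce_uniformly.
  exists (call2 (Tblocks tG) (Tmul (Tnat c) (Var 1)) (Var 2)), (fun _ n s => blocks G (c * n) s).
  split.
    move=> O k n s e OT; rewrite den_call2 den_mul den_nat (@den_blocks G) // => u e'.
    by apply: tGE; have := OT ord0; rewrite (tnth_nth (fun=> false)).
  by move=> n s; split=> [h|[]] //; exists 0%N.
move=> n; rewrite lamE; last exact: borel_open.
rewrite lee_fin; apply: le_trans (lam_blocks pfG _) _.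
by rewrite exprM -exprVn lerXn2r // nnegrE ?exprn_ge0 ?lam_ge0 // invr_ge0.
Qed.

(** * A w-random real made of blocks *)

Section Construction.
Variables (w : cantor_space) (G : pred (seq bool)).
Hypothesis G1 : lam (open_of [set` G]) < 1.
Hypothesis noS : forall S, sigma1 w S -> open_of [set` G] `<=` open_of S ->
  ~ lam (open_of S) < 1.

(** The initial segment built so far and an enumerable set that the real must avoid; [room] keeps
    that set from filling the cylinder of the segment. *)
Record stage := Stage {
  string : seq bool;
  avoided : set (seq bool);
  sigma1_avoided : sigma1 w avoided;
  room : lam (open_of avoided `&` cylinder string) < 2 ^- size string }.

(** Tests are listed by machine codes; if number [e] is a w-test, a real outside the open set
    generated by [S] is not captured by it. *)
Definition passes (e : nat) (S : set (seq bool)) : Prop :=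
  forall M W, unpickle e = Some M ->
    (forall n s, W n s <-> halts M [tuple w] (word n s)) ->
    (forall n, (uniform_measure R (open_of (W n)) <= (2 ^- n)%:E)%E) ->
    exists n, W n `<=` S.

Lemma next_stage e (p : stage) : exists p' : stage,
  [/\ exists2 v, G v & string p' = string p ++ v, avoided p `<=` avoided p' &
     passes e (avoided p')].
Proof.
case: p => s S wS roomS /=.
have [j hj] := dense_measure roomS.
have wD := @sigma1_dense w j S s wS.
(* The dense continuations form an enumerable set of measure below 1, so by [noS] they do not cover
   the open set of [G]; the next block [v] comes from an uncovered point. *)
have [x [[v Gv xv] xD]] : exists x, open_of [set` G] x /\ ~ open_of (dense_strings j S s) x.
  apply: contrapT => h; apply: (noS wD) hj => x xG.
  by apply: contrapT => xD; apply: h; exists x.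
have hv : lam (open_of S `&` cylinder (s ++ v)) < 2 ^- size (s ++ v).
  have : ~ dense_strings j S s v by move=> Dv; apply: xD; exists v.
  rewrite /dense_strings /= => /negP; rewrite -leNgt => /le_lt_trans; apply.
  by rewrite gtr_pMl ?ipow2_gt0 // ltrBlDr ltrDl ipow2_gt0.
case: (pselect (exists M W, [/\ unpickle e = Some M,
    (forall n s, W n s <-> halts M [tuple w] (word n s)) &
    (forall n, (uniform_measure R (open_of (W n)) <= (2 ^- n)%:E)%E)])); last first.
  move=> nW; exists (Stage wS hv); split=> //=; first by exists v.
  by move=> M W eM WM Wm; exfalso; apply: nW; exists M, W.
move=> [M [W [eM WM Wm]]].
(* The level of the test is chosen small enough to fit into the room that is left. *)
have [n hn] : exists n, 2 ^- n < 2 ^- size (s ++ v) - lam (open_of S `&` cylinder (s ++ v)).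
  by apply: small_ipow2; rewrite subr_gt0.
have wW : sigma1 w (W n).
  by apply: ce_sigma1; apply: uniformly_ceP; exists M.
have hS' : lam (open_of (S `|` W n) `&` cylinder (s ++ v)) < 2 ^- size (s ++ v).
  have mA := @borel_open S; have mW := @borel_open (W n); have mC := @borel_cylinder (s ++ v).
  apply: (@le_lt_trans _ _ (lam ((open_of S `&` cylinder (s ++ v)) `|` open_of (W n)))).
    apply: lam_le; first by apply: measurableI => //; exact: borel_open.
      by apply: measurableU => //; exact: measurableI.
    move=> y [[u [Su|Wu] yu] ys]; [left; split=> //; by exists u|right; by exists u].
  apply: le_lt_trans (lamU_le _ _ _) _ => //; first exact: measurableI.
  rewrite -ltrBrDl; apply: le_lt_trans hn.
  by rewrite -lee_fin -lamE.
exists (Stage (sigma1_setU wS wW) hS'); split=> /=; first by exists v.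
  by move=> u; left.
move=> M' W' eM'; move: eM; rewrite eM' => -[e'] WM' _; rewrite {}e' in WM'.
by exists n => u /WM' /WM; right.
Qed.

Lemma stage0_room : lam (open_of set0 `&` cylinder [::]) < 2 ^- size ([::] : seq bool).
Proof.
rewrite (_ : _ `&` _ = set0) ?lam0 ?ipow2_gt0 //.
by apply/seteqP; split=> // x [[]].
Qed.

Lemma random_outside : exists x, random_in R w x /\ forall n, open_of [set` blocks G n] x.
Proof.
have [next nextP] := choice (fun ep : nat * stage => next_stage ep.1 ep.2).
pose st := fix st n := if n is n'.+1 then next (n', st n')
  else Stage (sigma1_set0 w) stage0_room.
have stS n : [/\ exists2 v, G v & string (st n.+1) = string (st n) ++ v,
    avoided (st n) `<=` avoided (st n.+1) & passes n (avoided (st n.+1))].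
  exact: (nextP (n, st n)).
(* An empty block would make the open set of [G] the whole space; so every block lengthens the
   string. *)
have G0 v : G v -> (0 < size v)%N.
  case: v => // Gv; exfalso; move: G1; rewrite (_ : open_of _ = setT) ?lamT ?ltxx //.
  by apply/seteqP; split=> // x _; exists [::].
have strD n d : exists u, string (st (n + d)%N) = string (st n) ++ u.
  elim: d => [|d [u IH]]; first by exists [::]; rewrite addn0 cats0.
  have [[v _ e] _ _] := stS (n + d)%N; exists (u ++ v).
  by rewrite addnS e IH catA.
have avD n d : avoided (st n) `<=` avoided (st (n + d)%N).
  elim: d => [|d IH]; first by rewrite addn0.
  by rewrite addnS; have [_ h _] := stS (n + d)%N; exact: subset_trans h.
have strn n : (n <= size (string (st n)))%N.
  elim: n => // n IH; have [[v /G0 v0 ->] _ _] := stS n.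
  by rewrite size_cat; lia.
pose x : cantor_space := fun i => nth false (string (st i.+1)) i.
have xst n : cylinder (string (st n)) x.
  apply/cylinderP; apply: (@eq_from_nth _ false); first by rewrite size_prefix_of.
  move=> i; rewrite size_prefix_of => hi; rewrite nth_prefix_of // /x.
  case: (leqP i.+1 n) => h.
    have [u e] := strD i.+1 (n - i.+1)%N; rewrite subnKC // in e.
    by rewrite e nth_cat strn.
  have [u e] := strD n (i.+1 - n)%N; rewrite subnKC ?(ltnW h) // in e.
  by rewrite e nth_cat hi.
exists x; split; last first.
  move=> n; exists (string (st n)); last exact: xst.
  elim: n => [|n IH]; first by [].
  by have [[v Gv e] _ _] := stS n; apply/blocksS; exists (string (st n)), v.
move=> W [[M WM] Wm] xW.
have [_ _ /(_ M W (pickleK M) WM Wm)[k Wk]] := stS (pickle M).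
set N := (pickle M).+1 in Wk.
have [i Si] := (open_ofP _ _).1 (xW k I).
have := room (st (N + i)%N); set s := string _.
(* If [x] had a prefix of length [i] in the avoided set, the whole cylinder of a later string of
   length at least [i] would be avoided, contrary to [room]. *)
rewrite (_ : _ `&` _ = cylinder s) ?lam_cylinder ?ltxx //.
apply/seteqP; split=> [y [] //|y ys]; split=> //; apply/open_ofP; exists i.
rewrite (_ : prefix_of y i = prefix_of x i); first exact: avD (Wk _ Si).
have hs : (i <= size s)%N by apply: leq_trans (strn _); exact: leq_addl.
have /cylinderP xs := xst (N + i)%N; move/cylinderP: ys => ys.
by rewrite -(minn_idPl hs) -!take_prefix_of ys xs.
Qed.
End Construction.

(** One direction of Kjos-Hanssen's characterization of LR-reducibility. Without such a cover,
    [random_outside] yields a w-random real, which is then 0'-random, and [blocks_not_random]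
    refutes that. *)
Lemma cover_halting_open (w : cantor_space) (G : pred (seq bool)) tG :
  le_LR R halting_set w -> prefix_free [set` G] ->
  (forall O s e, O 0%N = (halting_set : nat -> bool) -> den O tG (code s :: e) = G s) ->
  lam (open_of [set` G]) < 1 ->
  exists S, [/\ sigma1 w S, open_of [set` G] `<=` open_of S & lam (open_of S) < 1].
Proof.
move=> hw pfG tGE G1; apply: contrapT => noS.
have [S wS GS S1|x [xr xG]] := @random_outside w G G1.
  by apply: noS; exists S.
exact: (blocks_not_random pfG tGE G1 xG (hw _ xr)).
Qed.

End KH.

(** * Compactness, and the projection to the even positions *)

Lemma koenig (T : set (seq bool)) : (forall s i, T s -> T (take i s)) ->
  (forall n, exists2 s, T s & size s = n) -> exists x, forall n, T (prefix_of x n).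
Proof.
move=> Tt Tn.
pose inf s := forall n, size s <= n -> exists u, [/\ T u, size u = n & take (size s) u = s].
have inf0 : inf [::] by move=> n _; have [s Ts <-] := Tn n; exists s; rewrite take0.
have infS s : inf s -> exists b, inf (rcons s b).
  move=> infs; apply: contrapT => h.
  have hb b : exists2 n, size (rcons s b) <= n &
      forall u, T u -> size u = n -> take (size (rcons s b)) u <> rcons s b.
    apply: contrapT => hb; apply: h; exists b => n sn; apply: contrapT => hu; apply: hb.
    by exists n => // u Tu un e; apply: hu; exists u.
  have [n0 s0 h0] := hb false; have [n1 s1 h1] := hb true.
  rewrite !size_rcons in s0 s1 h0 h1.
  (* A string of length n0 + n1 above [s] passes through one of the two children and, cut to n0 or
     n1, contradicts the failure of that child. *)
  have [u [Tu un us]] := infs (n0 + n1) (leq_trans (ltnW s0) (leq_addr _ _)).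
  have su : size s < size u by rewrite un; apply: leq_trans (leq_addr _ _).
  have := take_nth false su; rewrite us; case: nth => e.
    apply: (h1 (take n1 u)); [exact: Tt|by rewrite size_takel // un leq_addl|].
    by rewrite take_takel.
  apply: (h0 (take n0 u)); [exact: Tt|by rewrite size_takel // un leq_addr|].
  by rewrite take_takel.
have [c cP] := choice (fun s : {s | inf s} => infS (sval s) (svalP s)).
pose p := fix p n : {s | inf s} := if n is n'.+1 then exist _ _ (cP (p n')) else exist _ _ inf0.
have sp n : size (sval (p n)) = n by elim: n => //= n IH; rewrite size_rcons IH.
exists (fun n => c (p n)) => n.
have -> : prefix_of (fun n => c (p n)) n = sval (p n).
  by elim: n => //= n IH; rewrite /prefix_of mkseqS -/(prefix_of _ n) IH.
have [u [Tu un <-]] := svalP (p n) n (eq_leq (sp n)).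
exact: Tt.
Qed.

Definition evens (z : cantor_space) : cantor_space := fun n => z n.*2.
Definition odds (z : cantor_space) : cantor_space := fun n => z n.*2.+1.

Lemma oplus_evens_odds z : oplus (evens z) (odds z) = z.
Proof.
apply/funext => n; rewrite /oplus /evens /odds.
by case: ifP => h; congr (z _); rewrite -[RHS]odd_double_half h.
Qed.

Section Evens.
Variable R : realType.
Local Notation lam := (@lam R).
Local Open Scope ring_scope.

Lemma evens_cylinder s : exists L : seq (seq bool),
  [/\ uniq L, all (fun u => size u == (size s).*2)%N L, size L = (2 ^ size s)%N &
    evens @^-1` cylinder s = [set z | prefix_of z (size s).*2 \in L]].
Proof.
elim/last_ind: s => [|s b [L [uL aL sL eL]]].
  by exists [:: [::]]; split=> //; apply/seteqP; split.
pose ext c u := rcons (rcons u b) c : seq bool.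
have ext_inj c : injective (ext c) by move=> u v /rcons_inj[] /rcons_inj[].
exists (map (ext false) L ++ map (ext true) L); split.
- rewrite cat_uniq !map_inj_uniq // uL andbT /=.
  by apply/hasPn => _ /mapP[u _ ->]; apply/mapP => -[v _ /rcons_inj[]].
- rewrite all_cat !all_map; apply/andP; split; apply/allP => u /(allP aL) /eqP h;
    by rewrite /= !size_rcons h.
- by rewrite size_cat !size_map sL size_rcons expnS mul2n addnn.
- have eS z : (evens @^-1` cylinder s) z = (prefix_of z (size s).*2 \in L) by rewrite eL.
  apply/seteqP; split=> z /=; rewrite size_rcons doubleS /prefix_of !mkseqS -/(prefix_of z _).
    move=> /cylinderP; rewrite size_rcons /prefix_of mkseqS => /rcons_inj[es eb].
    have zL : prefix_of z (size s).*2 \in L by rewrite -eS; apply/cylinderP.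
    rewrite mem_cat; case zc: (z (size s).*2.+1); apply/orP; [right|left];
      by apply/mapP; exists (prefix_of z (size s).*2) => //; rewrite /ext -eb.
  rewrite mem_cat => /orP[] /mapP[u uL' /rcons_inj[/rcons_inj[eu eb] _]].
    have /cylinderP hz : (evens @^-1` cylinder s) z by rewrite eS eu.
    by apply/cylinderP; rewrite size_rcons /prefix_of mkseqS -/(prefix_of _ _) hz -eb.
  have /cylinderP hz : (evens @^-1` cylinder s) z by rewrite eS eu.
  by apply/cylinderP; rewrite size_rcons /prefix_of mkseqS -/(prefix_of _ _) hz -eb.
Qed.

Lemma borel_evens_cylinder s : borel (evens @^-1` cylinder s).
Proof.
by have [L [_ _ _ ->]] := evens_cylinder s; exact: (@borel_prefix (fun u => u \in L)).
Qed.

Lemma lam_evens_cylinder s : lam (evens @^-1` cylinder s) = 2 ^- size s.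
Proof.
have [L [uL aL sL ->]] := evens_cylinder s.
rewrite lam_seq // sL natrX -addnn exprD invfM mulrA mulfV ?mul1r //.
Qed.

Lemma evens_open S : evens @^-1` open_of S = \bigcup_(s in S) (evens @^-1` cylinder s).
Proof. by rewrite /open_of preimage_bigcup. Qed.

Lemma borel_evens_open S : borel (evens @^-1` open_of S).
Proof. by rewrite evens_open; apply: borel_bigcup => s _; exact: borel_evens_cylinder. Qed.

Lemma lam_evens_open S : prefix_free S -> lam (evens @^-1` open_of S) = lam (open_of S).
Proof.
move=> pf; apply: EFin_inj; rewrite lam_open_sum // evens_open lam_disjoint_bigcup.
- by apply: eq_eseriesr => c _ /=; rewrite lam_evens_cylinder.
- by move=> s _; exact: borel_evens_cylinder.
- by move=> s u z Ss Su; exact: prefix_free_disjoint pf Ss Su.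
Qed.
End Evens.

Lemma npair_ge n t : n <= npair n t /\ t <= npair n t.
Proof.
rewrite /npair; have h : n < 2 ^ n by exact: ltn_expl.
have : 2 ^ n * t.*2.+1 = 2 ^ n * t.*2 + 2 ^ n by rewrite mulnS addnC.
have : t.*2 <= 2 ^ n * t.*2 by rewrite leq_pmull // expn_gt0.
by move=> *; split; lia.
Qed.

(** * Covering the complement of the domain *)

Definition Tnpair n t := Tpred (Tmul (Texp (Tnat 2) n) (Succ (Tmul t (Tnat 2)))).

Lemma den_npair O n t e : den O (Tnpair n t) e = npair (den O n e) (den O t e).
Proof. by rewrite den_pred den_mul den_exp den_nat den_succ den_mul den_nat muln2. Qed.

Section Approximation.
Variables (R : realType) (f : pfun) (E : seq bool -> seq bool -> bool) (tE : term).
Hypothesis fE : approximates E f.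
Hypothesis tEE : forall O s a e, den O tE [:: code s, code a & e] = E s a.
Local Notation lam := (@lam R).
Local Open Scope ring_scope.

Let E_dom x y : f x = Some y <-> forall n, exists t, E (prefix_of x t) (prefix_of y n).
Proof. by case: fE. Qed.

Lemma approx_mono x s t n : E (prefix_of x s) n -> (s <= t)%N -> E (prefix_of x t) n.
Proof. by case: fE => _ h _ _; exact: h. Qed.

Lemma approx_compat x s t a b : E (prefix_of x s) a -> E (prefix_of x t) b ->
  (size a <= size b)%N -> a = take (size a) b.
Proof. by case: fE => _ _ h _; exact: h. Qed.

Lemma approx_take s a i : E (take i s) a -> E s a.
Proof.
have sE : prefix_of (seq_real s) (size s) = s.
  apply: (@eq_from_nth _ false); first by rewrite size_prefix_of.
  by move=> k; rewrite size_prefix_of => h; rewrite nth_prefix_of.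
rewrite -{1 2}sE take_prefix_of => /approx_mono; apply; exact: geq_minr.
Qed.

Lemma approx_value x y t a : f x = Some y -> E (prefix_of x t) a -> a = prefix_of y (size a).
Proof.
move=> /E_dom/(_ (size a))[s hs] ha.
by rewrite {1}(approx_compat ha hs) ?size_prefix_of // take_prefix_of minnn.
Qed.

Definition outputs_at (n : nat) (s : seq bool) : bool := has (E s) (strings n).

Lemma outputs_at_mono x n s t : outputs_at n (prefix_of x s) -> (s <= t)%N ->
  outputs_at n (prefix_of x t).
Proof. by move=> /hasP[a ha hE] st; apply/hasP; exists a => //; exact: approx_mono hE st. Qed.

Lemma pdomP x : pdom f x <-> forall n, exists t, outputs_at n (prefix_of x t).
Proof.
split=> [[y /E_dom h] n|h].
  have [t ht] := h n; exists t; apply/hasP; exists (prefix_of y n) => //.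
  by rewrite mem_strings size_prefix_of.
have {}h n : exists a, size a = n /\ exists t, E (prefix_of x t) a.
  have [t /hasP[a]] := h n; rewrite mem_strings => /eqP sa ha.
  by exists a; split=> //; exists t.
have [a aP] := choice h.
exists (fun i => nth false (a i.+1) i); apply/E_dom => n.
have [sn [t ht]] := aP n; exists t.
suff -> : prefix_of (fun i => nth false (a i.+1) i) n = a n by [].
apply: (@eq_from_nth _ false); first by rewrite size_prefix_of sn.
move=> i; rewrite size_prefix_of => i_n; rewrite nth_prefix_of //.
have [si [t' ht']] := aP i.+1.
by rewrite (approx_compat ht' ht) si ?sn // nth_take.
Qed.

Definition out_by (n t : nat) : set cantor_space := [set x | outputs_at n (prefix_of x t)].
Definition out_some (n : nat) : set cantor_space := \bigcup_t out_by n t.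

Lemma borel_out_by n t : borel (out_by n t).
Proof. exact: (@borel_prefix (fun s => outputs_at n s)). Qed.

Lemma borel_out_some n : borel (out_some n).
Proof. by apply: bigcupT_measurable => t; exact: borel_out_by. Qed.

Lemma pdom_cap : pdom f = \bigcap_n out_some n.
Proof.
apply/seteqP; split=> x.
  by move=> /pdomP h n _; have [t ht] := h n; exists t.
by move=> h; apply/pdomP => n; have [t _ ht] := h n I; exists t.
Qed.

Lemma borel_pdom : borel (pdom f).
Proof. by rewrite pdom_cap; apply: bigcapT_measurable => n; exact: borel_out_some. Qed.

Lemma out_by_mono n s t : (s <= t)%N -> out_by n s `<=` out_by n t.
Proof. by move=> st x h; exact: outputs_at_mono h st. Qed.

Variable j : nat.

(* [late n t] is witnessed by a stage at which the measure of [out_by n]      *)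
(* exceeds its value at [t] by more than 2^-(n+j).                            *)
Definition late_at (k n t : nat) : bool :=
  ((t <= k) && (2 ^ k * (count (outputs_at n) (strings t) * 2 ^ (n + j) + 2 ^ t) <
   count (outputs_at n) (strings k) * 2 ^ (n + j) * 2 ^ t))%N.

Definition late (n t : nat) : bool := `[< exists k, late_at k n t >].

Lemma late_atE k n t : late_at k n t <->
  (t <= k)%N /\ lam (out_by n t) + 2 ^- (n + j) < lam (out_by n k).
Proof.
rewrite /out_by !(@lam_count R (outputs_at n)) /late_at.
set c := count _ _; set d := count _ _.
have p1 := pow2_gt0 R k; have p2 := pow2_gt0 R t; have p3 := pow2_gt0 R (n + j).
have -> : (2 ^ k * (c * 2 ^ (n + j) + 2 ^ t) < d * 2 ^ (n + j) * 2 ^ t)%N =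
    (c%:R * 2 ^- t + 2 ^- (n + j) < d%:R * 2 ^- k :> R).
  rewrite -(ltr_nat R) !natrM natrD natrM !natrX.
  have q0 : 0 < 2 ^- k * 2 ^- t * 2 ^- (n + j) :> R by rewrite !mulr_gt0 // ipow2_gt0.
  rewrite -(ltr_pM2r q0); congr (_ < _); field; by rewrite !gt_eqF.
by split=> /andP.
Qed.

(** [halting_query] takes one parameter, so [n] and [k] are packed by [npair] and recovered by
    bounded search. *)
Lemma late_term : exists t, forall O q e n k, O 0%N = (halting_set : nat -> bool) ->
  q = npair n k -> den O t (q :: e) = late n k.
Proof.
pose Tc n t := Tcount t (Tcount (Shift n) (call2 tE (Var 1) (Var 0))).
have TcE O n t e : den O (Tc n t) e = count (outputs_at (den O n e)) (strings (den O t e)).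
  rewrite den_count; apply: eq_count => s; rewrite den_count den_shift.
  rewrite /outputs_at has_count; congr (0 < _)%N; apply: eq_count => a.
  by rewrite den_call2 tEE lt0b.
pose Tl := Tand (Tleq (Var 0) (Var 2)) (Tlt
  (Tmul (Texp (Tnat 2) (Var 2)) (Tadd (Tmul (Tc (Var 1) (Var 0)) (Texp (Tnat 2) (Tadd (Var 1) (Tnat j))))
     (Texp (Tnat 2) (Var 0))))
  (Tmul (Tmul (Tc (Var 1) (Var 2)) (Texp (Tnat 2) (Tadd (Var 1) (Tnat j)))) (Texp (Tnat 2) (Var 0)))).
have TlE O t n k e : den O Tl [:: t, n, k & e] = late_at k n t.
  by rewrite den_and den_leq den_lt !lt0b !den_mul !den_add !den_mul !den_exp !TcE !den_add !den_nat.
pose F k q := has (fun n => has (fun t => (q == npair n t) && late_at k n t)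
  (iota 0 q.+1)) (iota 0 q.+1).
have [|t tP] := @halting_query (Tex (Succ (Var 1)) (Tex (Succ (Var 2))
  (Tand (Teq (Var 3) (Tnpair (Var 1) (Var 0))) Tl))) F.
  move=> O k q e; rewrite den_ex den_succ; congr nat_of_bool; apply: eq_has => n.
  rewrite den_ex den_succ lt0b; apply: eq_has => u.
  by rewrite den_and den_eq den_npair TlE !lt0b.
exists t => O q e n k O0 ->; rewrite tP // /late; congr (nat_of_bool `[< _ >]).
apply/propext; split=> -[i]; last first.
  move=> h; exists i; apply/has_iotaP; exists n; first by rewrite ltnS; case: (npair_ge n k).
  apply/has_iotaP; exists k; first by rewrite ltnS; case: (npair_ge n k).
  by rewrite eqxx.
by move=> /has_iotaP[n' _ /has_iotaP[k' _ /andP[/eqP/npair_inj[<- <-] h]]]; exists i.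
Qed.

Lemma not_late_le n t : ~~ late n t -> lam (out_some n) <= lam (out_by n t) + 2 ^- (n + j).
Proof.
move=> nl; rewrite leNgt; apply/negP => /(lam_sup (borel_out_by n) (@out_by_mono n))[k hk].
move/negP: nl; apply; apply/asboolP; exists (maxn t k); apply/late_atE; split; first exact: leq_maxl.
apply: lt_le_trans hk _; apply: lam_le; [exact: borel_out_by..|].
by apply: out_by_mono; exact: leq_maxr.
Qed.

(** Once [out_by n] is within 2^-(n+j) of its limit in measure, no later growth can exceed that
    amount. *)
Lemma exists_not_late n : exists t, (n <= t)%N && ~~ late n t.
Proof.
have : lam (out_some n) - 2 ^- (n + j) < lam (out_some n).
  by rewrite ltrBlDr ltrDl ipow2_gt0.
move=> /(lam_sup (borel_out_by n) (@out_by_mono n))[k hk].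
exists (maxn n k); rewrite leq_maxl /=; apply/negP => /asboolP[i /late_atE[_ h]].
have h1 : lam (out_by n i) <= lam (out_some n).
  by apply: lam_le; [exact: borel_out_by|exact: borel_out_some|move=> x ?; exists i].
have h2 : lam (out_by n k) <= lam (out_by n (maxn n k)).
  by apply: lam_le; [exact: borel_out_by..|apply: out_by_mono; exact: leq_maxr].
by have := lt_le_trans h h1; lra.
Qed.

(** At stage [size s] almost all points with [n] output bits have been found and [s] is not among
    them; giving it up costs little measure. *)
Definition bad (s : seq bool) : bool :=
  has (fun n => ~~ late n (size s) && ~~ outputs_at n s) (iota 0 (size s).+1).

(** Prefix-freeness is what the block argument asks of the generators; minimality provides it and
    keeps them decidable in 0'. *)
Definition minimal_bad (s : seq bool) : bool :=
  bad s && all (fun i => ~~ bad (take i s)) (iota 0 (size s)).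

Lemma minimal_badE : [set` minimal_bad] = minimal [set` bad].
Proof.
apply/seteqP; split=> s.
  by move=> /andP[h /all_iotaP h2]; split=> // i /h2 /negP.
by move=> [h h2]; apply/andP; split=> //; apply/all_iotaP => i /h2 /negP.
Qed.

Lemma minimal_bad_term : exists t, forall O s e, O 0%N = (halting_set : nat -> bool) ->
  den O t (code s :: e) = minimal_bad s.
Proof.
have [tl tlE] := late_term.
pose Tb := Tex (Succ (Tlog (Var 0))) (Tand
  (Tnot (call1 tl (Tnpair (Var 0) (Tlog (Var 1)))))
  (Tnot (Tcount (Var 0) (call2 tE (Var 2) (Var 0))))).
have TbE O s e : O 0%N = (halting_set : nat -> bool) -> den O Tb (code s :: e) = bad s.
  move=> O0; rewrite den_ex den_succ (@den_len _ _ _ s) //; congr nat_of_bool.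
  apply: eq_has => n; rewrite den_and !den_not !lt0b; congr (_ && _).
    rewrite den_call1 den_npair (@den_len _ _ _ s) //.
    by rewrite (tlE O _ _ n (size s)) // eqb0.
  rewrite den_count /outputs_at has_count -eqn0Ngt; congr (_ == _); apply: eq_count => a.
  by rewrite den_call2 tEE lt0b.
exists (Tand Tb (Tall (Tlog (Var 0)) (Tnot (call1 Tb (Ttake (Var 0) (Var 1)))))).
move=> O s e O0; rewrite den_and TbE // den_all !lt0b (@den_len _ _ _ s) //.
congr (nat_of_bool (_ && _)); apply: eq_all => i.
by rewrite den_not den_call1 (@den_take _ _ _ _ s) // TbE // lt0b eqb0.
Qed.

Lemma not_bad_pdom x : ~ open_of [set` bad] x -> pdom f x.
Proof.
move=> xb; apply/pdomP => n; have [t /andP[nt nl]] := exists_not_late n.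
exists t; apply/negPn/negP => h; apply: xb; apply/open_ofP; exists t.
apply/has_iotaP; exists n; first by rewrite size_prefix_of ltnS.
by rewrite size_prefix_of nl.
Qed.

(** For each n let c n be the first stage from n on that is not late. A point of the domain with a
    bad prefix lies, for some n, in [out_some n] but not in [out_by n (c n)]; these differences have
    measure at most 2^-(n+j), in total 2 * 2^-j. *)
Lemma lam_bad : lam (open_of [set` bad]) <= 1 - lam (pdom f) + 2 * 2 ^- j.
Proof.
have first_stage n : exists t, ~~ late n t /\ forall t', (n <= t')%N -> ~~ late n t' -> (t <= t')%N.
  have ex := exists_not_late n; exists (ex_minn ex); case: ex_minnP => t /andP[_ nl] tmin.
  by split=> // t' nt' nl'; apply: tmin; rewrite nt' nl'.
have [c cP] := choice first_stage.
pose B n := out_some n `\` out_by n (c n).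
have mB n : borel (B n) by apply: measurableD; [exact: borel_out_some|exact: borel_out_by].
have mb := @borel_open [set` bad].
apply: (@le_trans _ _ (lam (~` pdom f `|` \bigcup_n B n))).
  have mU : borel (~` pdom f `|` \bigcup_n B n).
    by apply: measurableU; [apply: measurableC; exact: borel_pdom|exact: bigcupT_measurable].
  apply: lam_le => // x xb; case: (pselect (pdom f x)) => [xd|]; [right|by left].
  move/open_ofP: xb => [t /has_iotaP[n]]; rewrite size_prefix_of ltnS => nt /andP[nl no].
  exists n => //; split.
    by have [u hu] := (pdomP x).1 xd n; exists u.
  move=> h; move/negP: no; apply; apply: outputs_at_mono h _.
  by have [_ ] := cP n; apply.
apply: le_trans (lamU_le _ _ _) _.
- by apply: measurableC; exact: borel_pdom.
- exact: bigcupT_measurable.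
rewrite lamC; last exact: borel_pdom.
rewrite lerD2l; apply: lam_bigcup_le => // n.
have -> : 2 * 2 ^- j * 2 ^- n.+1 = 2 ^- (n + j) :> R.
  by rewrite exprS exprD; field; rewrite !gt_eqF // pow2_gt0.
have [/not_late_le h _] := cP n.
rewrite /B lamD ?lerBlDl //; [exact: borel_out_by|exact: borel_out_some|].
by move=> x hx; exists (c n).
Qed.
End Approximation.

(** * Inverting the function *)

Section Inversion.
Variables (f : pfun) (E : seq bool -> seq bool -> bool) (tE : term).
Hypothesis fE : approximates E f.
Hypothesis tEE : forall O s a e, den O tE [:: code s, code a & e] = E s a.
Hypothesis finj : pinjective f.
Variables (w : cantor_space) (S : set (seq bool)) (tS : term) (F : nat -> seq bool -> bool).
Hypothesis tSF : forall O k s e, O 0 = (w : nat -> bool) -> den O tS [:: k, code s & e] = F k s.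
Hypothesis SF : forall s, S s <-> exists k, F k s.
Hypothesis dom : ~` open_of S `<=` pdom f.

(* [s] may still be a prefix of a point outside [open_of S] mapped to [y]. *)
Definition survives (y : cantor_space) (s : seq bool) : bool :=
  ~~ covered F s && all (fun m =>
    ~~ has (fun a => E s a && (a != prefix_of y m)) (strings m)) (iota 0 (size s).+1).

Lemma survivesP y s : reflect
  (~~ covered F s /\ forall a, size a <= size s -> E s a -> a = prefix_of y (size a))
  (survives y s).
Proof.
apply: (iffP andP) => -[h1 h2]; split=> //.
  move=> a sa Ea; have := all_iotaP _ _ h2 (size a) sa.
  by move=> /hasPn/(_ a); rewrite mem_strings eqxx => /(_ isT); rewrite Ea negbK => /eqP.
apply/all_iotaP => m; rewrite ltnS => ms; apply/hasPn => a; rewrite mem_strings => /eqP am.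
by apply/negP => /andP[Ea]; rewrite -am; rewrite -(h2 a) ?eqxx // am.
Qed.

Lemma survives_take y s i : survives y s -> survives y (take i s).
Proof.
move=> /survivesP[h1 h2]; apply/survivesP; split.
  by apply: contra h1; exact: covered_take.
move=> a sa Ea; apply: h2; last exact: (approx_take fE Ea).
by apply: leq_trans sa _; rewrite size_take_min geq_minr.
Qed.

Lemma survives_value x y t : ~ open_of S x -> f x = Some y -> survives y (prefix_of x t).
Proof.
move=> xS fx; apply/survivesP; split; last by move=> a _; exact: (approx_value fE fx).
by apply/negP => h; apply: xS; apply/(open_covered _ SF); exists t.
Qed.

(** The limit lies outside the open set, hence in the domain, and every bit of its value is
    eventually computed and compared with [y]. *)
Lemma survivor_value x y : (forall t, survives y (prefix_of x t)) ->
  ~ open_of S x /\ f x = Some y.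
Proof.
move=> h; have xS : ~ open_of S x.
  by move/(open_covered _ SF) => [t ht]; have /survivesP[] := h t; rewrite ht.
split=> //; have [y' fx] := dom xS; rewrite fx; congr Some; apply/funext => n.
have [fE1 _ _ _] := fE; have [t ht] := (fE1 x y').1 fx n.+1.
have /survivesP[_ /(_ (prefix_of y' n.+1))] := h (maxn n.+1 t).
rewrite !size_prefix_of leq_maxl => /(_ isT) e.
have := e (approx_mono fE ht (leq_maxr _ _)).
by move=> /(congr1 (fun s => nth false s n)); rewrite /= !nth_prefix_of.
Qed.

(** When no string of length [t] survives, both bits are forced; this does not happen if [y] is the
    value of a point outside [open_of S]. *)
Definition forces (y : cantor_space) (n t : nat) (b : bool) : bool :=
  ~~ has (fun s => survives y s && (nth false s n != b)) (strings t).

Lemma forces_value x y n t b : ~ open_of S x -> f x = Some y -> n < t ->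
  forces y n t b -> b = (x : nat -> bool) n.
Proof.
move=> xS fx nt /hasPn/(_ (prefix_of x t)); rewrite mem_strings size_prefix_of eqxx.
by rewrite survives_value // nth_prefix_of // negbK => /(_ isT)/eqP.
Qed.

(** Compactness: otherwise survivors of every length disagree with [x] at [n], and König's lemma
    gives a point outside [open_of S] with value [y] and another bit at [n], against injectivity. *)
Lemma exists_forces x y n : ~ open_of S x -> f x = Some y ->
  exists2 t, n < t & forces y n t ((x : nat -> bool) n).
Proof.
move=> xS fx; apply: contrapT => nf.
pose T := [set s | survives y s /\ (n < size s -> nth false s n <> (x : nat -> bool) n)].
have [||x' x'T] := @koenig T.
- move=> s i [h1 h2]; split; first exact: survives_take.
  rewrite size_take_min leq_min => /andP[ni ns]; rewrite nth_take //; exact: h2.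
- move=> m; have : ~~ forces y n (m + n).+1 ((x : nat -> bool) n).
    by apply/negP => h; apply: nf; exists (m + n).+1; rewrite // ltnS leq_addl.
  rewrite negbK => /hasP[s]; rewrite mem_strings => /eqP sz /andP[h1 /eqP h2].
  exists (take m s); last by rewrite size_takel // sz -addnS leq_addr.
  split; first exact: survives_take.
  by rewrite size_take_min leq_min => /andP[nm _]; rewrite nth_take.
have [|_ fx'] := @survivor_value x' y; first by move=> t; case: (x'T t).
have [_] := x'T n.+1; rewrite size_prefix_of ltnSn nth_prefix_of // => /(_ isT).
by rewrite (finj fx' fx).
Qed.

(** Oracle 0 of the inverter is the join of y and r, so the bits of y are its even positions. *)
Definition Tprefix m := Rec m (Tnat 1)
  (Tadd (Tmul (Var 0) (Tnat 2)) (Orc 0 (Tmul (Var 1) (Tnat 2)))).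

Lemma den_prefix O (z : cantor_space) m e : O 0 = (z : nat -> bool) ->
  den O (Tprefix m) e = code (prefix_of (evens z) (den O m e)).
Proof.
move=> O0; rewrite den_rec; elim: (den O m e) => [|k IH]; first by rewrite /= den_nat.
rewrite [nat_rec _ _ _ _]/= den_add den_mul den_orc den_mul !den_nat !den_var /= IH.
by rewrite /prefix_of mkseqS code_rcons O0 [k * 2]muln2.
Qed.

(** [tS] reads [w] as oracle 0, whereas the inverter has it as oracle 1; hence the renaming. *)
Definition Tsurvives := Tand (Tnot (Tcovered (rename (fun=> 1) tS)))
  (Tall (Succ (Tlog (Var 0))) (Tnot (Tcount (Var 0)
    (Tand (call2 tE (Var 2) (Var 0)) (Tnot (Teq (Var 0) (Tprefix (Var 1)))))))).

Lemma den_survives O (z : cantor_space) s e :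
  O 0 = (z : nat -> bool) -> O 1 = (w : nat -> bool) ->
  den O Tsurvives (code s :: e) = survives (evens z) s.
Proof.
move=> O0 O1; rewrite den_and den_not (@den_covered _ _ F); last first.
  by move=> k u e'; rewrite den_rename tSF.
rewrite lt0b eqb0 den_all den_succ (@den_len _ _ _ s) // lt0b /survives.
congr (nat_of_bool (_ && _)); apply: eq_all => m.
rewrite den_not lt0b den_count has_count -eqn0Ngt; congr (_ == _); apply: eq_count => a.
rewrite den_and den_call2 tEE den_not den_eq (@den_prefix _ z) // !lt0b eqb0.
by rewrite den_var /= (inj_eq code_inj).
Qed.

Definition Tforces b := Tnot (Tcount (Var 0)
  (Tand Tsurvives (Tnot (Teq (Tnth (Var 0) (Var 2)) (Tnat b))))).

Lemma den_forces O (z : cantor_space) (b : bool) t n e :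
  O 0 = (z : nat -> bool) -> O 1 = (w : nat -> bool) ->
  den O (Tforces b) [:: t, n & e] = forces (evens z) n t b.
Proof.
move=> O0 O1; rewrite den_not den_count /forces has_count -eqn0Ngt.
congr (nat_of_bool (_ == _)); apply: eq_count => s.
rewrite den_and (@den_survives _ z) // den_not den_eq (@den_nth _ _ _ _ s) // den_nat !lt0b eqb0.
by congr (_ && ~~ _); rewrite /=; case: nth; case: (b).
Qed.

(** The values 1 and 2 stand for the bits false and true; the guard n < k ensures that strings of
    length k have a bit at n. *)
Definition inverter : machine 2 := compile 2 (streamer
  (Tif (Tlt (Var 1) (Var 0)) (Tif (Tforces false) (Tnat 1) (Tif (Tforces true) (Tnat 2) Zero)) Zero)).

Lemma inverter_outputs x y z : ~ open_of S x -> f x = Some y -> evens z = y ->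
  outputs inverter [tuple z; w] x.
Proof.
move=> xS fx zy; apply: streamer_outputs; set O := tuple_oracle _; set t := Tif _ _ _.
have O0 : O 0 = (z : nat -> bool) by [].
have O1 : O 1 = (w : nat -> bool) by [].
all: have tv k n : den O t [:: k; n] = if n < k then
    (if forces y n k false then 1 else if forces y n k true then 2 else 0) else 0.
all: try by rewrite !den_if den_lt !lt0b !(@den_forces _ z) // zy !lt0b !den_nat.
- move=> n; have [k nk fk] := exists_forces n xS fx; exists k.
  rewrite tv nk; move: fk; case: (x n) => ->; last by [].
  by case: ifP.
- move=> n k; rewrite tv; case: ltnP => // nk.
  case: ifP => [/(forces_value xS fx nk) <- //|_].
  by case: ifP => [/(forces_value xS fx nk) <- //|_].
Qed.

Lemma inversion_exists : exists2 g, partial_computable_in w g &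
  forall x y z, ~ open_of S x -> f x = Some y -> evens z = y -> g z = Some x.
Proof.
pose g z := if pselect (exists y, outputs inverter [tuple z; w] y) is left h
  then Some (projT1 (cid h)) else None.
have gP z y : g z = Some y <-> outputs inverter [tuple z; w] y.
  rewrite /g; case: pselect => [h|h]; last by split=> // hy; case: h; exists y.
  case: cid => y' /= hy'; split=> [[<-] //|hy]; congr Some.
  exact: outputs_unique hy' hy.
exists g; first by exists inverter => z y; exact: gP.
by move=> x y z xS fx zy; apply/gP; exact: inverter_outputs zy.
Qed.

(** * The image of the closed set has positive measure *)

Section Positive.
Variable R : realType.
Local Notation lam := (@lam R).
Local Open Scope ring_scope.
Hypothesis frand : forall x y, random R x -> f x = Some y -> random R y.

Definition value_prefix (s : seq bool) : Prop :=
  exists x y, [/\ ~ open_of S x, f x = Some y & prefix_of y (size s) = s].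

Definition value_strings (t : nat) : set (seq bool) := [set s | size s = t /\ value_prefix s].

Definition values : set cantor_space := [set y | exists2 x, ~ open_of S x & f x = Some y].

(** The image of a compact set is closed. Survival of a string of length t depends only on the first
    t bits of [y], so if each prefix of [y] begins a value, survivors of all lengths exist and
    König's lemma gives a preimage. *)
Lemma values_cap : values = \bigcap_t open_of (value_strings t).
Proof.
apply/seteqP; split=> y.
  move=> [x xS fx] t _; apply/open_ofP; exists t; split; first exact: size_prefix_of.
  by exists x, y; rewrite size_prefix_of.
move=> h; have [||x xT] := @koenig [set s | survives y s].
- by move=> s i; exact: survives_take.
- move=> t; have /open_ofP[n [nt [x [y' [xS fx e]]]]] := h t I.
  rewrite size_prefix_of in nt; rewrite nt size_prefix_of in e.
  exists (prefix_of x t); last exact: size_prefix_of.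
  apply/survivesP; have /survivesP[h1 h2] := survives_value t xS fx; split=> //.
  move=> a sa Ea; rewrite {1}(h2 a sa Ea); rewrite size_prefix_of in sa.
  by rewrite -[in LHS](minn_idPl sa) -take_prefix_of e take_prefix_of (minn_idPl sa).
by have [xS fx] := survivor_value xT; exists x.
Qed.

Lemma value_strings_mono s t : (s <= t)%N ->
  open_of (value_strings t) `<=` open_of (value_strings s).
Proof.
move=> st y /open_ofP[n [nt [x [y' [xS fx e]]]]].
rewrite size_prefix_of in nt; rewrite nt size_prefix_of in e.
apply/open_ofP; exists s; split; first exact: size_prefix_of.
exists x, y'; split=> //; rewrite size_prefix_of.
have := congr1 (take s) e; by rewrite !take_prefix_of (minn_idPl st).
Qed.

Definition preimage_of (a : seq bool) : set cantor_space :=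
  [set x | exists t, E (prefix_of x t) a].

Lemma borel_preimage_of a : borel (preimage_of a).
Proof.
rewrite (_ : preimage_of a = \bigcup_t [set x | E (prefix_of x t) a]).
  by apply: bigcupT_measurable => t; exact: (@borel_prefix (fun s => E s a)).
by apply/seteqP; split=> x [t]; [move=> h; exists t|move=> _ h; exists t].
Qed.

Definition heavy (k : nat) : set (seq bool) :=
  [set a | 2 ^+ k * 2 ^- size a < lam (preimage_of a)].

(** Strings of outputs on the same argument are comparable, so the maximal inequality applies and
    bounds 2^k times the measure of the k-th set by 1. *)
Lemma heavy_test : ml_test R [tuple] heavy.
Proof.
split.
  apply: ce_uniformly.
  exists (Tlt (Texp (Tnat 2) (Tadd (Var 1) (Var 0)))
     (Tmul (Tcount (Var 0) (call2 tE (Var 0) (Var 3))) (Texp (Tnat 2) (Tlog (Var 2))))),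
   (fun t k a => (2 ^ (k + t) < count (E^~ a) (strings t) * 2 ^ size a)%N); split.
    move=> O t k a e _; rewrite den_lt den_mul !den_exp !den_nat den_add den_count.
    rewrite (@den_len _ _ _ a) //; congr (nat_of_bool (_ < _ * _)%N).
    by apply: eq_count => s; rewrite den_call2 tEE lt0b.
  move=> k a; rewrite /heavy /=.
  pose A t := [set x : cantor_space | E (prefix_of x t) a].
  have mA t : borel (A t) by exact: (@borel_prefix (fun s => E s a)).
  have AE : preimage_of a = \bigcup_t A t.
    by apply/seteqP; split=> x [t]; [move=> h; exists t|move=> _ h; exists t].
  have key t : (2 ^ (k + t) < count (E^~ a) (strings t) * 2 ^ size a)%N <->
      2 ^+ k * 2 ^- size a < lam (A t).
    rewrite /A (@lam_count R (E^~ a)) -(ltr_nat R) !natrM !natrX exprD.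
    set c := (count _ _)%:R.
    have p1 := pow2_gt0 R t; have p2 := pow2_gt0 R (size a).
    have q0 : 0 < 2 ^- t * 2 ^- size a :> R by rewrite mulr_gt0 // ipow2_gt0.
    rewrite -(ltr_pM2r q0).
    have -> : 2 ^+ k * 2 ^+ t * (2 ^- t * 2 ^- size a) = 2 ^+ k * 2 ^- size a :> R.
      by field; rewrite !gt_eqF.
    have -> // : c * 2 ^+ size a * (2 ^- t * 2 ^- size a) = c * 2 ^- t :> R.
    by field; rewrite !gt_eqF.
  rewrite AE; split.
    move=> /(lam_sup mA)[|t /key ht]; last by exists t.
    by move=> s t st x h; exact: (approx_mono fE h st).
  move=> [t /key h]; apply: lt_le_trans h _; apply: lam_le => //; first exact: bigcupT_measurable.
  by move=> x hx; exists t.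
move=> k; rewrite lamE ?lee_fin; last exact: borel_open.
have h : 2 ^+ k * lam (open_of (heavy k)) <= lam (\bigcup_(a in heavy k) preimage_of a).
  apply: maximal_inequality.
  - by rewrite ltW // pow2_gt0.
  - exact: borel_preimage_of.
  - by move=> a b x [t ht] [u hu]; exact: (approx_compat fE ht hu).
  - by move=> a /ltW.
rewrite -[leRHS]mul1r ler_pdivlMr ?pow2_gt0 // mulrC; apply: le_trans h _.
by apply: lam_le1; apply: borel_bigcup => a _; exact: borel_preimage_of.
Qed.

(** There are countably many machines, hence countably many tests, and each captures a null set. *)
Lemma nonrandom_null : exists2 N, borel N /\ lam N = 0 & forall x, ~ random R x -> N x.
Proof.
pose W (M : machine 0) n : set (seq bool) := [set s | halts M [tuple] (word n s)].
pose ok M := forall n, (uniform_measure R (open_of (W M n)) <= (2 ^- n)%:E)%E.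
pose N e := if unpickle e is Some M then
  if pselect (ok M) then \bigcap_n open_of (W M n) else set0 else set0.
have mN e : borel (N e).
  rewrite /N; case: unpickle => [M|//]; case: pselect => okM //=.
  by apply: bigcapT_measurable => n; exact: borel_open.
have N0 e : lam (N e) = 0.
  rewrite /N; case: unpickle => [M|]; last exact: lam0.
  case: pselect => okM /=; last exact: lam0.
  apply/eqP; rewrite eq_le lam_ge0 andbT leNgt; apply/negP => /small_ipow2[n].
  apply/negP; rewrite -leNgt; apply: (@le_trans _ _ (lam (open_of (W M n)))).
    apply: lam_le; last by move=> x; apply.
      by apply: bigcapT_measurable => k; exact: borel_open.
    exact: borel_open.
  by rewrite -lee_fin -lamE //; exact: borel_open.
exists (\bigcup_e N e).
  by split; [exact: bigcupT_measurable|exact: lam_bigcup0].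
move=> x /existsNP[V /not_implyP[[[M VM] Vm] /contrapT Vx]].
exists (pickle M) => //; rewrite /N pickleK.
have VE n : W M n = V n by apply/seteqP; split=> s; rewrite /W /= VM.
case: pselect => [okM n _|[]]; first by rewrite VE; exact: Vx.
by move=> n; rewrite VE.
Qed.

(** A random point outside [open_of S] has a random value, which escapes some member of the test; so
    these countably many sets cover the complement up to a null set, and one of them is not null. *)
Lemma heavy_small : 0 < lam (~` open_of S) -> exists2 k,
  borel (~` open_of S `\` \bigcup_(a in heavy k) preimage_of a) &
  0 < lam (~` open_of S `\` \bigcup_(a in heavy k) preimage_of a).
Proof.
move=> Spos; have [N [mN N0] NP] := nonrandom_null.
pose Q k := ~` open_of S `\` \bigcup_(a in heavy k) preimage_of a.
have mS : borel (~` open_of S) by apply: measurableC; exact: borel_open.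
have mQ k : borel (Q k).
  by apply: measurableD => //; apply: borel_bigcup => a _; exact: borel_preimage_of.
apply: contrapT => nQ; move: Spos; apply/negP; rewrite -leNgt.
have Q0 k : lam (Q k) = 0.
  apply/eqP; rewrite eq_le lam_ge0 andbT leNgt; apply/negP => h; apply: nQ.
  by exists k; [exact: mQ|].
have mU : borel (\bigcup_k Q k) by exact: bigcupT_measurable.
apply: (@le_trans _ _ (lam (N `|` \bigcup_k Q k))); last first.
  by apply: le_trans (lamU_le _ mN mU) _; rewrite N0 lam_bigcup0 // addr0.
apply: lam_le => //; first exact: measurableU.
move=> x xS; case: (pselect (random R x)) => xr; [right|left; exact: NP].
have [y fx] := dom xS; have yr := frand xr fx.
have [k yk] : exists k, ~ open_of (heavy k) y.
  apply: contrapT => h; apply: (yr _ heavy_test) => k _.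
  by apply: contrapT => hk; apply: h; exists k.
exists k => //; split=> // -[a ha [t hE]]; apply: yk; apply/open_ofP; exists (size a).
by rewrite -(approx_value fE fx hE).
Qed.

(** The non-null set Q is covered by the preimages of the value strings of length t that are not
    heavy, each of measure at most 2^k 2^-t. The resulting bound does not depend on t and so passes
    to the intersection. *)
Lemma values_prefix_measure : 0 < lam (~` open_of S) ->
  exists2 r : R, 0 < r & forall t, r <= lam (open_of (value_strings t)).
Proof.
move=> /heavy_small[k mQ]; set Q := _ `\` _ in mQ * => Q0.
exists (lam Q * 2 ^- k); first by rewrite mulr_gt0 // ipow2_gt0.
move=> t; rewrite ler_pdivrMr ?pow2_gt0 // mulrC.
pose V := [set s | value_strings t s /\ ~ heavy k s].
have pfV : prefix_free V.
  by move=> s i [[st _] _] [[it _] _]; rewrite st -it size_take_min geq_minl.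
have h1 : lam (\bigcup_(a in V) preimage_of a) <= 2 ^+ k * lam (open_of V).
  rewrite -lee_fin EFinM (lam_open_sum _ pfV) -seq_sumZ; last by move=> s; rewrite ltW ?ipow2_gt0.
  apply: le_trans (lam_bigcup_sum _ _) _; first by move=> a _; exact: borel_preimage_of.
  apply: seq_sum_le => [a|a [_ /negP]]; first exact: lam_ge0.
  by rewrite -leNgt.
apply: (@le_trans _ _ (lam (\bigcup_(a in V) preimage_of a))).
  apply: lam_le => //; first by apply: borel_bigcup => a _; exact: borel_preimage_of.
  move=> x [xS xh]; have [y fx] := dom xS; have [fE1 _ _ _] := fE.
  have [u hu] := (fE1 x y).1 fx t; exists (prefix_of y t); last by exists u.
  split; last by move=> hy; apply: xh; exists (prefix_of y t) => //; exists u.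
  by split; [exact: size_prefix_of|exists x, y; rewrite size_prefix_of].
apply: le_trans h1 _; rewrite ler_pM2l ?pow2_gt0 //.
by apply: lam_le; [exact: borel_open..|move=> x [s [hs _] xs]; exists s].
Qed.

Lemma evens_values_measure : 0 < lam (~` open_of S) ->
  (0 < uniform_measure R (evens @^-1` values))%E.
Proof.
move=> /values_prefix_measure[r r0 hr].
have eV : evens @^-1` values = \bigcap_t (evens @^-1` open_of (value_strings t)).
  by rewrite values_cap preimage_bigcap.
have mV : borel (evens @^-1` values).
  by rewrite eV; apply: bigcapT_measurable => t; exact: borel_evens_open.
rewrite lamE // lte_fin; apply: lt_le_trans r0 _; rewrite leNgt; apply/negP.
rewrite eV => /lam_inf[||t].
- by move=> t; exact: borel_evens_open.
- by move=> s t st z; exact: value_strings_mono st _.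
rewrite lam_evens_open; first by rewrite ltNge hr.
by move=> s i [st _] [it _]; rewrite st -it size_take_min geq_minl.
Qed.
End Positive.
End Inversion.

(** * An inversion that succeeds with positive probability *)

Theorem theorem5p3 (R : realType) (f : pfun) (w : cantor_space)
    (hf : partial_computable f) (finj : pinjective f)
    (hw : le_LR R halting_set w) :
  ~ oneway R w f.
Proof.
move=> [_ [fpos frand]]; apply.
have [E [tE [fE tEE]]] := approximation hf.
have mD := borel_pdom fE.
have dpos : (0 < lam R (pdom f))%R by rewrite -lte_fin -lamE.
(* This makes the bound 1 - lam (pdom f) + 2 * 2^-j of [lam_bad] less than 1. *)
have [j hj] : exists j, (2 ^- j < lam R (pdom f) / 2)%R.
  by apply: small_ipow2; rewrite divr_gt0.
have [tG tGE] := minimal_bad_term tEE j.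
have pfG : prefix_free [set` minimal_bad E j] by rewrite minimal_badE; exact: minimal_prefix_free.
have openG : open_of [set` minimal_bad E j] = open_of [set` bad E j].
  by rewrite minimal_badE open_minimal.
have G1 : (lam R (open_of [set` minimal_bad E j]) < 1)%R.
  by rewrite openG; apply: le_lt_trans (lam_bad R fE j) _; lra.
have [S [[tS [F [tSF SF]]] GS S1]] := cover_halting_open hw pfG tGE G1.
have dom : ~` open_of S `<=` pdom f.
  move=> x xS; apply: (not_bad_pdom R fE) => xb; apply: xS; apply: GS.
  by rewrite openG; exact: xb.
have Spos : (0 < lam R (~` open_of S))%R by rewrite lamC ?subr_gt0 //; exact: borel_open.
have [g gw gP] := inversion_exists fE tEE finj tSF SF dom.
exists g => //; apply: lt_le_trans (evens_values_measure fE tEE SF dom frand Spos) _.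
(* Every [z] is the join of [evens z] and [odds z], so the inversion succeeds wherever [evens z] is
   a value. *)
apply: mu_mono => z [x xS fx]; exists (evens z), (odds z), x.
by rewrite oplus_evens_odds; split=> //; exact: gP fx _.
Qed.
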